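(* Let $m\ge2$ and let $\varphi=(\varphi_1,\varphi_2):\mathbb D\to\mathbb G_2$ be a weak $m$-extremal. Assume that $\varphi$ is not, up to composition with a holomorphic automorphism of $\mathbb G_2$, of the form $(0,\varphi_2)$ (that is, there is no holomorphic automorphism $\psi$ of $\mathbb G_2$ such that the first component of $\psi\circ\varphi$ is identically $0$). Then there are an integer $n$ with $1\le n\le m-1$, matrices $a_1,\dots,a_n\in\mathcal R_{II}$, a holomorphic function $Z:\mathbb D\to\mathbb D$ with $Z(0)=0$, and a unitary $2\times2$ matrix $U$ such that the map $$f(\lambda):=\Phi_{a_1}\Big(\lambda\,\Phi_{a_2}\Big(\cdots\lambda\,\Phi_{a_n}\Big(U\begin{pmatrix}\lambda&0\\0&Z(\lambda)\end{pmatrix}U^t\Big)\cdots\Big)\Big),\qquad \lambda\in\mathbb D$$ (that is, $f=F_1$ where $F_n(\lambda)=\Phi_{a_n}\big(U\,\mathrm{diag}(\lambda,Z(\lambda))\,U^t\big)$ and $F_j(\lambda)=\Phi_{a_j}(\lambda F_{j+1}(\lambda))$ for $1\le j<n$), satisfies $$\left(\frac{\varphi_1(\lambda)}2,\frac{\varphi_1(\lambda)}2,\varphi_2(\lambda)\right)=\pi\big({}^\tau f(\lambda)\big),\qquad\lambda\in\mathbb D.$$ Moreover, one may additionally assume that the lifting disc $f$ is chosen so that its entry $f_{11}$ does not vanish on $\mathbb D$.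
   Context: $\mathbb D$ is the open unit disc. The symmetrised bidisc $\mathbb G_2$ is the image of $\mathbb D^2$ under $(z_1,z_2)\mapsto(z_1+z_2,z_1z_2)$. $\mathcal R_{II}$ is the classical Cartan domain of the second type in $\mathbb C^{2\times2}$, i.e. the set of symmetric matrices $x\in\mathbb C^{2\times2}$ with $1-xx^*>0$. For $a\in\mathcal R_{II}$, $\Phi_a$ is the automorphism of $\mathcal R_{II}$ given by $$\Phi_a(x)=(1-aa^* )^{-1/2}(x-a)(1-a^*x)^{-1}(1-a^*a)^{1/2}.$$ $\pi:\mathbb C^{2\times2}\to\mathbb C^3$ is $\pi(z)=(z_{11},z_{22},\det z)$. For $a\in\mathbb C^{2\times2}$, ${}^\tau a$ is the matrix obtained from $a$ by interchanging its two columns. $U^t$ is the transpose of $U$. A holomorphic map $\varphi:\mathbb D\to D$ into a domain $D$ is a weak $m$-extremal if there are pairwise distinct points $\lambda_1,\dots,\lambda_m\in\mathbb D$ such that there is no map $g$ holomorphic on a neighbourhood of $\overline{\mathbb D}$ with $g(\overline{\mathbb D})\subset D$ and $g(\lambda_j)=\varphi(\lambda_j)$ for $j=1,\dots,m$.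
   Formalization: The final claim that f_11 does not vanish is stated only when φ(D) is not contained in the royal variety {(2w,w²)}; there it is false: for φ(λ)=(2λ,λ²), m=2, every such lifting f has f_11 ≡ 0. *)

(* Defs.v *)
From HB Require Import structures.
From mathcomp Require Export all_boot all_order all_algebra.
From mathcomp Require Export sesquilinear spectral complex.
From mathcomp Require Export all_classical all_reals.
From mathcomp Require Export topology normedtype derive.

Set Implicit Arguments.
Unset Strict Implicit.
Unset Printing Implicit Defensive.

Export Order.TTheory GRing.Theory Num.Theory.
Export numFieldNormedType.Exports.
#[global] Open Scope classical_set_scope.
#[global] Open Scope ring_scope.
#[global] Open Scope sesquilinear_scope.

(* The complex numbers are R[i] for R : realType.  They are
   packaged as a numClosedFieldType because the norm topology and the C-normed
   module structure (and not an R-linear one) are inherited from that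
   structure. *)
Definition Cplx (R : realType) : numClosedFieldType := R[i].

Section Holomorphy.
Variable R : realType.
Local Notation C := (Cplx R).

Definition disc : set C := [set z | `|z| < 1].
Definition closed_disc : set C := [set z | `|z| <= 1].

(* [differentiable] is taken over the scalars C, so this is Frechet
   C-differentiability.  It is only used for open A, and it depends only on the
   restriction of f to A: maps on a domain are total functions whose values
   off that domain are irrelevant. *)
Definition holomorphic_on (V W : normedModType C) (A : set V) (f : V -> W) :
  Prop := forall x, A x -> differentiable f x.

Definition automorphism (V : normedModType C) (D : set V) (psi : V -> V) :
  Prop :=
  [/\ holomorphic_on D psi, (forall x, D x -> D (psi x)) &
      exists psi' : V -> V,
        [/\ holomorphic_on D psi', (forall x, D x -> D (psi' x)),
            (forall x, D x -> psi' (psi x) = x) &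
            (forall x, D x -> psi (psi' x) = x)]].

Definition weak_extremal (V : normedModType C) (D : set V) (m : nat)
    (phi : C -> V) : Prop :=
  [/\ holomorphic_on disc phi, (forall z, disc z -> D (phi z)) &
      exists lam : 'I_m -> C,
        [/\ injective lam, (forall j, disc (lam j)) &
            ~ exists g : C -> V,
              [/\ exists N : set C,
                    [/\ open N, closed_disc `<=` N & holomorphic_on N g],
                  (forall z, closed_disc z -> D (g z)) &
                  (forall j, g (lam j) = phi (lam j))]]].

Definition symmetrised_bidisc : set (C * C) :=
  [set (z.1 + z.2, z.1 * z.2) | z in disc `*` disc].

(* The locus s^2 = 4p of the symmetrised bidisc.  For a weak extremal inside it,
   such as z |-> (2z, z^2), no lifting f into the Cartan domain has a
   nowhere-vanishing f_11: the first coordinate is 2h with h a Blaschke product,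
   f_12 = h, f_11 f_22 = h^2 - h^2 = 0, and |f_11|^2 < 1 - |h|^2, |f_22|^2 <
   1 - |h|^2 force f_11 = f_22 = 0 by the maximum principle. *)
Definition royal_variety : set (C * C) :=
  [set (z *+ 2, z ^+ 2) | z in disc].

End Holomorphy.

Section CartanDomain.
Variable R : realType.
Local Notation C := (Cplx R).

(* In the order of R[i], 0 < w means that w is real and positive, so A is
   automatically Hermitian. *)
Definition posdef (n : nat) (A : 'M[C]_n) : Prop :=
  forall v : 'cV[C]_n, v != 0 -> 0 < (v^t* *m A *m v) 0 0.

Definition cartan_II : set 'M[C]_2 :=
  [set x | x^T = x /\ posdef (1%:M - x *m x^t*)].

Definition sqrtmx (n : nat) (A : 'M[C]_n) : 'M[C]_n :=
  invmx (spectralmx A) *m diag_mx (map_mx sqrtC (spectral_diag A))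
    *m spectralmx A.

(* On positive definite matrices, [sqrtmx] is the positive square root. *)
Lemma sqrtmxK (n : nat) (A : 'M[C]_n) :
  A \is normalmx -> sqrtmx A *m sqrtmx A = A.
Proof.
move=> /orthomx_spectralP AE; rewrite [RHS]AE /sqrtmx.
have U := spectral_unit A.
rewrite -!mulmxA mulKVmx // (mulmxA (diag_mx _)); congr (_ *m (_ *m _)).
rewrite mulmx_diag; congr diag_mx; apply/rowP => i.
by rewrite !mxE -expr2 sqrtCK.
Qed.

Lemma sqrtmx_posdef (n : nat) (A : 'M[C]_n) :
  A \is normalmx -> posdef A -> posdef (sqrtmx A).
Proof.
move=> /orthomx_spectralP; set P := spectralmx A; set d := spectral_diag A.
move=> AE pA; have Pu : P \is unitarymx := spectral_unitarymx A.
have Pi : invmx P = P^t* by exact: invmx_unitary.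
have PP : P *m P^t* = 1%:M by apply/unitarymxP.
have Pn : P^t* *m P = 1%:M by rewrite -Pi mulVmx // spectral_unit.
have formE (e : 'rV[C]_n) (v : 'cV[C]_n) :
    (v^t* *m (P^t* *m diag_mx e *m P) *m v) 0 0 =
    \sum_i `|(P *m v) i 0| ^+ 2 * e 0 i.
  have -> : v^t* *m (P^t* *m diag_mx e *m P) *m v =
      (P *m v)^t* *m diag_mx e *m (P *m v).
    by rewrite trmx_mul map_mxM !mulmxA.
  rewrite mxE; apply: eq_bigr => i _.
  by rewrite mul_mx_diag normCK mxE mulrAC; congr (_ * _); rewrite mulrC !mxE.
have d_gt0 i : 0 < d 0 i.
  have nz : P^t* *m (delta_mx i 0 : 'cV[C]_n) != 0.
    apply/eqP => /(congr1 (mulmx P)); rewrite mulmxA PP mul1mx mulmx0.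
    by move=> /matrixP/(_ i 0)/eqP; rewrite !mxE !eqxx oner_eq0.
  have := pA _ nz; rewrite AE Pi formE mulmxA PP mul1mx (bigD1 i) //=.
  rewrite big1 ?addr0 => [|j /negbTE ji]; last first.
    by rewrite mxE ji /= normr0 expr0n mul0r.
  by rewrite mxE !eqxx normr1 expr1n mul1r.
move=> v nz; rewrite /sqrtmx -/P -/d Pi formE.
have [i vi] : exists i, (P *m v) i 0 != 0.
  apply/existsP; apply: contraR nz => /existsPn Pv0.
  suff Pv : P *m v = 0 by rewrite -[v]mul1mx -Pn -mulmxA Pv mulmx0.
  by apply/matrixP => i j; rewrite ord1 [RHS]mxE; apply/eqP/negbNE/Pv0.
rewrite (bigD1 i) //= ltr_pwDl //.
  by rewrite mulr_gt0 ?exprn_gt0 ?normr_gt0 // mxE sqrtC_gt0.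
apply: sumr_ge0 => j _.
by rewrite mulr_ge0 ?exprn_ge0 // mxE sqrtC_ge0 ltW.
Qed.

Definition cartan_Phi (a x : 'M[C]_2) : 'M[C]_2 :=
  invmx (sqrtmx (1%:M - a *m a^t*)) *m (x - a) *m invmx (1%:M - a^t* *m x)
    *m sqrtmx (1%:M - a^t* *m a).

(* For s = [:: a_1; ...; a_n] with n >= 1 this is
   Phi_{a_1}(z Phi_{a_2}(... z Phi_{a_n}(G z) ...)); there is no factor z in
   front of G z, so the singleton is the base case and [::] is junk. *)
Fixpoint lift_disc (s : seq 'M[C]_2) (G : C -> 'M[C]_2) (z : C) : 'M[C]_2 :=
  match s with
  | [::] => G z
  | [:: a] => cartan_Phi a (G z)
  | a :: s' => cartan_Phi a (z *: lift_disc s' G z)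
  end.

Definition diag2 (x y : C) : 'M[C]_2 := diag_mx (\row_(i < 2) [:: x; y]`_i).

Definition swap_columns (a : 'M[C]_2) : 'M[C]_2 := xcol 0 1 a.

Definition proj_tetra (z : 'M[C]_2) : C * C * C := (z 0 0, z 1 1, \det z).

End CartanDomain.

(* Main.v *)
Require Import Defs.
From mathcomp Require Import exp trigo sequences.
From mathcomp Require Import cyclic separable cyclotomic.
From mathcomp Require Import ring lra zify.

(** Why the theorem is true.

Write phi = (s, p), h = s / 2, and look for a symmetric disc F with rows (x, h)
and (h, y).  The requirement on the projection is x y = h^2 - p.  If moreover
|x| = |y|, then the singular values of F are |z1| and |z2| for s = z1 + z2 and
p = z1 z2.  A factorisation of h^2 - p with |x| = |y| on the unit circle thus
makes F contractive on the circle, hence on the disc by the maximum principle.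
To find it, phi is approximated by polynomials ([poly_approx]): their
discriminant is the product of a zero-free function, whose square root is x, and
of a finite Blaschke product B, and y = x B ([lift_approx]).  A limit of these
approximate liftings is a lifting ([lifting]).  That x is zero-free also in the
limit, unless the discriminant vanishes identically, is a Harnack-type bound for
functions having roots of every order ([tower_lower_bound]).

If F touches the boundary of the Cartan domain, the strong maximum principle
shows that F = V diag(1, W) V^T with a constant unitary V ([boundary_form]).
Then phi lies on a flat geodesic s = b + conj b p, which an automorphism of the
symmetrised bidisc moves to s = 0 ([lift_boundary]); this is the excluded case.
So F takes its values in the Cartan domain.

Weak extremality says that no disc which is strict up to the circle agrees with
F at the nodes, for its projection would agree with phi there.  Hence the Schur
algorithm at the nodes meets a disc touching the boundary after at most m - 1
steps ([interpolation_or_degree]).  The record kept of this is that F maps some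
nonzero vector polynomial P of degree at most d < m to a polynomial Q, and the
reversed conjugate of Q to that of P ([inner_degree]).  The property no longer
refers to the nodes, and the Schur algorithm at 0 lowers d by one at each step:
if the disc vanishes at 0, then so does Q, and P loses its leading coefficient
([inner_degree_div]).  Therefore this
algorithm too ends with a disc V diag(1, W) V^T after n <= d steps; multiplied by
z it is the innermost disc of the formula, with Z(z) = z W(z)
([schur_algorithm]).

The complex analysis needed here rests on Goursat's lemma ([goursat]), proved for
trapezoid sums in place of integrals.  In the coordinate log z it gives the mean
value inequality, from which the maximum principle, also with finitely many
exceptional points, follows.  The latter yields the Schwarz lemma, the division
of f - f(c) by z - c ([divide]) and hence derivative estimates which are uniform
over bounded functions, so that pointwise limits along an ultrafilter are
holomorphic ([montel]). *)

Set Implicit Arguments.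
Unset Strict Implicit.
Unset Printing Implicit Defensive.

(** * The modulus as a real number *)

Section Modulus.
Variable R : realType.
Local Notation C := (Cplx R).
Implicit Types (x y z w : C) (k : R).

Definition nr z : R := complex.Re `|z|.

Lemma nrE z : nr z = Num.sqrt (complex.Re z ^+ 2 + complex.Im z ^+ 2).
Proof. by rewrite /nr normc_def. Qed.

Lemma nrC z : (nr z)%:C%C = `|z|.
Proof. by rewrite /nr normc_def. Qed.

Lemma nr_ge0 z : 0 <= nr z. Proof. by rewrite nrE sqrtr_ge0. Qed.

Lemma nr_sqr z : nr z ^+ 2 = complex.Re z ^+ 2 + complex.Im z ^+ 2.
Proof. by rewrite nrE sqr_sqrtr // addr_ge0 ?sqr_ge0. Qed.

Lemma nr0 : nr (0 : C) = 0. Proof. by rewrite /nr normr0. Qed.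
Lemma nr1 : nr (1 : C) = 1. Proof. by rewrite /nr normr1. Qed.

Lemma nr_eq0 z : (nr z == 0) = (z == 0).
Proof.
rewrite -(normr_eq0 z) /nr; apply/eqP/eqP => [h|->//].
by rewrite -nrC /nr h.
Qed.

Lemma nr_gt0 z : (0 < nr z) = (z != 0).
Proof. by rewrite lt_neqAle nr_ge0 andbT eq_sym nr_eq0. Qed.

Lemma nrM x y : nr (x * y) = nr x * nr y.
Proof. by apply: (@complexI R); rewrite rmorphM /= !nrC normrM. Qed.

Lemma nrX n x : nr (x ^+ n) = nr x ^+ n.
Proof. by apply: (@complexI R); rewrite rmorphXn /= !nrC normrX. Qed.

Lemma nrV x : nr x^-1 = (nr x)^-1.
Proof.
apply: (@complexI R); rewrite nrC normfV -nrC.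
by rewrite -(fmorphV (real_complex R)).
Qed.

Lemma nr_div x y : nr (x / y) = nr x / nr y.
Proof. by rewrite nrM nrV. Qed.

Lemma nrN x : nr (- x) = nr x. Proof. by rewrite /nr normrN. Qed.

Lemma nrB x y : nr (x - y) = nr (y - x). Proof. by rewrite -nrN opprB. Qed.

Lemma nrD x y : nr (x + y) <= nr x + nr y.
Proof. by rewrite -lecR rmorphD /= !nrC ler_normD. Qed.

Lemma nr_le_sub x y : nr x - nr y <= nr (x - y).
Proof. by rewrite lerBlDr (le_trans _ (nrD _ _)) // subrK. Qed.

Lemma nr_le_add x y : nr (x - y) <= nr x + nr y.
Proof. by rewrite (le_trans (nrD _ _)) // nrN. Qed.

Lemma nr_real k : nr (k%:C%C : C) = `|k|.
Proof. by rewrite nrE /= expr0n /= addr0 sqrtr_sqr. Qed.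

Lemma nr_nat n : nr (n%:R : C) = n%:R.
Proof.
have -> : (n%:R : C) = (n%:R)%:C%C by rewrite -(rmorph_nat (real_complex R)).
by rewrite nr_real normr_nat.
Qed.

Lemma nr_conj z : nr z^* = nr z. Proof. by rewrite /nr norm_conjC. Qed.

Lemma nr_sum (I : Type) (s : seq I) (P : pred I) (F : I -> C) :
  nr (\sum_(i <- s | P i) F i) <= \sum_(i <- s | P i) nr (F i).
Proof.
elim/big_rec2: _ => [|i y x _ h]; first by rewrite nr0.
by apply: le_trans (nrD _ _) _; rewrite lerD2l.
Qed.

Lemma nr_prod (I : Type) (s : seq I) (P : pred I) (F : I -> C) :
  nr (\prod_(i <- s | P i) F i) = \prod_(i <- s | P i) nr (F i).
Proof. by rewrite (big_morph nr nrM nr1). Qed.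

Lemma nr_ltP z k : (`|z| < k%:C%C) = (nr z < k).
Proof. by rewrite -nrC ltcR. Qed.

Lemma nr_leP z k : (`|z| <= k%:C%C) = (nr z <= k).
Proof. by rewrite -nrC lecR. Qed.

Lemma discE z : disc z = (nr z < 1) :> Prop.
Proof. by rewrite /disc /= -(nr_ltP z 1). Qed.

Lemma closed_discE z : closed_disc z = (nr z <= 1) :> Prop.
Proof. by rewrite /closed_disc /= -(nr_leP z 1). Qed.

Lemma sqr_nrC z : (nr z ^+ 2)%:C%C = z * z^* :> C.
Proof. by rewrite rmorphXn /= nrC normCK. Qed.

Lemma re_le_nr z : `|complex.Re z| <= nr z.
Proof. by rewrite nrE -sqrtr_sqr ler_wsqrtr // lerDl sqr_ge0. Qed.

Lemma im_le_nr z : `|complex.Im z| <= nr z.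
Proof. by rewrite nrE -sqrtr_sqr ler_wsqrtr // lerDr sqr_ge0. Qed.

Lemma nr_le_reim z : nr z <= `|complex.Re z| + `|complex.Im z|.
Proof.
have h1 := normr_ge0 (complex.Re z); have h2 := normr_ge0 (complex.Im z).
rewrite -(@ler_pXn2r _ 2) ?nnegrE ?nr_ge0 ?addr_ge0 //.
rewrite nr_sqr -[complex.Re z ^+ 2]real_normK ?num_real //.
rewrite -[complex.Im z ^+ 2]real_normK ?num_real //; nra.
Qed.

Lemma reD x y : complex.Re (x + y) = complex.Re x + complex.Re y.
Proof. by case: x y => a b []. Qed.
Lemma imD x y : complex.Im (x + y) = complex.Im x + complex.Im y.
Proof. by case: x y => a b []. Qed.
Lemma reN x : complex.Re (- x) = - complex.Re x.
Proof. by case: x. Qed.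
Lemma imN x : complex.Im (- x) = - complex.Im x.
Proof. by case: x. Qed.
Lemma reM x y : complex.Re (x * y) =
  complex.Re x * complex.Re y - complex.Im x * complex.Im y.
Proof. by case: x y => a b []. Qed.
Lemma imM x y : complex.Im (x * y) =
  complex.Re x * complex.Im y + complex.Im x * complex.Re y.
Proof. by case: x y => a b []. Qed.
Lemma re_conj x : complex.Re x^* = complex.Re x.
Proof. by case: x. Qed.
Lemma im_conj x : complex.Im x^* = - complex.Im x.
Proof. by case: x. Qed.
Lemma re_real k : complex.Re (k%:C%C : C) = k. Proof. by []. Qed.
Lemma im_real k : complex.Im (k%:C%C : C) = 0. Proof. by []. Qed.
Lemma re_nat n : complex.Re (n%:R : C) = n%:R.
Proof. by rewrite -(rmorph_nat (real_complex R)). Qed.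
Lemma im_nat n : complex.Im (n%:R : C) = 0.
Proof. by rewrite -(rmorph_nat (real_complex R)). Qed.
Lemma re1 : complex.Re (1 : C) = 1. Proof. by []. Qed.
Lemma im1 : complex.Im (1 : C) = 0. Proof. by []. Qed.
Lemma re0 : complex.Re (0 : C) = 0. Proof. by []. Qed.
Lemma im0 : complex.Im (0 : C) = 0. Proof. by []. Qed.

Definition reimE := (reD, imD, reN, imN, reM, imM, re_conj, im_conj, re_real,
  im_real, re_nat, im_nat, re1, im1, re0, im0).

Lemma real_eps (e : C) : 0 < e -> exists2 k : R, 0 < k & e = k%:C%C.
Proof.
move=> e0; have er : e \is Num.real by rewrite realE ltW.
by case/complex_realP: er e0 => k ->; rewrite ltcR => k0; exists k.
Qed.

(** With a factor c that is independent of e, the constants in front of the small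
errors in the estimates below need no normalisation. *)
Lemma le_eps (a b c : R) : (forall e, 0 < e -> a <= b + c * e) -> a <= b.
Proof.
move=> h; apply/ler_addgt0Pr => e e0.
have c1 : 0 < `|c| + 1 by rewrite ltr_wpDl.
apply: le_trans (h _ (divr_gt0 e0 c1)) _; rewrite lerD2l mulrA ler_pdivrMr //.
rewrite mulrC ler_pM2l //; apply: le_trans (ler_norm _) _; lra.
Qed.

End Modulus.

(** * Complex differentiability at a point *)

Section Differentiability.
Variable R : realType.
Local Notation C := (Cplx R).
Implicit Types (f g : C -> C) (z w : C).

Definition cont f z := forall e : R, 0 < e ->
  exists2 d : R, 0 < d & forall w, nr (w - z) < d -> nr (f w - f z) <= e.

Lemma nbhs_nrP z (P : C -> Prop) :
  (\forall w \near z, P w) <->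
  exists2 d : R, 0 < d & forall w, nr (w - z) < d -> P w.
Proof.
split.
  move/nbhs_normP => [e /= /real_eps [k k0 ->] h]; exists k => // w hw.
  by apply: h; rewrite /= nr_ltP nrB.
case=> d d0 h; apply/nbhs_normP; exists (d%:C%C); first by rewrite /= ltcR.
by move=> w /=; rewrite nr_ltP nrB; apply: h.
Qed.

Lemma contP f z : {for z, continuous f} <-> cont f z.
Proof.
split=> [h e e0|h].
  have/cvgr_dist_le/(_ (e%:C%C)) := h; rewrite ltcR => /(_ e0) /nbhs_nrP.
  by case=> d d0 H; exists d => // w /H; rewrite nr_leP nrB.
suff H : f @ nbhs z --> nbhs (f z) by exact: H.
apply/cvgrPdist_le => _ /real_eps [k k0 ->]; apply/nbhs_nrP.
by have [d d0 H] := h _ k0; exists d => // w /H; rewrite nr_leP nrB.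
Qed.

Lemma differentiable_cont f z : differentiable f z -> cont f z.
Proof. by move=> /differentiable_continuous h; apply/contP. Qed.

Definition has_deriv f z d := forall e : R, 0 < e ->
  exists2 r : R, 0 < r &
    forall w, nr (w - z) < r -> nr (f w - f z - d * (w - z)) <= e * nr (w - z).

Lemma has_derivP f z : differentiable f z <-> exists d, has_deriv f z d.
Proof.
rewrite -derivable1_diffP; split.
  move=> /cvg_ex [d hd]; exists d => e e0.
  have H := proj1 (@cvgrPdist_le _ _ _ _ (@dnbhs_filter _ 0) _ _) hd.
  have := H (e%:C%C); rewrite ltcR => /(_ e0).
  rewrite /dnbhs /within /= => /nbhs_nrP [r r0 h]; exists r => // w hw.
  have [->|nz] := eqVneq w z; first by rewrite !subrr mulr0 subrr nr0 mulr0.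
  have wz : w - z != 0 by rewrite subr_eq0.
  have := h (w - z); rewrite subr0 => /(_ hw wz).
  rewrite /= nr_leP /GRing.scale /= mulr1 subrK => h1.
  have -> : f w - f z - d * (w - z) =
      - ((d - (w - z)^-1 * (f w - f z)) * (w - z)) by field.
  by rewrite nrN nrM ler_wpM2r ?nr_ge0.
case=> d h; apply/cvg_ex; exists d; apply/cvgrPdist_le => _ /real_eps [e e0 ->].
have [r r0 hr] := h _ e0; rewrite /dnbhs /within /=; apply/nbhs_nrP.
exists r => // w; rewrite subr0 => hw w0.
have := hr (w + z); rewrite addrK => /(_ hw).
rewrite nr_leP /GRing.scale /= mulr1 => h1.
have -> : d - w^-1 * (f (w + z) - f z) = - ((f (w + z) - f z - d * w) / w).
  by field.
by rewrite nrN nr_div ler_pdivrMr // nr_gt0.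
Qed.

Lemma differentiable_near f g z (r : R) : 0 < r ->
  (forall w, nr (w - z) < r -> f w = g w) ->
  differentiable f z -> differentiable g z.
Proof.
move=> r0 fg /has_derivP [d h]; apply/has_derivP; exists d => e /h [s s0 hs].
exists (Num.min r s); first by rewrite lt_min r0.
move=> w; rewrite lt_min => /andP[wr ws].
by rewrite -!fg ?subrr ?nr0 //; apply: hs.
Qed.

Lemma differentiable_ext f g z :
  f =1 g -> differentiable f z -> differentiable g z.
Proof. by move=> /funext ->. Qed.

End Differentiability.

Section Calculus.
Variable R : realType.
Local Notation C := (Cplx R).
Implicit Types (f g : C -> C) (z w c : C).

Lemma diffable_cst c z : differentiable (fun _ : C => c) z.
Proof. exact: differentiable_cst. Qed.

Lemma diffable_id z : differentiable (fun w : C => w) z.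
Proof. by apply/derivable1_diffP; apply: derivable_id. Qed.

Lemma diffableD f g z : differentiable f z -> differentiable g z ->
  differentiable (fun w => f w + g w) z.
Proof. exact: differentiableD. Qed.

Lemma diffableB f g z : differentiable f z -> differentiable g z ->
  differentiable (fun w => f w - g w) z.
Proof. exact: differentiableB. Qed.

Lemma diffableM f g z : differentiable f z -> differentiable g z ->
  differentiable (fun w => f w * g w) z.
Proof. exact: differentiableM. Qed.

Lemma diffableV f z : differentiable f z -> f z != 0 ->
  differentiable (fun w => (f w)^-1) z.
Proof. exact: differentiableV. Qed.

Lemma diffable_div f g z : differentiable f z -> differentiable g z ->
  g z != 0 -> differentiable (fun w => f w / g w) z.
Proof. by move=> hf hg g0; exact: diffableM hf (diffableV hg g0). Qed.

Lemma diffableX f z n : differentiable f z ->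
  differentiable (fun w => f w ^+ n) z.
Proof.
move=> hf; elim: n => [|n IH]; first exact: diffable_cst.
apply: (@differentiable_ext _ (fun w => f w * f w ^+ n)) => [w|].
  by rewrite exprS.
exact: diffableM.
Qed.

Lemma diffable_comp f g z : differentiable f z -> differentiable g (f z) ->
  differentiable (fun w => g (f w)) z.
Proof. exact: differentiable_comp. Qed.

Lemma diffable_sum (I : Type) (s : seq I) (P : pred I) (F : I -> C -> C) z :
  (forall i, differentiable (F i) z) ->
  differentiable (fun w => \sum_(i <- s | P i) F i w) z.
Proof.
move=> h; elim: s => [|i s IH].
  apply: differentiable_ext (diffable_cst 0 z) => w; by rewrite big_nil.
have [p|p] := boolP (P i).
  apply: differentiable_ext (diffableD (h i) IH) => w; by rewrite big_cons p.
by apply: differentiable_ext IH => w; rewrite big_cons (negbTE p).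
Qed.

Lemma diffable_prod (I : Type) (s : seq I) (P : pred I) (F : I -> C -> C) z :
  (forall i, differentiable (F i) z) ->
  differentiable (fun w => \prod_(i <- s | P i) F i w) z.
Proof.
move=> h; elim: s => [|i s IH].
  apply: differentiable_ext (diffable_cst 1 z) => w; by rewrite big_nil.
have [p|p] := boolP (P i).
  apply: differentiable_ext (diffableM (h i) IH) => w; by rewrite big_cons p.
by apply: differentiable_ext IH => w; rewrite big_cons (negbTE p).
Qed.

Lemma diffable_horner (p : {poly C}) z : differentiable (fun w => p.[w]) z.
Proof.
apply: (@differentiable_ext _
  (fun w => \sum_(i <- index_enum 'I_(size p)) p`_i * w ^+ i)).
  by move=> w; rewrite horner_coef.
by apply: diffable_sum => i; apply: diffableM (diffable_cst _ _) _;
  apply: diffableX; apply: diffable_id.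
Qed.

End Calculus.

(** * Goursat's lemma for trapezoid sums *)

Section Goursat.
Variable R : realType.
Local Notation C := (Cplx R).
Implicit Types (f g : C -> C) (z w a b u v A : C) (e : R) (n : nat).

(** The trapezoid rule on 2^n equal pieces of the segment from a to b.  Working
with these sums for all n at once replaces the integral along the segment:
bisecting a segment turns level n.+1 into level n exactly, and no convergence
is needed. *)
Fixpoint trap f n a b : C :=
  if n is m.+1 then trap f m a ((a + b) / 2) + trap f m ((a + b) / 2) b
  else (f a + f b) / 2 * (b - a).

Lemma trap_rev f n a b : trap f n b a = - trap f n a b.
Proof.
elim: n a b => [|n IH] a b /=; first by field.
by rewrite (addrC b a) (IH a) (IH _ b); ring.
Qed.

Lemma trap_shift f n a b c :
  trap f n (a + c) (b + c) = trap (fun w => f (w + c)) n a b.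
Proof.
elim: n a b => [|n IH] a b /=; first by ring.
have -> : (a + c + (b + c)) / 2 = (a + b) / 2 + c by field.
by rewrite !IH.
Qed.

Lemma trapB f g n a b :
  trap (fun w => f w - g w) n a b = trap f n a b - trap g n a b.
Proof. by elim: n a b => [|n IH] a b /=; rewrite ?IH; ring. Qed.

Lemma trap_affine al be n a b : trap (fun w => al + be * w) n a b =
  al * (b - a) + be * (b ^+ 2 - a ^+ 2) / 2.
Proof. by elim: n a b => [|n IH] a b /=; rewrite ?IH; field. Qed.

Lemma half_nr (w : C) : nr (w / 2) = nr w / 2.
Proof. by rewrite nr_div nr_nat. Qed.

Lemma trap_bound f n a b k :
  (forall t : R, 0 <= t <= 1 -> nr (f (a + t%:C%C * (b - a))) <= k) ->
  nr (trap f n a b) <= k * nr (b - a).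
Proof.
elim: n a b => [|n IH] a b h /=.
  have h0 : nr (f a) <= k.
    by have := h 0; rewrite rmorph0 mul0r addr0 lexx ler01; apply.
  have h1 : nr (f b) <= k.
    by have := h 1; rewrite rmorph1 mul1r addrC subrK lexx ler01; apply.
  rewrite nrM half_nr ler_wpM2r ?nr_ge0 //.
  by have := nrD (f a) (f b); lra.
have two : (2 : C) = (2 : R)%:C%C by rewrite -(rmorph_nat (real_complex R)).
have d1 : (a + b) / 2 - a = (b - a) / 2 by field.
have d2 : b - (a + b) / 2 = (b - a) / 2 by field.
apply: le_trans (nrD _ _) _.
have e1 : nr (trap f n a ((a + b) / 2)) <= k * (nr (b - a) / 2).
  rewrite -half_nr -d1; apply: IH => t t01.
  have -> : a + t%:C%C * ((a + b) / 2 - a) = a + (t / 2)%:C%C * (b - a).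
    by rewrite d1 rmorphM /= fmorphV /= two; ring.
  by apply: h; lra.
have e2 : nr (trap f n ((a + b) / 2) b) <= k * (nr (b - a) / 2).
  rewrite -half_nr -d2; apply: IH => t t01.
  have -> : (a + b) / 2 + t%:C%C * (b - (a + b) / 2) =
            a + ((1 + t) / 2)%:C%C * (b - a).
    by rewrite d2 rmorphM /= fmorphV /= rmorphD rmorph1 -two; field.
  by apply: h; lra.
by lra.
Qed.

Definition par f n A u v : C :=
  trap f n A (A + u) + trap f n (A + u) (A + u + v) +
  trap f n (A + u + v) (A + v) + trap f n (A + v) A.

Lemma par_split f n A u v : par f n.+1 A u v =
  par f n A (u / 2) (v / 2) + par f n (A + u / 2) (u / 2) (v / 2) +
  par f n (A + v / 2) (u / 2) (v / 2) +
  par f n (A + u / 2 + v / 2) (u / 2) (v / 2).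
Proof.
rewrite /par /=.
have -> : (A + (A + u)) / 2 = A + u / 2 by field.
have -> : (A + u + (A + u + v)) / 2 = A + u + v / 2 by field.
have -> : (A + u + v + (A + v)) / 2 = A + u / 2 + v by field.
have -> : (A + v + A) / 2 = A + v / 2 by field.
have -> : A + u / 2 + u / 2 = A + u by field.
have -> : A + v / 2 + u / 2 = A + u / 2 + v / 2 by ring.
have -> : A + u / 2 + v / 2 + u / 2 = A + u + v / 2 by field.
have -> : A + v / 2 + v / 2 = A + v by field.
have -> : A + u / 2 + v / 2 + v / 2 = A + u / 2 + v by field.
have -> : A + u + v / 2 + v / 2 = A + u + v by field.
rewrite (trap_rev f n (A + u / 2) (A + u / 2 + v / 2)).
rewrite (trap_rev f n (A + v / 2) (A + u / 2 + v / 2)).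
rewrite (trap_rev f n (A + u / 2 + v / 2) (A + u + v / 2)).
rewrite (trap_rev f n (A + u / 2 + v / 2) (A + u / 2 + v)).
by ring.
Qed.

(** Affine functions contribute nothing, so only the deviation from an affine
function counts. *)
Lemma par_bound f n A u v al be k :
  (forall s t : R, 0 <= s <= 1 -> 0 <= t <= 1 ->
     let w := A + s%:C%C * u + t%:C%C * v in nr (f w - (al + be * w)) <= k) ->
  nr (par f n A u v) <= k * (2 * (nr u + nr v)).
Proof.
move=> h; pose g w := al + be * w.
have I0 : 0 <= (0 : R) <= 1 by rewrite lexx ler01.
have I1 : 0 <= (1 : R) <= 1 by rewrite lexx ler01.
have -> : par f n A u v = par (fun w => f w - g w) n A u v.
  rewrite /par !trapB (_ : trap g = trap (fun w => al + be * w)) //.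
  by rewrite !trap_affine; ring.
rewrite /par; set G := fun w => _.
have b1 : nr (trap G n A (A + u)) <= k * nr u.
  rewrite -{2}[u](addKr A) (addrC (- A)).
  apply: trap_bound => t t01; have := h t 0 t01 I0.
  by rewrite /= rmorph0 mul0r addr0 (addrC A u) addrK.
have b2 : nr (trap G n (A + u) (A + u + v)) <= k * nr v.
  rewrite -{2}[v](addKr (A + u)) (addrC (- _)).
  apply: trap_bound => t t01; have := h 1 t I1 t01.
  by rewrite /= rmorph1 mul1r (addrC (A + u) v) addrK.
have b3 : nr (trap G n (A + u + v) (A + v)) <= k * nr u.
  have e : nr u = nr (A + v - (A + u + v)) by rewrite -nrN; congr nr; ring.
  rewrite e.
  apply: trap_bound => t t01; have t01' : 0 <= 1 - t <= 1 by lra.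
  have := h (1 - t) 1 t01' I1; rewrite /= rmorph1 mul1r rmorphB rmorph1.
  by congr (nr (G _) <= _); ring.
have b4 : nr (trap G n (A + v) A) <= k * nr v.
  have e : nr v = nr (A - (A + v)) by rewrite -nrN; congr nr; ring.
  rewrite e.
  apply: trap_bound => t t01; have t01' : 0 <= 1 - t <= 1 by lra.
  have := h 0 (1 - t) I0 t01'; rewrite /= rmorph0 mul0r rmorphB rmorph1.
  by congr (nr (G _) <= _); ring.
apply: le_trans (nrD _ _) _; apply: le_trans (lerD (nrD _ _) b4) _.
apply: le_trans (lerD (lerD (nrD _ _) b3) (lexx _)) _.
by lra.
Qed.

Lemma nested_point (s r : nat -> R) : (forall j k : nat, s j <= s k + r k) ->
  exists x, forall k : nat, s k <= x <= s k + r k.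
Proof.
move=> h; exists (sup (range s)) => k; apply/andP; split.
  apply: ub_le_sup; last by exists k.
  by exists (s 0 + r 0) => _ [j _ <-]; exact: (h j 0).
by apply: ge_sup => [|_ [j _ <-]]; [exists (s 0), 0 | exact: h].
Qed.

Lemma inv2X_le1 n : (2^-1 : R) ^+ n <= 1.
Proof. by apply: exprn_ile1; lra. Qed.

Lemma inv2X_gt0 n : 0 < (2^-1 : R) ^+ n.
Proof. by apply: exprn_gt0; lra. Qed.

Lemma inv2X_small (e : R) : 0 < e -> exists n, (2^-1 : R) ^+ n < e.
Proof.
move=> e0; have [n hn] : exists n : nat, e^-1 < n%:R.
  by exists (Num.truncn e^-1).+1; exact: truncnS_gt.
exists n; rewrite exprVn invf_plt ?posrE ?exprn_gt0 //.
apply: lt_le_trans hn _; rewrite -natrX ler_nat.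
exact/ltnW/ltn_expl.
Qed.

(** The statement only mentions arbitrarily fine sums: some subparallelogram of
every generation keeps its share of a persistent excess, and these shrink to a
point where f is affine up to a small error. *)
Theorem goursat f A u v :
  (forall s t : R, 0 <= s <= 1 -> 0 <= t <= 1 ->
     differentiable f (A + s%:C%C * u + t%:C%C * v)) ->
  forall e, 0 < e -> exists n0, forall n, (n0 <= n)%N -> nr (par f n A u v) <= e.
Proof.
move=> df e e0; apply: contrapT => bad0.
pose h (k : nat) : R := 2^-1 ^+ k.
have hS (k : nat) : h k.+1 = h k / 2 by rewrite /h exprSr.
have h0 : h 0 = 1 by rewrite /h expr0.
have hp (k : nat) : 0 < h k by apply: inv2X_gt0.
pose P (k : nat) (st : R * R) :=
  A + (st.1)%:C%C * u + (st.2)%:C%C * v.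
pose bad (k : nat) (st : R * R) := ~ exists n0, forall n, (n0 <= n)%N ->
  nr (par f n (P k st) ((h k)%:C%C * u) ((h k)%:C%C * v)) <= e * h k ^+ 2.
have two : (2 : C) = (2 : R)%:C%C by rewrite -(rmorph_nat (real_complex R)).
have step (k : nat) st : bad k st -> exists st', bad k.+1 st' /\
    ((st'.1 = st.1 \/ st'.1 = st.1 + h k.+1) /\
     (st'.2 = st.2 \/ st'.2 = st.2 + h k.+1)).
  move=> b; apply: contrapT => nb; apply: b.
  have good s t : (s = st.1 \/ s = st.1 + h k.+1) ->
      (t = st.2 \/ t = st.2 + h k.+1) ->
      exists n0, forall n, (n0 <= n)%N -> nr (par f n (P k.+1 (s, t))
        ((h k.+1)%:C%C * u) ((h k.+1)%:C%C * v)) <= e * h k.+1 ^+ 2.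
    by move=> hs ht; apply: contrapT => b; apply: nb; exists (s, t).
  have [n1 H1] := good _ _ (or_introl erefl) (or_introl erefl).
  have [n2 H2] := good _ _ (or_intror erefl) (or_introl erefl).
  have [n3 H3] := good _ _ (or_introl erefl) (or_intror erefl).
  have [n4 H4] := good _ _ (or_intror erefl) (or_intror erefl).
  exists (n1 + n2 + n3 + n4).+1 => -[//|n] hn; rewrite par_split.
  have half c : (h k)%:C%C * c / 2 = (h k.+1)%:C%C * c.
    by rewrite hS rmorphM /= fmorphV /= -two; ring.
  rewrite !half.
  have E2 : P k st + (h k.+1)%:C%C * u = P k.+1 (st.1 + h k.+1, st.2).
    by rewrite /P /= rmorphD; ring.
  have E3 : P k st + (h k.+1)%:C%C * v = P k.+1 (st.1, st.2 + h k.+1).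
    by rewrite /P /= rmorphD; ring.
  have E4 : P k st + (h k.+1)%:C%C * u + (h k.+1)%:C%C * v =
      P k.+1 (st.1 + h k.+1, st.2 + h k.+1).
    by rewrite /P /= !rmorphD; ring.
  rewrite E4 E2 E3.
  have {}H1 := H1 n ltac:(lia); have {}H2 := H2 n ltac:(lia).
  have {}H3 := H3 n ltac:(lia); have {}H4 := H4 n ltac:(lia).
  apply: le_trans (nrD _ _) _; apply: le_trans (lerD (nrD _ _) H4) _.
  apply: le_trans (lerD (lerD (nrD _ _) H3) (lexx _)) _.
  apply: le_trans (lerD (lerD (lerD H1 H2) (lexx _)) (lexx _)) _.
  by rewrite hS; nra.
have bad00 : bad 0%N (0, 0).
  move=> [n0 H]; apply: bad0; exists n0 => n /H.
  by rewrite /P h0 /= rmorph0 rmorph1 !mul0r !mul1r !addr0 expr1n mulr1.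
have [st [st0 stS]] : exists st : nat -> R * R, st 0%N = (0, 0) /\
    forall k : nat, bad k (st k) /\
      ((st k.+1).1 = (st k).1 \/ (st k.+1).1 = (st k).1 + h k.+1) /\
      ((st k.+1).2 = (st k).2 \/ (st k.+1).2 = (st k).2 + h k.+1).
  pose T (k : nat) := {x : R * R | bad k x}.
  pose nx (k : nat) (x : T k) : T k.+1 :=
    let y := cid (step k (sval x) (svalP x)) in
    exist _ (sval y) (proj1 (svalP y)).
  pose ch := fix ch (k : nat) : T k :=
    if k is j.+1 then nx j (ch j) else exist _ (0, 0) bad00.
  exists (fun k => sval (ch k)); split=> // k; split; first exact: svalP (ch k).
  by rewrite /= /nx; case: cid => /= y [].
have nest (s : nat -> R) : s 0%N = 0 ->
    (forall k : nat, s k.+1 = s k \/ s k.+1 = s k + h k.+1) ->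
    exists x, (forall k : nat, s k <= x <= s k + h k) /\
      forall k : nat, 0 <= s k /\ s k + h k <= 1.
  move=> s0 sS.
  have up j (k : nat) : s j <= s (j + k)%N.
    elim: k => [|k IH]; first by rewrite addn0.
    by rewrite addnS; case: (sS (j + k)%N) => ->; have := hp (j + k).+1; lra.
  have dn j (k : nat) : s (j + k)%N + h (j + k)%N <= s j + h j.
    elim: k => [|k IH]; first by rewrite addn0.
    rewrite addnS; apply: le_trans IH; rewrite hS.
    by case: (sS (j + k)%N) => ->; rewrite ?hS; have := hp (j + k)%N; lra.
  have [|x hx] := @nested_point s h.
    move=> j k; have := up j k; have := dn k j.
    by rewrite (addnC k); have := hp (j + k)%N; lra.
  exists x; split=> // k; split.
    by rewrite -s0; exact: (up 0%N k).
  by have := dn 0%N k; rewrite s0 h0 add0n; lra.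
have [|k|x [hx hx1]] := nest (fun k => (st k).1); first by rewrite st0.
  by have [_ []] := stS k.
have [|k|y [hy hy1]] := nest (fun k => (st k).2); first by rewrite st0.
  by have [_ []] := stS k.
pose z := A + x%:C%C * u + y%:C%C * v.
have [d hd] : exists d, has_deriv f z d.
  apply/has_derivP; apply: df.
    by have := hx 0%N; have := hx1 0%N; rewrite st0 /= h0; lra.
  by have := hy 0%N; have := hy1 0%N; rewrite st0 /= h0; lra.
pose L := nr u + nr v + 1.
have L1 : 1 <= L by rewrite /L; have := nr_ge0 u; have := nr_ge0 v; lra.
have uL : nr u + nr v <= L by rewrite /L; lra.
have L0 : 0 < L by lra.
have [r r0 hr] := hd (e / (2 * L ^+ 2)) ltac:(by apply: divr_gt0 => //; nra).
have [k hk] := inv2X_small (divr_gt0 r0 L0).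
have [bk _] := stS k; apply: bk; exists 0%N => n _.
apply: le_trans.
  apply: (@par_bound _ _ _ _ _ (f z - d * z) d (e / (2 * L ^+ 2) * (h k * L))).
  move=> s t s01 t01; set w := (X in let w := X in _); rewrite /=.
  have wz : nr (w - z) <= h k * L.
    have -> : w - z = ((st k).1 + s * h k - x)%:C%C * u +
                      ((st k).2 + t * h k - y)%:C%C * v.
      by rewrite /w /z /P !rmorphB !rmorphD !rmorphM /=; ring.
    apply: le_trans (nrD _ _) _; rewrite !nrM !nr_real.
    have a1 : `|(st k).1 + s * h k - x| <= h k.
      by rewrite ler_norml; have := hx k; have := hp k; nra.
    have a2 : `|(st k).2 + t * h k - y| <= h k.
      by rewrite ler_norml; have := hy k; have := hp k; nra.
    apply: le_trans (lerD (ler_wpM2r (nr_ge0 u) a1) (ler_wpM2r (nr_ge0 v) a2)) _.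
    by rewrite -mulrDr ler_wpM2l // ltW.
  have -> : f w - (f z - d * z + d * w) = f w - f z - d * (w - z) by ring.
  apply: le_trans (hr w _) _.
    by apply: le_lt_trans wz _; rewrite -ltr_pdivlMr.
  by rewrite ler_wpM2l // divr_ge0 ?ltW //; nra.
rewrite !nrM !nr_real (ger0_norm (ltW (hp k))) -mulrDr.
have -> : e / (2 * L ^+ 2) * (h k * L) * (2 * (h k * (nr u + nr v))) =
   e * h k ^+ 2 * ((nr u + nr v) / L).
  by field; lra.
have q : (nr u + nr v) / L <= 1 by rewrite ler_pdivrMr // mul1r.
rewrite -[leRHS]mulr1; apply: ler_wpM2l => //.
exact: mulr_ge0 (ltW e0) (exprn_ge0 2 (ltW (hp k))).
Qed.

End Goursat.

(** * The mean value inequality *)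

Section MeanValue.
Variable R : realType.
Local Notation C := (Cplx R).
Implicit Types (f g : C -> C) (z w : C).

Lemma real_linear_approx (f : R -> R) (d : R) : is_derive (0 : R) (1 : R) f d ->
  forall e : R, 0 < e -> exists2 r : R, 0 < r &
    forall h, `|h| < r -> `|f h - f 0 - d * h| <= e * `|h|.
Proof.
move=> [hd he] e e0.
have H := proj1 (@cvgrPdist_le _ _ _ _ (@dnbhs_filter _ 0) _ _) hd.
have := H e e0; rewrite -/(derive f 0 1) he.
rewrite /dnbhs /within /= => /nbhs_normP [r r0 h]; exists r => // w hw.
have [->|nz] := eqVneq w 0; first by rewrite !subrr mulr0 subrr normr0 mulr0.
have := h w; rewrite /= sub0r normrN => /(_ hw nz).
rewrite /GRing.scale /= mulr1 addr0 => h1.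
have -> : f w - f 0 - d * w = - ((d - w^-1 * (f w - f 0)) * w) by field.
by rewrite normrN normrM ler_wpM2r.
Qed.

Definition cexp z : C :=
  (expR (complex.Re z) * cos (complex.Im z) +i*
   (expR (complex.Re z) * sin (complex.Im z)))%C.

Lemma cexpD z w : cexp (z + w) = cexp z * cexp w.
Proof.
case: z w => a b [c d]; rewrite /cexp /= expRD cosD sinD.
apply/eqP; rewrite eq_complex /=; apply/andP; split; apply/eqP; ring.
Qed.

Lemma nr_cexp z : nr (cexp z) = expR (complex.Re z).
Proof.
apply/eqP; rewrite -(@eqrXn2 _ 2) ?nr_ge0 ?expR_ge0 // nr_sqr /=.
apply/eqP; rewrite !exprMn -mulrDr cos2Dsin2 mulr1 //.
Qed.

Lemma cexp_period z : cexp (z + (0 +i* (pi *+ 2))%C) = cexp z.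
Proof.
case: z => a b; rewrite /cexp /= addr0.
by rewrite cosD2pi sinD2pi.
Qed.

Lemma cexp0 : cexp 0 = 1.
Proof.
by rewrite /cexp /= expR0 cos0 sin0 mulr0 mulr1.
Qed.

Lemma cexp_diffable z : differentiable cexp z.
Proof.
apply: (@differentiable_ext _ (fun w => cexp z * cexp (w - z))).
  by move=> w; rewrite -cexpD addrC subrK.
apply: diffableM; first exact: diffable_cst.
apply: diffable_comp; first by apply: diffableB; [apply: diffable_id|apply: diffable_cst].
rewrite subrr; apply/has_derivP; exists 1 => e e0.
pose e' := Num.min 1 (e / 9).
have e'0 : 0 < e' by rewrite lt_min ltr01 divr_gt0.
have e'1 : e' <= 1 by rewrite ge_min lexx.
have e'e : 9 * e' <= e by rewrite /e' mulrC -ler_pdivlMr // ge_min lexx orbT.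
clearbody e'.
have [r1 r10 h1] := real_linear_approx (is_derive_expR 0) e'0.
have [r2 r20 h2] := real_linear_approx (is_derive_cos 0) e'0.
have [r3 r30 h3] := real_linear_approx (is_derive_sin 0) e'0.
exists (Num.min (Num.min r1 e') (Num.min r2 r3)).
  by rewrite !lt_min r10 r20 r30 e'0.
move=> w; rewrite subr0 !lt_min => /andP[/andP[w1 we] /andP[w2 w3]].
have x1 := re_le_nr w; have y1 := im_le_nr w.
case: w x1 y1 w1 we w2 w3 => x y /= x1 y1 w1 we w2 w3.
have {}h1 := h1 x (le_lt_trans x1 w1); have {}h2 := h2 y (le_lt_trans y1 w2).
have {}h3 := h3 y (le_lt_trans y1 w3).
move: h1 h2 h3; rewrite expR0 cos0 sin0 oppr0 mul0r !subr0 !mul1r addr0 => h1 h2 h3.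
rewrite cexp0; apply: le_trans (nr_le_reim _) _; rewrite /= !subr0.
set E := expR x in h1 *; set c := cos y in h2 *; set s := sin y in h3 *.
set N := nr _ in x1 y1 w1 we w2 w3 *.
have X0 := normr_ge0 x; have Y0 := normr_ge0 y.
have E1 : `|E - 1| <= 2 * `|x|.
  have -> : E - 1 = (E - 1 - x) + x by ring.
  by apply: le_trans (ler_normD _ _) _; nra.
have E3 : `|E| <= 3.
  have -> : E = (E - 1) + 1 by ring.
  by apply: le_trans (ler_normD _ _) _; rewrite normr1; nra.
have A : `|E * c - 1 - x| <= 4 * e' * N.
  have -> : E * c - 1 - x = E * (c - 1) + (E - 1 - x) by ring.
  apply: le_trans (ler_normD _ _) _; rewrite normrM.
  have : `|E| * `|c - 1| <= 3 * (e' * `|y|) by apply: ler_pM.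
  by nra.
have B : `|E * s - y| <= 5 * e' * N.
  have -> : E * s - y = E * (s - y) + (E - 1) * y by ring.
  apply: le_trans (ler_normD _ _) _; rewrite !normrM.
  have : `|E| * `|s - y| <= 3 * (e' * `|y|) by apply: ler_pM.
  have : `|E - 1| * `|y| <= (2 * e') * `|y| by apply: ler_wpM2r => //; nra.
  by nra.
apply: le_trans (lerD A B) _.
have N0 : 0 <= N by apply: nr_ge0.
by nra.
Qed.

(** In the coordinate w = log z the circles about 0 are vertical segments of
length 2 pi, and the horizontal sides of a rectangle of that height cancel by
periodicity: by Goursat's lemma the means over two circles agree, and those over
small circles are close to f 0. *)
Theorem mean_value_le f (r k : R) : 0 < r < 1 ->
  (forall z, nr z < 1 -> z != 0 -> differentiable f z) -> cont f 0 ->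
  (forall z, nr z = r -> nr (f z) <= k) -> nr (f 0) <= k.
Proof.
move=> /andP[r0 r1] df cf fk.
pose v : C := (0 +i* (pi *+ 2))%C.
have v0 : nr v = pi *+ 2.
  rewrite nrE /= expr0n /= add0r sqrtr_sqr ger0_norm //.
  by apply: mulrn_wge0; apply: pi_ge0.
have pi20 : 0 < pi *+ 2 :> R by rewrite pmulrn_lgt0 // pi_gt0.
have nz w : cexp w != 0 by rewrite -nr_gt0 nr_cexp expR_gt0.
pose F w := f (cexp w).
apply: (@le_eps _ _ _ 2) => e e0.
have [d d0 hd] := cf e e0.
pose r1' := Num.min r (d / 2).
have r1'0 : 0 < r1' by rewrite lt_min r0 divr_gt0.
pose x1 := ln r1'; pose x2 := ln r.
have X1 : expR x1 = r1' by rewrite lnK.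
have X2 : expR x2 = r by rewrite lnK.
have x12 : x1 <= x2 by rewrite -ler_expR X1 X2 ge_min lexx.
have x20 : x2 < 0 by rewrite -expR_lt1 X2.
pose A : C := x1%:C%C; pose u : C := (x2 - x1)%:C%C.
have [|n0 hn] := @goursat _ F A u v _ (e * (pi *+ 2)) ltac:(by apply: mulr_gt0).
  move=> s t s01 t01; apply: diffable_comp; first exact: cexp_diffable.
  apply: df; rewrite // nr_cexp expR_lt1.
  rewrite /A /u /v !reimE /= !(mulr0, mul0r, subr0, addr0).
  by case/andP: s01 => s0 s1; nra.
have {hn} := hn _ (leqnn n0); rewrite /par.
have FP w : F (w + v) = F w by rewrite /F cexp_period.
have -> : trap F n0 (A + u + v) (A + v) = - trap F n0 A (A + u).
  rewrite trap_shift trap_rev; congr (- trap _ _ _ _).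
  by apply/funext => w; rewrite FP.
rewrite (trap_rev F n0 A (A + v)).
set V1 := trap F n0 A (A + v); set V2 := trap F n0 (A + u) _.
have -> : trap F n0 A (A + u) + V2 + - trap F n0 A (A + u) - V1 = V2 - V1.
  by ring.
move=> V12.
have vk : nr V2 <= k * (pi *+ 2).
  have -> : pi *+ 2 = nr (A + u + v - (A + u)) by rewrite addrAC subrr add0r v0.
  apply: trap_bound => t t01; apply: fk; rewrite nr_cexp.
  rewrite !reimE /= !(mulr0, mul0r, subr0, addr0).
  by rewrite -X2; congr expR; ring.
have v1 : nr (V1 - f 0 * v) <= e * (pi *+ 2).
  have -> : V1 - f 0 * v = trap (fun w => F w - (f 0 + 0 * w)) n0 A (A + v).
    rewrite trapB trap_affine -/V1; ring.
  have -> : pi *+ 2 = nr (A + v - A) by rewrite addrAC subrr add0r v0.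
  apply: trap_bound => t t01; rewrite mul0r addr0; apply: hd.
  rewrite subr0 nr_cexp !reimE /= !(mulr0, mul0r, subr0, addr0).
  by rewrite subrr mulr0 addr0 X1 gt_min ltr_pdivrMr //; apply/orP; right; lra.
have : nr (f 0 * v) <= (k + 2 * e) * (pi *+ 2).
  have -> : f 0 * v = - (V1 - f 0 * v) - (V2 - V1) + V2 by ring.
  apply: le_trans (nrD _ _) _; apply: le_trans (lerD (nr_le_add _ _) (lexx _)) _.
  by rewrite nrN; lra.
by rewrite nrM v0 ler_pM2r.
Qed.

End MeanValue.

(** * The maximum principle *)

Section Continuity.
Variable R : realType.
Local Notation C := (Cplx R).
Implicit Types (f g : C -> C) (z w c : C).

Lemma contB f g z : cont f z -> cont g z -> cont (fun w => f w - g w) z.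
Proof. by move=> /contP hf /contP hg; apply/contP; exact: (cvgB hf hg). Qed.

Lemma contM f g z : cont f z -> cont g z -> cont (fun w => f w * g w) z.
Proof. by move=> /contP hf /contP hg; apply/contP; exact: (cvgM hf hg). Qed.

Lemma cont_cst c z : cont (fun=> c) z.
Proof. by move=> e e0; exists 1 => // w _; rewrite subrr nr0 ltW. Qed.

Lemma contX f z n : cont f z -> cont (fun w => f w ^+ n) z.
Proof.
move=> cf; elim: n => [|n IH]; first exact: cont_cst.
have -> : (fun w => f w ^+ n.+1) = (fun w => f w * f w ^+ n).
  by apply/funext => w; rewrite exprS.
exact: contM.
Qed.

Lemma diffableM_cont f g z : differentiable f z -> f z = 0 -> cont g z ->
  differentiable (fun w => f w * g w) z.
Proof.
move=> /has_derivP [d hd] f0 cg; apply/has_derivP; exists (d * g z) => e e0.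
pose G := nr (g z) + 1; pose E := nr d + 1.
have G0 : 0 < G by rewrite /G; have := nr_ge0 (g z); lra.
have E0 : 0 < E by rewrite /E; have := nr_ge0 d; lra.
have [r1 r10 h1] := hd (e / (2 * G)) ltac:(by apply: divr_gt0; lra).
have e2 : 0 < Num.min 1 (e / (2 * E)) by rewrite lt_min ltr01 divr_gt0 //; lra.
have [r2 r20 h2] := cg _ e2.
exists (Num.min r1 r2) => [|w]; first by rewrite lt_min r10.
rewrite lt_min => /andP[/h1 w1 /h2]; rewrite le_min => /andP[w2 w3].
move: w1; rewrite f0 mul0r !subr0 => w1.
have -> : f w * g w - d * g z * (w - z) =
  (f w - d * (w - z)) * g w + d * (w - z) * (g w - g z) by ring.
apply: le_trans (nrD _ _) _; rewrite !nrM.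
have gw : nr (g w) <= G.
  have h := nrD (g w - g z) (g z); rewrite subrK in h.
  by apply: le_trans h _; rewrite /G addrC lerD2l.
have dE : nr d <= E by rewrite /E lerDl ler01.
have N0 := nr_ge0 (w - z).
have a1 : nr (f w - d * (w - z)) * nr (g w) <= e / (2 * G) * nr (w - z) * G.
  by apply: ler_pM; rewrite ?nr_ge0.
have a2 : nr d * nr (w - z) * nr (g w - g z) <= E * nr (w - z) * (e / (2 * E)).
  by apply: ler_pM; rewrite ?mulr_ge0 ?nr_ge0 //; apply: ler_wpM2r.
apply: le_trans (lerD a1 a2) _.
have -> // : e / (2 * G) * nr (w - z) * G + E * nr (w - z) * (e / (2 * E)) =
    e * nr (w - z).
by field; rewrite !gt_eqF.
Qed.

Lemma isolated (S : seq C) w :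
  exists2 d : R, 0 < d & forall s, s \in S -> s != w -> d <= nr (s - w).
Proof.
elim: S => [|t S [d d0 hd]]; first by exists 1.
have [tw|tw] := eqVneq t w.
  exists d => // s; rewrite inE => /orP[/eqP ->|/hd//].
  by rewrite tw eqxx.
exists (Num.min d (nr (t - w))).
  by rewrite lt_min d0 nr_gt0 subr_eq0.
move=> s; rewrite inE ge_min => /orP[/eqP ->|/hd h sw]; last by rewrite h.
by rewrite lexx orbT.
Qed.

Lemma pow_unbounded (q M : R) : 1 < q -> exists n, M < q ^+ n.
Proof.
move=> q1; pose t := q - 1; have t0 : 0 < t by rewrite /t; lra.
have B n : 1 + n%:R * t <= q ^+ n.
  elim: n => [|n IH]; first by rewrite mul0r addr0 expr0.
  rewrite exprS -natr1; have n0 : 0 <= n%:R :> R by apply: ler0n.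
  apply: (@le_trans _ _ (q * (1 + n%:R * t))); last by rewrite ler_wpM2l //; lra.
  have h : 0 <= n%:R * t ^+ 2 by rewrite mulr_ge0 ?sqr_ge0.
  by rewrite /t in h *; lra.
exists (Num.truncn (M / t)).+1; apply: lt_le_trans (B _).
have := truncnS_gt (M / t); rewrite ltr_pdivrMr //; lra.
Qed.

End Continuity.

Section MaximumPrinciple.
Variable R : realType.
Local Notation C := (Cplx R).
Implicit Types (f g : C -> C) (z w c : C) (M K N r e : R) (S : seq C).

Definition mob c z : C := (z + c) / (1 + c^* * z).

Lemma mob_den_sqr c z : nr (1 + c^* * z) ^+ 2 - nr (z + c) ^+ 2 =
  (1 - nr c ^+ 2) * (1 - nr z ^+ 2).
Proof. by rewrite !nr_sqr !reimE; ring. Qed.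

Lemma mob_den_ge c z : nr z <= 1 -> 1 - nr c <= nr (1 + c^* * z).
Proof.
move=> z1; have := nr_le_sub 1 (- (c^* * z)).
rewrite opprK nrN nr1 nrM nr_conj; have := nr_ge0 c; nra.
Qed.

Lemma mob_den_neq0 c z : nr c < 1 -> nr z <= 1 -> 1 + c^* * z != 0.
Proof. by move=> c1 /(@mob_den_ge c) h; rewrite -nr_gt0; lra. Qed.

Lemma nr_mob c z : nr c < 1 -> nr z <= 1 ->
  1 - nr (mob c z) ^+ 2 =
  (1 - nr c ^+ 2) * (1 - nr z ^+ 2) / nr (1 + c^* * z) ^+ 2.
Proof.
move=> c1 z1; rewrite nr_div expr_div_n -mob_den_sqr mulrBl divff //.
by rewrite expf_neq0 // nr_eq0 mob_den_neq0.
Qed.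

Lemma sqr_lt1 (a : R) : 0 <= a -> (a ^+ 2 < 1) = (a < 1).
Proof. by move=> a0; rewrite -[in RHS](@ltr_pXn2r _ 2) ?nnegrE // expr1n. Qed.

Lemma mob_disc c z : nr c < 1 -> nr z < 1 -> nr (mob c z) < 1.
Proof.
move=> c1 z1; rewrite -sqr_lt1 ?nr_ge0 // -subr_gt0 nr_mob // ?ltW //.
apply: divr_gt0; last by rewrite exprn_gt0 // nr_gt0 mob_den_neq0 // ltW.
by apply: mulr_gt0; rewrite subr_gt0 sqr_lt1 ?nr_ge0.
Qed.

Lemma mob0 c : mob c 0 = c.
Proof. by rewrite /mob mulr0 addr0 add0r divr1. Qed.

Lemma mob_diffable c z : nr c < 1 -> nr z <= 1 -> differentiable (mob c) z.
Proof.
move=> c1 z1; apply: diffable_div; last exact: mob_den_neq0.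
  by apply: diffableD; [apply: diffable_id | apply: diffable_cst].
apply: diffableD; first exact: diffable_cst.
by apply: diffableM; [apply: diffable_cst | apply: diffable_id].
Qed.

Lemma mobK c z : nr c < 1 -> nr z <= 1 -> mob (- c) (mob c z) = z.
Proof.
move=> c1 z1; have n1 := mob_den_neq0 c1 z1.
have c2 : 1 - c^* * c != 0.
  have := @mob_den_neq0 c (- c) c1; rewrite nrN mulrN; apply; exact: ltW.
have e1 : mob c z + - c = z * (1 - c^* * c) / (1 + c^* * z).
  by rewrite /mob; field.
have e2 : 1 + (- c)^* * mob c z = (1 - c^* * c) / (1 + c^* * z).
  by rewrite /mob rmorphN; field.
by rewrite {1}/mob e1 e2; field; rewrite n1 c2.
Qed.

Definition near_circle_le f K := forall e, 0 < e -> exists2 r, r < 1 &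
  forall z, r < nr z < 1 -> nr (f z) <= K + e.

(** The mean value inequality is applied at w itself, after a Moebius change of
variable moving w to the centre; the radius rho is so close to 1 that the circle
|z| = rho is mapped into the annulus where the hypothesis gives the bound. *)
Lemma max_principle f K : (forall z, nr z < 1 -> differentiable f z) ->
  near_circle_le f K -> forall w, nr w < 1 -> nr (f w) <= K.
Proof.
move=> df hK w w1; apply: (@le_eps _ _ _ 1) => e e0; rewrite mul1r.
have [r' r1' hr'] := hK e e0.
pose r := Num.max r' 0.
have r0 : 0 <= r by rewrite le_max lexx orbT.
have r1 : r < 1 by rewrite gt_max r1' ltr01.
have rr' : r' <= r by rewrite le_max lexx.
have wg := nr_ge0 w.
(* 1 - |mob w z|^2 is at most (1 - |z|^2) / (1 - |w|)^2, which is required to be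
   smaller than 1 - r^2 when |z| = rho. *)
pose rho := 1 - (1 - r) * (1 - nr w) ^+ 2 / 2.
have qq : 0 < (1 - r) * (1 - nr w) ^+ 2.
  by apply: mulr_gt0; [lra | apply: exprn_gt0; lra].
have qq1 : (1 - r) * (1 - nr w) ^+ 2 <= 1.
  by apply: mulr_ile1; rewrite ?exprn_ge0 ?exprn_ile1 //; lra.
have rho1 : rho < 1 by rewrite /rho; lra.
have rho0 : 0 < rho by rewrite /rho; lra.
rewrite -(mob0 w).
have rho01 : 0 < rho < 1 by rewrite rho0.
apply: (@mean_value_le _ (fun z => f (mob w z)) rho _ rho01).
- move=> z z1 _; apply: diffable_comp; first by apply: mob_diffable; rewrite ?ltW.
  by apply: df; apply: mob_disc.
- apply: differentiable_cont; apply: diffable_comp.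
    by apply: mob_diffable; rewrite ?nr0 ?ler01.
  by apply: df; apply: mob_disc; rewrite ?nr0 ?ltr01.
move=> z zr; have z1 : nr z < 1 by rewrite zr.
apply: hr'; rewrite mob_disc // andbT (le_lt_trans rr') //.
have d1 := mob_den_ge w (ltW z1).
have m1 : (1 - nr w ^+ 2) * (1 - nr z ^+ 2) / nr (1 + w^* * z) ^+ 2 < 1 - r ^+ 2.
  rewrite ltr_pdivrMr; last by rewrite exprn_gt0 //; lra.
  have a1 : (1 - nr w) ^+ 2 <= nr (1 + w^* * z) ^+ 2 by nra.
  have a2 : 1 - nr z ^+ 2 < (1 - r ^+ 2) * (1 - nr w) ^+ 2.
    rewrite zr; have q : 1 - rho = (1 - r) * (1 - nr w) ^+ 2 / 2.
      by rewrite /rho; ring.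
    apply: (@lt_le_trans _ _ (2 * (1 - rho))); first by nra.
    have := mulr_ge0 r0 (ltW qq); nra.
  have a3 : 0 <= 1 - nr w ^+ 2 <= 1 by nra.
  have a4 : 0 <= 1 - nr z ^+ 2 by rewrite zr; nra.
  have a5 : 0 < 1 - r ^+ 2 by nra.
  by nra.
rewrite -nr_mob // ?ltW // in m1.
have {}m1 : r ^+ 2 < nr (mob w z) ^+ 2 by lra.
by rewrite -(@ltr_pXn2r _ 2) ?nnegrE ?nr_ge0.
Qed.

(** The exceptional points are removed by applying the principle to
prod (z - s) * g^n, which is differentiable there because the product vanishes;
the factor disappears on taking n-th roots. *)
Theorem max_principle_exc S g K :
  (forall z, nr z < 1 -> cont g z) ->
  (forall z, nr z < 1 -> z \notin S -> differentiable g z) ->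
  near_circle_le g K -> forall w, nr w < 1 -> nr (g w) <= K.
Proof.
move=> cg dg hK.
pose P z : C := \prod_(s <- S) (z - s).
pose B : R := \prod_(s <- S) (1 + nr s).
have B0 : 0 <= B by apply: prodr_ge0 => s _; rewrite addr_ge0 ?nr_ge0.
have P0 s : s \in S -> P s = 0.
  by move=> sS; apply/eqP; rewrite prodf_seq_eq0; apply/hasP; exists s; rewrite ?subrr /=.
have PN s : s \notin S -> P s != 0.
  move=> sS; rewrite prodf_seq_neq0; apply/allP => t tS /=.
  by rewrite subr_eq0; apply: contraNneq sS => ->.
have PB z : nr z < 1 -> nr (P z) <= B.
  move=> z1; rewrite nr_prod; apply: ler_prod => s _.
  by rewrite nr_ge0 (le_trans (nr_le_add _ _)) // lerD2r ltW.
have dP z : differentiable P z.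
  by apply: diffable_prod => s; apply: diffableB; [apply: diffable_id|apply: diffable_cst].
have K0 : 0 <= K.
  apply: (@le_eps _ _ _ 1) => e e0; rewrite mul1r; have [r r1 hr] := hK e e0.
  pose r' := (Num.max r 0 + 1) / 2.
  have m1 : Num.max r 0 < 1 by rewrite gt_max r1 ltr01.
  have m2 : r <= Num.max r 0 by rewrite le_max lexx.
  have m3 : 0 <= Num.max r 0 by rewrite le_max lexx orbT.
  apply: le_trans (nr_ge0 _) (hr (r'%:C%C) _).
  by rewrite nr_real ger0_norm /r'; lra.
have off w : nr w < 1 -> w \notin S -> nr (g w) <= K.
  move=> w1 wS; apply: (@le_eps _ _ _ 1) => e e0; rewrite mul1r.
  rewrite leNgt; apply/negP => big.
  have Ke : 0 < K + e by lra.
  have bound n : nr (P w * g w ^+ n) <= B * (K + e) ^+ n.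
    apply: (@max_principle (fun z => P z * g z ^+ n)) => //.
      move=> z z1; have [zS|zS] := boolP (z \in S).
        apply: diffableM_cont => //; first exact: P0.
        by apply: contX; apply: cg.
      by apply: diffableM => //; apply: diffableX; apply: dg.
    move=> d d0; have [r r1 hr] := hK e e0; exists r => // z /[dup] /hr gz.
    move=> /andP[_ z1]; rewrite nrM nrX; apply: ler_wpDr; first exact: ltW.
    apply: ler_pM; [exact: nr_ge0 | exact: exprn_ge0 (nr_ge0 _) | exact: PB |].
    by apply: lerXn2r; rewrite ?nnegrE ?nr_ge0 // ltW.
  have Pw : 0 < nr (P w) by rewrite nr_gt0 PN.
  have [|n hn] := @pow_unbounded R (nr (g w) / (K + e)) (B / nr (P w)).
    by rewrite ltr_pdivlMr // mul1r.
  have := bound n; rewrite leNgt => /negP; apply.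
  move: hn; rewrite ltr_pdivrMr // expr_div_n nrM nrX.
  by rewrite mulrAC ltr_pdivlMr ?exprn_gt0 // (mulrC (nr (P w))).
move=> w w1; apply: (@le_eps _ _ _ 1) => e e0; rewrite mul1r.
have [d d0 hd] := cg w w1 e e0.
have [i i0 hi] := isolated S w.
pose t := Num.min (Num.min (d / 2) (i / 2)) ((1 - nr w) / 2).
have t0 : 0 < t by rewrite !lt_min !divr_gt0 //; lra.
have td : t < d.
  by apply: (@le_lt_trans _ _ (d / 2)); [rewrite /t !ge_min lexx | lra].
have ti : t < i.
  apply: (@le_lt_trans _ _ (i / 2)); last lra.
  by rewrite /t !ge_min lexx orbT.
have tw : t <= (1 - nr w) / 2 by rewrite /t ge_min lexx orbT.
have tn : nr (w + t%:C%C - w) = t.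
  by rewrite addrAC subrr add0r nr_real gtr0_norm.
have h1 : nr (g (w + t%:C%C)) <= K.
  apply: off.
    by apply: le_lt_trans (nrD _ _) _; rewrite nr_real gtr0_norm //; lra.
  apply/negP => /hi; rewrite tn => H.
  have : w + t%:C%C != w by rewrite -subr_eq0 -nr_gt0 tn.
  by move/H; lra.
have := hd (w + t%:C%C); rewrite tn => /(_ td) h2.
have := nrD (g w - g (w + t%:C%C)) (g (w + t%:C%C)).
by rewrite subrK (nrB (g w)); lra.
Qed.

(** A function dominated by N / |z - c| is, near the circle, dominated by
about N / (1 - |c|). *)
Lemma max_principle_quot S g c N : nr c < 1 ->
  (forall z, nr z < 1 -> cont g z) ->
  (forall z, nr z < 1 -> z \notin S -> differentiable g z) ->
  (forall z, nr z < 1 -> nr (g z) * nr (z - c) <= N) ->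
  forall w, nr w < 1 -> nr (g w) <= N / (1 - nr c).
Proof.
move=> c1 cg dg gN; apply: (@max_principle_exc S) => // e e0.
have N0 : 0 <= N by apply: le_trans (gN c c1); rewrite mulr_ge0 ?nr_ge0.
pose a := 1 - nr c; have a0 : 0 < a by rewrite /a; lra.
pose eta := Num.min (a / 2) (e * a ^+ 2 / (2 * (N + 1))).
have N1 : 0 < N + 1 by rewrite ltr_wpDl.
have eta0 : 0 < eta by rewrite lt_min !divr_gt0 ?mulr_gt0 ?exprn_gt0.
have eta1 : eta <= a / 2 by rewrite /eta ge_min lexx.
have eta2 : eta * (2 * (N + 1)) <= e * a ^+ 2.
  by rewrite -ler_pdivlMr ?mulr_gt0 // /eta ge_min lexx orbT.
exists (1 - eta); first lra.
move=> z /andP[z0 z1]; have := gN z z1; have := nr_le_sub z c => h1 h2.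
have h3 : a - eta <= nr (z - c) by rewrite /a; lra.
have h4 : nr (g z) * (a - eta) <= N.
  by apply: le_trans h2; rewrite ler_wpM2l ?nr_ge0.
have h5 : nr (g z) <= N / (a - eta) by rewrite ler_pdivlMr //; lra.
apply: le_trans h5 _; rewrite ler_pdivrMr; last lra.
have -> : (N / a + e) * (a - eta) = N + (e * (a - eta) * a - N * eta) / a.
  by field; rewrite gt_eqF.
rewrite lerDl; apply: divr_ge0; last exact: ltW.
have : e * a * (a / 2) <= e * a * (a - eta).
  by apply: ler_wpM2l; [exact: mulr_ge0 (ltW e0) (ltW a0) | lra].
have : 0 <= N * eta by apply: mulr_ge0 => //; exact: ltW.
by nra.
Qed.

End MaximumPrinciple.

(** * Division by z - c, the Schwarz lemma and the strong maximum principle *)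

Section Division.
Variable R : realType.
Local Notation C := (Cplx R).
Implicit Types (f g : C -> C) (z w c : C) (M K N e : R) (S : seq C).

Lemma cauchy_point (a : nat -> C) (r : nat -> R) :
  (forall j k : nat, nr (a j - a k) <= r j + r k) ->
  exists x : C, forall k : nat, nr (a k - x) <= 2 * r k.
Proof.
move=> h.
have part (p : C -> R) : (forall x y, p (x - y) = p x - p y) ->
    (forall x, `|p x| <= nr x) ->
    exists x, forall k : nat, `|p (a k) - x| <= r k.
  move=> pB pN.
  have [|x hx] := @nested_point R (fun k => p (a k) - r k) (fun k => 2 * r k).
    move=> j k; have := le_trans (pN _) (h j k).
    by rewrite pB ler_norml => /andP[_]; lra.
  by exists x => k; rewrite ler_norml; have /andP[] := hx k; lra.
have [|x hx] := part (@complex.Re R) _ (@re_le_nr R).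
  by move=> x y; rewrite reD reN.
have [|y hy] := part (@complex.Im R) _ (@im_le_nr R).
  by move=> u v; rewrite imD imN.
exists (x +i* y)%C => k; apply: le_trans (nr_le_reim _) _.
rewrite !reimE /=; have := hx k; have := hy k; lra.
Qed.

Lemma inv_antitone (a b : R) : 0 < a -> a <= b -> b^-1 <= a^-1.
Proof. by move=> a0 ab; rewrite lef_pV2 ?posrE // (lt_le_trans a0). Qed.

Definition dquot f c d z : C := if z == c then d else (f z - f c) / (z - c).

Lemma dquotE f c d z : f z = f c + (z - c) * dquot f c d z.
Proof.
rewrite /dquot; have [->|zc] := eqVneq z c; first by rewrite subrr mul0r addr0.
by field; rewrite subr_eq0.
Qed.

Lemma dquot_mul f c d z : dquot f c d z * (z - c) = f z - f c.
Proof. by rewrite [in RHS](dquotE f c d z); ring. Qed.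

Lemma dquot_cont f c d : has_deriv f c d -> cont (dquot f c d) c.
Proof.
move=> hd e e0; have [r r0 hr] := hd e e0; exists r => // w wr.
rewrite /dquot eqxx; have [_|wc] := eqVneq w c; first by rewrite subrr nr0 ltW.
have wc' : w - c != 0 by rewrite subr_eq0.
have -> : (f w - f c) / (w - c) - d = (f w - f c - d * (w - c)) / (w - c).
  by field.
by rewrite nr_div ler_pdivrMr ?nr_gt0 //; apply: hr.
Qed.

Lemma dquot_diffable f c d z : z != c -> differentiable f z ->
  differentiable (dquot f c d) z.
Proof.
move=> zc df; have nz : 0 < nr (z - c) by rewrite nr_gt0 subr_eq0.
apply: (@differentiable_near _ (fun w => (f w - f c) / (w - c)) _ _ _ nz).
  move=> w wz; rewrite /dquot; case: eqVneq => // wc.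
  by move: wz; rewrite wc nrB ltxx.
apply: diffable_div; last by rewrite subr_eq0.
  exact: (diffableB df (diffable_cst _ _)).
by apply: diffableB; [apply: diffable_id | apply: diffable_cst].
Qed.

Lemma dquot_cont_all f c d z : has_deriv f c d -> differentiable f z ->
  cont (dquot f c d) z.
Proof.
move=> hd df; have [->|zc] := eqVneq z c; first exact: dquot_cont.
exact/differentiable_cont/dquot_diffable.
Qed.

(** Differentiability of the quotient g at c comes from the maximum principle
alone: the difference quotients Q_w of g satisfy
(Q_w - Q_v)(z) (z - v) = (w - v) (Q_w z - Q_w v), hence Q_w c is a Lipschitz
function of w and has a limit as w tends to c. *)
Theorem divide f c M : nr c < 1 ->
  (forall z, nr z < 1 -> differentiable f z) ->
  (forall z, nr z < 1 -> nr (f z) <= M) ->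
  exists g, [/\ forall z, nr z < 1 -> differentiable g z,
    forall z, f z = f c + (z - c) * g z &
    forall z, nr z < 1 -> nr (g z) <= 2 * M / (1 - nr c)].
Proof.
move=> c1 df fM.
have [d hd] : exists d, has_deriv f c d by apply/has_derivP/df.
pose g := dquot f c d.
have M0 : 0 <= M by apply: le_trans (nr_ge0 _) (fM c c1).
have dg z : nr z < 1 -> z != c -> differentiable g z.
  by move=> z1 zc; apply: dquot_diffable zc (df z z1).
have cg z : nr z < 1 -> cont g z by move=> z1; apply: dquot_cont_all (df z z1).
have gM z : nr z < 1 -> nr (g z) <= 2 * M / (1 - nr c).
  apply: (@max_principle_quot _ [:: c]) => // [w w1|w w1].
    by rewrite inE => wc; apply: dg.
  rewrite -nrM dquot_mul; apply: le_trans (nr_le_add _ _) _.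
  by have := fM w w1; have := fM c c1; lra.
exists g; split=> //; last by move=> z; apply: dquotE.
move=> z z1; have [->{z z1}|zc] := eqVneq z c; last exact: dg.
set M1 := 2 * M / (1 - nr c) in gM.
have M10 : 0 <= M1 by apply: le_trans (nr_ge0 _) (gM c c1).
pose a := (1 - nr c) / 2; have a0 : 0 < a by rewrite /a; lra.
have near w : nr (w - c) < a -> nr w <= 1 - a.
  move=> wc; have := nrD (w - c) c; rewrite subrK; rewrite /a in wc *; lra.
have [D hD] : exists D : C -> C, forall w, nr w < 1 -> w != c ->
    has_deriv g w (D w).
  have /choice [D hD] : forall w, exists d', nr w < 1 -> w != c -> has_deriv g w d'.
    move=> w; have [w1|w1] := boolP ((nr w < 1) && (w != c)).
      by case/andP: w1 => w1 wc; have /has_derivP [d' hd'] := dg w w1 wc; exists d'.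
    by exists 0 => w2 w3; move: w1; rewrite w2 w3.
  by exists D.
pose Q w := dquot g w (D w).
have cQ w z : nr w < 1 -> w != c -> nr z < 1 -> cont (Q w) z.
  move=> w1 wc z1; have [->|zw] := eqVneq z w; first exact: dquot_cont (hD w w1 wc).
  have [->|zc] := eqVneq z c; last exact/differentiable_cont/dquot_diffable/dg.
  have wc' : 0 < nr (w - c) by rewrite nr_gt0 subr_eq0.
  move=> e e0; have [r r0 hr] := cg c c1 (e * (nr (w - c) / 2))
    ltac:(by rewrite mulr_gt0 ?divr_gt0).
  have ci : cont (fun z => (g z - g w) / (z - w)) c.
    apply: contM; first by apply: contB; [apply: cg | apply: cont_cst].
    apply: differentiable_cont; apply: diffableV; last by rewrite subr_eq0 eq_sym.
    by apply: diffableB; [apply: diffable_id | apply: diffable_cst].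
  have [s s0 hs] := ci e e0; exists (Num.min s (nr (w - c))).
    by rewrite lt_min s0.
  move=> y; rewrite lt_min => /andP[ys yw].
  rewrite /Q /dquot (eq_sym c w) (negbTE wc); case: eqVneq => [yE|_]; last exact: hs.
  by move: yw; rewrite yE ltxx.
have dQ w z : nr w < 1 -> w != c -> nr z < 1 -> z \notin [:: c; w] ->
    differentiable (Q w) z.
  move=> w1 wc z1; rewrite !inE negb_or => /andP[zc zw].
  exact/dquot_diffable/dg.
have QM w z : nr (w - c) < a -> w != c -> nr z < 1 -> nr (Q w z) <= 2 * M1 / a.
  move=> /near wa wc z1; have w1 : nr w < 1 by lra.
  apply: (@le_trans _ _ (2 * M1 / (1 - nr w))).
    apply: (@max_principle_quot _ [:: c; w]) => // [y y1|y y1|y y1].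
    - exact: cQ.
    - exact: dQ.
    rewrite -nrM dquot_mul; apply: le_trans (nr_le_add _ _) _.
    by have := gM y y1; have := gM w w1; lra.
  by apply: ler_wpM2l; [lra | apply: inv_antitone; lra].
pose L := 4 * M1 / a ^+ 2.
have L0 : 0 <= L by apply: divr_ge0; [lra | exact: sqr_ge0].
have QL w v : nr (w - c) < a -> w != c -> nr (v - c) < a -> v != c ->
    nr (Q w c - Q v c) <= L * nr (w - v).
  move=> wa wc va vc; have w1 := near w wa; have v1 := near v va.
  have w1' : nr w < 1 by lra.
  have v1' : nr v < 1 by lra.
  apply: (@le_trans _ _ (nr (w - v) * (4 * M1 / a) / (1 - nr v))).
    apply: (@max_principle_quot _ [:: c; w; v] (fun z => Q w z - Q v z));
      last exact: c1.
    - exact: v1'.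
    - by move=> y y1; apply: contB; apply: cQ.
    - move=> y y1; rewrite !inE !negb_or => /and3P[yc yw yv].
      by apply: diffableB; apply: dQ; rewrite // !inE negb_or yc.
    move=> y y1; rewrite -nrM.
    have -> : (Q w y - Q v y) * (y - v) = (w - v) * (Q w y - Q w v).
      have E1 := dquot_mul g w (D w) y; have E2 := dquot_mul g w (D w) v.
      have E3 := dquot_mul g v (D v) y; rewrite -!/(Q _) in E1 E2 E3.
      have -> : (Q w y - Q v y) * (y - v) =
         Q w y * (y - w) + Q w y * (w - v) - Q v y * (y - v) by ring.
      have -> : (w - v) * (Q w y - Q w v) = Q w y * (w - v) + Q w v * (v - w).
        by ring.
      by rewrite E1 E2 E3; ring.
    rewrite nrM ler_wpM2l ?nr_ge0 //; apply: le_trans (nr_le_add _ _) _.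
    have := QM w y wa wc y1; have := QM w v wa wc v1'; lra.
  have -> : L * nr (w - v) = nr (w - v) * (4 * M1 / a) / a.
    by rewrite /L; field; rewrite gt_eqF.
  apply: ler_wpM2l; last by apply: inv_antitone; lra.
  by apply: mulr_ge0; [exact: nr_ge0 | apply: divr_ge0; lra].
apply/has_derivP.
pose h (k : nat) : R := a * 2^-1 ^+ k.+1.
have h0 (k : nat) : 0 < h k by rewrite mulr_gt0 ?inv2X_gt0.
have ha (k : nat) : h k < a.
  rewrite /h exprS; have := inv2X_le1 R k; have := inv2X_gt0 R k; nra.
pose s (k : nat) : C := c + (h k)%:C%C.
have sc (k : nat) : nr (s k - c) = h k.
  by rewrite /s addrAC subrr add0r nr_real gtr0_norm.
have snc (k : nat) : s k != c by rewrite -subr_eq0 -nr_gt0 sc.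
have [|q hq] := @cauchy_point (fun k => Q (s k) c) (fun k => L * h k).
  move=> j k; apply: le_trans (QL _ _ _ _ _ _) _; rewrite ?sc //.
  rewrite -mulrDr ler_wpM2l //.
  have -> : s j - s k = (s j - c) - (s k - c) by ring.
  by apply: le_trans (nr_le_add _ _) _; rewrite !sc.
have qL w : nr (w - c) < a -> w != c -> nr (Q w c - q) <= L * nr (w - c).
  move=> wa wc; apply: (@le_eps _ _ _ (3 * L)) => e e0.
  have [k hk] := inv2X_small (divr_gt0 e0 a0).
  have ke : h k <= e.
    move: hk; rewrite ltr_pdivlMr // /h exprSr => hk.
    have := inv2X_gt0 R k; nra.
  have -> : Q w c - q = (Q w c - Q (s k) c) + (Q (s k) c - q) by ring.
  apply: le_trans (nrD _ _) _.
  have e1 := hq k; have e2 : nr (Q w c - Q (s k) c) <= L * (nr (w - c) + h k).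
    apply: le_trans (QL _ _ _ _ _ _) _; rewrite ?sc // ler_wpM2l //.
    have -> : w - s k = (w - c) - (s k - c) by ring.
    by apply: le_trans (nr_le_add _ _) _; rewrite sc.
  have : L * h k <= L * e by rewrite ler_wpM2l.
  by lra.
exists q => e e0; have L1 : 0 < L + 1 by lra.
exists (Num.min a (e / (L + 1))); first by rewrite lt_min a0 divr_gt0.
move=> w; rewrite lt_min => /andP[wa we].
have [->|wc] := eqVneq w c; first by rewrite !subrr mulr0 subrr nr0 mulr0.
have -> : g w - g c - q * (w - c) = (Q w c - q) * (w - c).
  have := dquot_mul g w (D w) c; rewrite -/(Q w) => E.
  have -> : (Q w c - q) * (w - c) = - (Q w c * (c - w)) - q * (w - c) by ring.
  by rewrite E; ring.
rewrite nrM ler_wpM2r ?nr_ge0 //; apply: le_trans (qL w wa wc) _.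
by move: we; rewrite ltr_pdivlMr // => we; have := nr_ge0 (w - c); lra.
Qed.

Lemma schwarz f M : (forall z, nr z < 1 -> differentiable f z) ->
  (forall z, nr z < 1 -> nr (f z) <= M) -> f 0 = 0 ->
  forall z, nr z < 1 -> nr (f z) <= M * nr z.
Proof.
move=> df fM f0 z z1; have n0 : nr (0 : C) < 1 by rewrite nr0 ltr01.
have [g [dg gE _]] := divide n0 df fM.
rewrite gE f0 add0r subr0 nrM mulrC ler_wpM2r ?nr_ge0 //.
have -> : M = M / (1 - nr (0 : C)) by rewrite nr0 subr0 divr1.
apply: (@max_principle_quot _ [::] g) => // w w1.
- exact/differentiable_cont/dg.
- by move=> _; apply: dg.
by rewrite -nrM mulrC; have := gE w; rewrite f0 add0r => <-; apply: fM.
Qed.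

(** If |f| <= 1 and f 0 = 1 then 1 - f has nonnegative real part, and the
Schwarz lemma applies to (1 - f) / (1 - f + e) for every e > 0. *)
Lemma strong_max0 f : (forall z, nr z < 1 -> differentiable f z) ->
  (forall z, nr z < 1 -> nr (f z) <= 1) -> f 0 = 1 ->
  forall z, nr z < 1 -> f z = 1.
Proof.
move=> df fM f0 z z1.
have re z' : nr z' < 1 -> 0 <= complex.Re (1 - f z').
  move=> /fM h; rewrite !reimE; have := re_le_nr (f z').
  by rewrite ler_norml => /andP[_]; lra.
have key e : 0 < e -> nr (1 - f z) <= nr z * nr (1 - f z + e%:C%C).
  move=> e0; have den y : nr y < 1 -> 0 < nr (1 - f y + e%:C%C).
    move=> y1; apply: lt_le_trans (re_le_nr _).
    by rewrite (reD (1 - f y)) re_real; have := re y y1 => h; rewrite gtr0_norm; lra.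
  rewrite -ler_pdivrMr ?den // -nr_div -(mul1r (nr z)).
  apply: (@schwarz (fun y => (1 - f y) / (1 - f y + e%:C%C))); last exact: z1.
  - move=> y y1; have dy : differentiable (fun y => 1 - f y) y.
      by apply: diffableB; [apply: diffable_cst | apply: df].
    apply: (diffable_div dy); last by rewrite -nr_gt0 den.
    exact: (diffableD dy (diffable_cst _ _)).
  - move=> y y1; rewrite nr_div ler_pdivrMr ?den // mul1r.
    rewrite -(@ler_pXn2r _ 2) ?nnegrE ?nr_ge0 // !nr_sqr.
    rewrite (reD (1 - f y)) (imD (1 - f y)) re_real im_real addr0.
    by have := mulr_ge0 (re y y1) (ltW e0); have := sqr_ge0 e; lra.
  - by rewrite f0 subrr mul0r.
have h : nr (1 - f z) * (1 - nr z) <= 0.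
  apply: (@le_eps _ _ _ (nr z)) => e e0.
  have := key e e0; have := nrD (1 - f z) (e%:C%C); rewrite nr_real gtr0_norm //.
  by have := nr_ge0 z; nra.
have : nr (1 - f z) <= 0.
  by move: h; rewrite pmulr_lle0 //; lra.
rewrite le_eqVlt ltNge nr_ge0 orbF nr_eq0 subr_eq0 => /eqP <- //.
Qed.

Theorem strong_max f c : (forall z, nr z < 1 -> differentiable f z) ->
  (forall z, nr z < 1 -> nr (f z) <= 1) -> nr c < 1 -> nr (f c) = 1 ->
  forall z, nr z < 1 -> f z = f c.
Proof.
move=> df fM c1 fc z z1.
have fc0 : f c != 0 by rewrite -nr_gt0 fc ltr01.
pose w := mob (- c) z.
have w1 : nr w < 1 by rewrite mob_disc ?nrN.
have zE : mob c w = z.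
  by rewrite /w -{1}[c]opprK mobK ?nrN // ltW.
have := @strong_max0 (fun y => f (mob c y) / f c); rewrite mob0 divff //.
move=> /(_ _ _ erefl w w1); rewrite zE => H.
apply: (mulIf (invr_neq0 fc0)); rewrite divff //; apply: H => y y1.
  apply: diffable_div (diffable_cst _ _) fc0; apply: diffable_comp.
    by apply: mob_diffable => //; apply: ltW.
  by apply: df; apply: mob_disc.
by rewrite nr_div fc divr1; apply: fM; apply: mob_disc.
Qed.

(** A derivative estimate that is uniform over all functions bounded by M, and
therefore survives pointwise limits. *)
Lemma second_order f M z : nr z < 1 ->
  (forall z, nr z < 1 -> differentiable f z) ->
  (forall z, nr z < 1 -> nr (f z) <= M) ->
  exists d, nr d <= 2 * M / (1 - nr z) /\ forall w, nr w < 1 ->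
    nr (f w - f z - d * (w - z)) <= 4 * M / (1 - nr z) ^+ 2 * nr (w - z) ^+ 2.
Proof.
move=> z1 df fM; have [g [dg gE gM]] := divide z1 df fM.
have [k [_ kE kM]] := divide z1 dg gM.
exists (g z); split=> [|w w1]; first exact: gM.
have -> : f w - f z - g z * (w - z) = k w * (w - z) ^+ 2.
  by rewrite [f w]gE [g w]kE; ring.
rewrite nrM nrX ler_wpM2r ?exprn_ge0 ?nr_ge0 //; apply: le_trans (kM w w1) _.
by rewrite le_eqVlt; apply/orP; left; apply/eqP; field; lra.
Qed.

End Division.

(** * Limits along an ultrafilter *)

Section Ultralimits.
Variable R : realType.
Local Notation C := (Cplx R).
Implicit Types (f g : C -> C) (z w c : C) (M K N e : R).

Lemma cvg_nrP (F : set_system nat) (FF : Filter F) (a : nat -> C) (x : C) :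
  a @ F --> x <-> forall e, 0 < e -> F [set n | nr (a n - x) <= e].
Proof.
split=> [h e e0|h].
  have := proj1 (@cvgrPdist_le _ _ _ _ FF _ _) h (e%:C%C).
  rewrite ltcR => /(_ e0); apply: filterS => n /=.
  by rewrite nr_leP nrB.
apply/(@cvgrPdist_le _ _ _ _ FF) => _ /real_eps [e e0 ->].
by apply: filterS (h e e0) => n /=; rewrite nr_leP nrB.
Qed.

Context {U : set_system nat} {UU : UltraFilter U}.

Lemma ulimD (a b : nat -> C) (x y : C) : a @ U --> x -> b @ U --> y ->
  (fun n => a n + b n) @ U --> x + y.
Proof. by move=> ha hb; exact: (cvgD ha hb). Qed.

Lemma ulimB (a b : nat -> C) (x y : C) : a @ U --> x -> b @ U --> y ->
  (fun n => a n - b n) @ U --> x - y.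
Proof. by move=> ha hb; exact: (cvgB ha hb). Qed.

Lemma ulimM (a b : nat -> C) (x y : C) : a @ U --> x -> b @ U --> y ->
  (fun n => a n * b n) @ U --> x * y.
Proof. by move=> ha hb; exact: (cvgM ha hb). Qed.

Lemma ulim_cst (x : C) : (fun=> x) @ U --> x.
Proof. exact: cvg_cst. Qed.

Lemma ultra_real_limit (a : nat -> R) M : (forall n, `|a n| <= M) ->
  exists x, forall e, 0 < e -> U [set n | `|a n - x| <= e].
Proof.
move=> aM; pose T : set R := [set t | U [set n | t <= a n]].
have T0 : T (- M).
  by apply: filterS filterT => n _ /=; have := aM n; rewrite ler_norml => /andP[].
have Tb : ubound T M.
  move=> t /= /filter_ex [n /= tn]; apply: le_trans tn _.
  by have := aM n; rewrite ler_norml => /andP[].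
have hT : has_sup T by split; [exists (- M) | exists M].
exists (sup T) => e e0.
have [t Tt te] := sup_adherent e0 hT.
have h2 : U [set n | a n < sup T + e].
  have [h|h] := in_ultra_setVsetC [set n | sup T + e <= a n] UU.
    have : sup T + e <= sup T by apply: ub_le_sup => //; exists M.
    by lra.
  by apply: filterS h => n /= /negP; rewrite -ltNge.
apply: filterS2 Tt h2 => n /= h3 h4; rewrite ler_norml; lra.
Qed.

Lemma ultra_limit (a : nat -> C) M : (forall n, nr (a n) <= M) ->
  exists x : C, a @ U --> x.
Proof.
move=> aM.
have [n|x hx] := @ultra_real_limit (fun n => complex.Re (a n)) M.
  exact: le_trans (re_le_nr _) (aM n).
have [n|y hy] := @ultra_real_limit (fun n => complex.Im (a n)) M.
  exact: le_trans (im_le_nr _) (aM n).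
exists (x +i* y)%C; apply/cvg_nrP => e e0.
have e2 : 0 < e / 2 by lra.
apply: filterS2 (hx _ e2) (hy _ e2) => n /= h1 h2.
by apply: le_trans (nr_le_reim _) _; rewrite !reimE /=; lra.
Qed.

Lemma ultra_limit_le (a : nat -> C) (x : C) K : a @ U --> x ->
  (forall e, 0 < e -> U [set n | nr (a n) <= K + e]) -> nr x <= K.
Proof.
move=> /cvg_nrP ax h; apply: (@le_eps _ _ _ 2) => e e0.
have /filter_ex [n /= [h1 h2]] :
    U ([set n | nr (a n - x) <= e] `&` [set n | nr (a n) <= K + e]).
  by apply: filterI; [exact: ax | exact: h].
by have := nrD (x - a n) (a n); rewrite subrK (nrB x); lra.
Qed.

Lemma ultra_limit_le_all (a : nat -> C) (x : C) K : a @ U --> x ->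
  (forall n, nr (a n) <= K) -> nr x <= K.
Proof.
move=> ax h; apply: (ultra_limit_le ax) => e e0.
by apply: filterS filterT => n _ /=; have := h n; lra.
Qed.

(** Montel's theorem; the limit is holomorphic because the second-order
estimate is uniform in n. *)
Theorem montel (F : nat -> C -> C) M :
  (forall n z, nr z < 1 -> differentiable (F n) z) ->
  (forall n z, nr z < 1 -> nr (F n z) <= M) ->
  exists f, (forall z, nr z < 1 -> differentiable f z) /\
    forall z, nr z < 1 -> (fun n => F n z) @ U --> f z.
Proof.
move=> dF FM.
have /choice [f hf] : forall z, exists x : C, nr z < 1 -> (fun n => F n z) @ U --> x.
  move=> z; have [z1|z1] := boolP (nr z < 1); last by exists 0.
  by have [x hx] := @ultra_limit (fun n => F n z) M (fun n => FM n z z1); exists x.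
exists f; split=> // z z1.
have M0 : 0 <= M by apply: le_trans (nr_ge0 _) (FM 0%N z z1).
have /choice [d hd] : forall n, exists d, nr d <= 2 * M / (1 - nr z) /\
    forall w, nr w < 1 -> nr (F n w - F n z - d * (w - z)) <=
      4 * M / (1 - nr z) ^+ 2 * nr (w - z) ^+ 2.
  by move=> n; apply: second_order (dF n) (FM n).
have [D hD] := ultra_limit (fun n => proj1 (hd n)).
set K := 4 * M / (1 - nr z) ^+ 2 in hd.
have K0 : 0 <= K by apply: divr_ge0; [lra | exact: sqr_ge0].
apply/has_derivP; exists D => e e0.
exists (Num.min (1 - nr z) (e / (K + 1))).
  by rewrite lt_min divr_gt0 //; lra.
move=> w; rewrite lt_min => /andP[w1 w2].
have w1' : nr w < 1 by have := nrD (w - z) z; rewrite subrK; lra.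
have lim := ulimB (ulimB (hf w w1') (hf z z1)) (ulimM hD (@ulim_cst (w - z))).
apply: le_trans (ultra_limit_le_all lim (fun n => proj2 (hd n) w w1')) _.
rewrite expr2 mulrA ler_wpM2r ?nr_ge0 //.
have K1 : 0 < K + 1 by lra.
move: w2; rewrite ltr_pdivlMr // => w2; have := nr_ge0 (w - z); lra.
Qed.

End Ultralimits.

(** * Polynomial approximation *)

Section Taylor.
Variable R : realType.
Local Notation C := (Cplx R).
Implicit Types (f g : C -> C) (z w c : C) (M K N e : R).

Lemma prim_root_exists n : (0 < n)%N -> exists z : C, n.-primitive_root z.
Proof.
pose p : {poly C} := 'X^n - 1; have [r Dp] := closed_field_poly_normal p.
move=> n_gt0; rewrite (monicP _) ?monicXnsubC // scale1r in Dp.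
have rn1: all n.-unity_root r by apply/allP=> z; rewrite -root_prod_XsubC -Dp.
have sz_r: (n < (size r).+1)%N.
  by rewrite -(size_prod_XsubC r id) -Dp size_XnsubC.
have [|z] := hasP (has_prim_root n_gt0 rn1 _ sz_r); last by exists z.
by rewrite -separable_prod_XsubC -Dp separable_Xn_sub_1 // pnatr_eq0 -lt0n.
Qed.

Lemma prim_root_sum n (x : C) i : n.-primitive_root x -> (0 < i < n)%N ->
  \sum_(j < n) (x ^+ i) ^+ j = 0.
Proof.
move=> px /andP[i0 ilt].
have x1 : x ^+ i - 1 != 0.
  by rewrite subr_eq0 -(prim_order_dvd px) gtnNdvd.
apply: (mulfI x1); rewrite mulr0 -subrX1 -exprM mulnC exprM.
by rewrite (prim_expr_order px) expr1n subrr.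
Qed.

Lemma prim_root_nr n (x : C) : n.-primitive_root x -> nr x = 1.
Proof.
move=> px; have n0 := prim_order_gt0 px.
have := congr1 (@nr R) (prim_expr_order px); rewrite nrX nr1 => /eqP.
by rewrite pexprn_eq1 ?nr_ge0 // eqn0Ngt n0 /= => /eqP.
Qed.

(** By the maximum principle, division by a power of z does not increase the
supremum. *)
Lemma quotient_pow_le k G N : (forall z, nr z < 1 -> differentiable G z) ->
  (forall z, nr z < 1 -> nr (z ^+ k * G z) <= N) ->
  forall z, nr z < 1 -> nr (G z) <= N.
Proof.
move=> dG; elim: k => [|k IH] hN.
  by move=> z /hN; rewrite expr0 mul1r.
apply: IH => z z1; have n0 : nr (0 : C) < 1 by rewrite nr0 ltr01.
have dk w : nr w < 1 -> differentiable (fun w => w ^+ k * G w) w.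
  by move=> w1; apply: diffableM (diffableX _ (diffable_id _)) (dG w w1).
have -> : N = N / (1 - nr (0 : C)) by rewrite nr0 subr0 divr1.
apply: (@max_principle_quot _ [::] (fun w => w ^+ k * G w)); last exact: z1.
- exact: n0.
- by move=> w w1; apply/differentiable_cont/dk.
- by move=> w w1 _; apply: dk.
move=> w w1; rewrite subr0 -nrM mulrC mulrA -exprS; exact: hN.
Qed.

Lemma taylor_expansion f M : (forall z, nr z < 1 -> differentiable f z) ->
  (forall z, nr z < 1 -> nr (f z) <= M) ->
  exists (a : nat -> C) (H : nat -> C -> C),
    (forall k z, nr z < 1 -> differentiable (H k) z) /\
    (forall k, H k 0 = a k) /\
    forall k z, f z = \sum_(i < k) a i * z ^+ i + z ^+ k * H k z.
Proof.
move=> df fM; have n0 : nr (0 : C) < 1 by rewrite nr0 ltr01.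
pose T := {g : C -> C | (forall z, nr z < 1 -> differentiable g z) /\
   exists B, forall z, nr z < 1 -> nr (g z) <= B}.
have step (g : T) : exists g' : T, forall z, sval g z = sval g 0 + z * sval g' z.
  case: g => g [dg [B gB]] /=; have [h [dh hE hB]] := divide n0 dg gB.
  unshelve eexists (exist _ h _).
    by split => //; exists (2 * B / (1 - nr (0 : C))).
  by move=> z /=; rewrite [LHS]hE subr0.
have /choice [nx hnx] := step.
pose F0 : T := exist _ f (conj df (ex_intro _ M fM)).
pose H (k : nat) : T := iter k nx F0.
exists (fun k => sval (H k) 0), (fun k => sval (H k)); split.
  by move=> k; case: (svalP (H k)).
split=> // k z; elim: k => [|k IH].
  by rewrite big_ord0 add0r expr0 mul1r.
rewrite IH big_ord_recr /= -addrA; congr (_ + _).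
by rewrite [sval (iter k nx F0) z]hnx exprSr /H /=; ring.
Qed.

(** Averaging f over the k-th roots of unity leaves only the coefficients whose
index is a multiple of k, which isolates the k-th one. *)
Lemma taylor_coef_le f M (a : nat -> C) (H : nat -> C -> C) :
  (forall z, nr z < 1 -> nr (f z) <= M) ->
  (forall k z, nr z < 1 -> differentiable (H k) z) ->
  (forall k, H k 0 = a k) ->
  (forall k z, f z = \sum_(i < k) a i * z ^+ i + z ^+ k * H k z) ->
  forall k, nr (a k) <= 2 * M.
Proof.
move=> fM dH H0 fE k; have n0 : nr (0 : C) < 1 by rewrite nr0 ltr01.
have fa : f 0 = a 0%N by rewrite (fE 0%N) big_ord0 add0r expr0 mul1r H0.
have M0 : 0 <= M by apply: le_trans (nr_ge0 _) (fM 0 n0).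
case: k => [|k]; first by rewrite -fa; have := fM 0 n0; lra.
have [x px] := prim_root_exists (ltn0Sn k).
pose n : C := k.+1%:R.
have nz : n != 0 by rewrite pnatr_eq0.
pose G z := (\sum_(j < k.+1) H k.+1 (x ^+ j * z)) / n.
have xj j z : nr (x ^+ j * z) = nr z.
  by rewrite nrM nrX (prim_root_nr px) expr1n mul1r.
have dG z : nr z < 1 -> differentiable G z.
  move=> z1; apply: diffableM (diffable_cst _ _); apply: diffable_sum => j.
  apply: diffable_comp; last by apply: dH; rewrite xj.
  exact: diffableM (diffable_cst _ _) (diffable_id _).
have -> : a k.+1 = G 0.
  rewrite /G (eq_bigr (fun=> a k.+1)); last by move=> j _; rewrite mulr0 H0.
  by rewrite sumr_const card_ord -mulr_natr mulfK.
apply: (quotient_pow_le (k := k.+1) dG); last exact: n0.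
move=> z z1.
have -> : z ^+ k.+1 * G z = (\sum_(j < k.+1) f (x ^+ j * z)) / n - f 0.
  rewrite /G mulrA; apply: (mulIf nz); rewrite mulrBl !divfK // fa.
  rewrite mulr_sumr; apply/eqP; rewrite eq_sym subr_eq; apply/eqP.
  rewrite (eq_bigr (fun j : 'I_k.+1 => \sum_(i < k.+1) a i * z ^+ i * (x ^+ i) ^+ j +
     z ^+ k.+1 * H k.+1 (x ^+ j * z))); last first.
    move=> j _; rewrite (fE k.+1); congr (_ + _); last first.
      by rewrite exprMn exprAC (prim_expr_order px) expr1n mul1r.
    by apply: eq_bigr => i _; rewrite exprMn exprAC; ring.
  rewrite big_split /= addrC; congr (_ + _).
  rewrite exchange_big /= (bigD1 ord0) //= [X in _ + X]big1 ?addr0.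
    under eq_bigr do rewrite !expr0 expr1n !mulr1.
    by rewrite sumr_const card_ord mulr_natr.
  move=> i i0; rewrite -mulr_sumr (prim_root_sum px) ?mulr0 //.
  by rewrite ltn_ord andbT lt0n.
apply: le_trans (nr_le_add _ _) _; rewrite nr_div nr_nat.
have h1 : nr (\sum_(j < k.+1) f (x ^+ j * z)) <= M * k.+1%:R.
  apply: le_trans (nr_sum _ _ _) _.
  apply: (@le_trans _ _ (\sum_(j < k.+1) M)).
    by apply: ler_sum => j _; apply: fM; rewrite xj.
  by rewrite sumr_const card_ord mulr_natr.
have h2 : nr (\sum_(j < k.+1) f (x ^+ j * z)) / k.+1%:R <= M.
  by rewrite ler_pdivrMr ?ltr0n.
by apply: le_trans (lerD h2 (fM 0 n0)) _; lra.
Qed.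

Lemma linear_pow_small (rho e : R) : 0 <= rho < 1 -> 0 < e ->
  exists n, (1 + 2 * n%:R) * rho ^+ n <= e.
Proof.
move=> /andP[r0 r1] e0; pose t : R := 1 - rho; have t0 : 0 < t by rewrite /t; lra.
have B (m : nat) : rho ^+ m * (1 + m%:R * t) <= 1.
  elim: m => [|m IH]; first by rewrite expr0 mul0r addr0 mulr1.
  rewrite exprS -natr1; apply: le_trans IH.
  have p0 : 0 <= rho ^+ m by apply: exprn_ge0.
  have m0 : 0 <= m%:R :> R by apply: ler0n.
  rewrite mulrAC mulrC; apply: ler_wpM2l => //.
  have h : 0 <= m%:R * t ^+ 2 by rewrite mulr_ge0 ?sqr_ge0.
  have h' : 0 <= t ^+ 2 by rewrite sqr_ge0.
  by rewrite /t in h h' *; lra.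
pose L := 1 + 4 / t; have L0 : 0 < L by rewrite addr_gt0 // divr_gt0.
exists (2 * (Num.truncn (L / (e * t))).+1)%N; set m := (Num.truncn _).+1.
have mL : L / (e * t) < m%:R := truncnS_gt _.
have m0 : 0 < m%:R :> R by rewrite ltr0n.
rewrite ltr_pdivrMr ?mulr_gt0 // in mL.
have p0 : 0 <= rho ^+ m by apply: exprn_ge0.
have q : 0 < 1 + m%:R * t by rewrite addr_gt0 // mulr_gt0.
have b1 : rho ^+ m <= (1 + m%:R * t)^-1 by rewrite -[leRHS]mul1r ler_pdivlMr // B.
rewrite mulnC exprM natrM.
have h1 : 1 + 2 * (m%:R * 2) <= L * (1 + m%:R * t).
  have -> : L * (1 + m%:R * t) = 1 + 4 * m%:R + m%:R * t + 4 / t.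
    by rewrite /L; field; rewrite gt_eqF.
  have : 0 <= m%:R * t by rewrite mulr_ge0 ?ltW.
  have : 0 <= 4 / t by rewrite divr_ge0 ?ltW.
  by lra.
apply: (@le_trans _ _ (L * (1 + m%:R * t) * (rho ^+ m * (1 + m%:R * t)^-1))).
  apply: ler_pM => //; first lra.
    by rewrite expr2 mulr_ge0.
  by rewrite expr2 ler_wpM2l.
have -> : L * (1 + m%:R * t) * (rho ^+ m * (1 + m%:R * t)^-1) = L * rho ^+ m.
  by field; rewrite gt_eqF.
apply: (@le_trans _ _ (L * (1 + m%:R * t)^-1)); first by rewrite ler_pM2l.
rewrite ler_pdivrMr //; lra.
Qed.

Theorem poly_approx f M : (forall z, nr z < 1 -> differentiable f z) ->
  (forall z, nr z < 1 -> nr (f z) <= M) ->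
  forall rho e, 0 <= rho < 1 -> 0 < e ->
  exists p : {poly C}, forall z, nr z <= rho -> nr (p.[z] - f z) <= e.
Proof.
move=> df fM rho e r01 e0; have n0 : nr (0 : C) < 1 by rewrite nr0 ltr01.
have M0 : 0 <= M by apply: le_trans (nr_ge0 _) (fM 0 n0).
have [a [H [dH [H0 fE]]]] := taylor_expansion df fM.
have aM := taylor_coef_le fM dH H0 fE.
have M1 : 0 < M + 1 by lra.
have [n hn] := linear_pow_small r01 (divr_gt0 e0 M1).
have HB z : nr z < 1 -> nr (H n z) <= M * (1 + 2 * n%:R).
  apply: (quotient_pow_le (k := n)) => [w|w w1]; first exact: dH.
  have -> : w ^+ n * H n w = f w - \sum_(i < n) a i * w ^+ i.
    by rewrite (fE n w); ring.
  apply: le_trans (nr_le_add _ _) _.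
  have h : nr (\sum_(i < n) a i * w ^+ i) <= 2 * M * n%:R.
    apply: le_trans (nr_sum _ _ _) _.
    apply: (@le_trans _ _ (\sum_(i < n) (2 * M))).
      apply: ler_sum => i _; rewrite nrM nrX -[leRHS]mulr1.
      by apply: ler_pM; rewrite ?exprn_ge0 ?nr_ge0 ?exprn_ile1 ?nr_ge0 // ltW.
    by rewrite sumr_const card_ord mulr_natr.
  by have := fM w w1; lra.
exists (\poly_(i < n) a i) => z zr.
have z1 : nr z < 1 by case/andP: r01 => _; apply: le_lt_trans zr.
rewrite horner_poly (fE n z) opprD addNKr nrN nrM nrX.
apply: (@le_trans _ _ (rho ^+ n * (M * (1 + 2 * n%:R)))).
  apply: ler_pM; rewrite ?exprn_ge0 ?nr_ge0 ?HB //.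
  by apply: lerXn2r; rewrite ?nnegrE ?nr_ge0 //; case/andP: r01.
rewrite ler_pdivlMr // in hn; apply: le_trans hn.
have q0 : 0 <= (1 + 2 * n%:R) * rho ^+ n.
  rewrite mulr_ge0 ?exprn_ge0 //; last by case/andP: r01.
  by have := ler0n R n; lra.
have -> : rho ^+ n * (M * (1 + 2 * n%:R)) = (1 + 2 * n%:R) * rho ^+ n * M by ring.
by apply: ler_wpM2l => //; lra.
Qed.

End Taylor.

(** * Zero-free functions and their holomorphic roots *)

Section Towers.
Variable R : realType.
Local Notation C := (Cplx R).
Implicit Types (f g G : C -> C) (z w c : C) (M K e : R).

Lemma sqrtc_sqr z : (sqrtc z : C) ^+ 2 = z.
Proof. exact: sqr_sqrtc. Qed.

Lemma sqrtc_re_gt0 z : 0 < complex.Re z -> 0 < complex.Re (sqrtc z).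
Proof.
case: z => a b /= a0; rewrite sqrtr_gt0 divr_gt0 //.
by rewrite ltr_wpDl // sqrtr_ge0.
Qed.

Lemma sqrtc_diffable z : 0 < complex.Re z ->
  differentiable (fun w : C => sqrtc w : C) z.
Proof.
move=> z0; pose s : C := sqrtc z; pose r := complex.Re s.
have r0 : 0 < r by apply: sqrtc_re_gt0.
have s0 : s != 0 by rewrite -nr_gt0 (lt_le_trans r0) // (le_trans (ler_norm _)) // re_le_nr.
have sr : r <= nr s by apply: le_trans (ler_norm _) (re_le_nr _).
apply/has_derivP; exists (2 * s)^-1 => e e0.
exists (Num.min (complex.Re z) (e * (2 * r ^+ 3))).
  by rewrite lt_min z0 !mulr_gt0 ?exprn_gt0.
move=> w; rewrite lt_min => /andP[w1 w2].
have wre : 0 < complex.Re w.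
  have := le_lt_trans (re_le_nr (w - z)) w1; rewrite !reimE ltr_norml; lra.
pose t : C := sqrtc w; have t0 : 0 < complex.Re t by apply: sqrtc_re_gt0.
have ts : r <= nr (t + s).
  apply: le_trans (re_le_nr _); rewrite reD -/r ger0_norm; lra.
have ts0 : t + s != 0 by rewrite -nr_gt0 (lt_le_trans r0).
have wz : w - z = (t - s) * (t + s).
  by rewrite -[w]sqrtc_sqr -[z]sqrtc_sqr -/t -/s; ring.
have -> : t - s - (2 * s)^-1 * (w - z) =
    - ((w - z) ^+ 2 / (2 * s * (t + s) ^+ 2)).
  by rewrite wz; field; rewrite ts0 s0.
rewrite nrN nr_div !(nrX, nrM) nr_nat ler_pdivrMr; last first.
  by rewrite !mulr_gt0 ?exprn_gt0 ?nr_gt0.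
have h1 : 2 * r ^+ 3 <= 2 * nr s * nr (t + s) ^+ 2.
  rewrite -mulrA ler_pM2l // exprS.
  apply: (ler_pM (ltW r0) (sqr_ge0 _) sr).
  by apply: lerXn2r; rewrite ?nnegrE ?nr_ge0 // ltW.
have N0 := nr_ge0 (w - z).
rewrite expr2 mulrAC ler_wpM2r //.
apply: le_trans (ltW w2) _; apply: ler_wpM2l h1; exact: ltW.
Qed.

(** Apart from the zero function, these are the zero-free functions on the disc.
The existence of roots makes logarithms unnecessary: it is preserved by products
and gives a quantitative form of zero-freeness, which passes to limits. *)
Definition tower G := forall k : nat, exists y : C -> C,
  (forall z, nr z < 1 -> differentiable y z) /\
  forall z, nr z < 1 -> y z ^+ (2 ^ k) = G z.

Lemma tower_mul f g : tower f -> tower g -> tower (fun z => f z * g z).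
Proof.
move=> hf hg k; have [x [dx xE]] := hf k; have [y [dy yE]] := hg k.
exists (fun z => x z * y z); split=> z z1; first exact: diffableM (dx z z1) (dy z z1).
by rewrite exprMn xE ?yE.
Qed.

Lemma tower_cst c : tower (fun=> c).
Proof.
move=> k; exists (fun=> (2 ^ k).-root c); split=> z z1; first exact: diffable_cst.
by rewrite rootCK // expn_gt0.
Qed.

Lemma tower_re_gt0 f : (forall z, nr z < 1 -> differentiable f z) ->
  (forall z, nr z < 1 -> 0 < complex.Re (f z)) -> tower f.
Proof.
move=> df f0 k.
suff [y [dy [y0 yE]]] : exists y : C -> C,
    (forall z, nr z < 1 -> differentiable y z) /\
    (forall z, nr z < 1 -> 0 < complex.Re (y z)) /\
    forall z, nr z < 1 -> y z ^+ (2 ^ k) = f z by exists y.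
elim: k => [|k [y [dy [y0 yE]]]]; first by exists f.
exists (fun z => sqrtc (y z) : C); split.
  move=> z z1; exact: diffable_comp (dy z z1) (sqrtc_diffable (y0 z z1)).
split=> z z1; first exact/sqrtc_re_gt0/y0.
by rewrite expnS exprM sqrtc_sqr yE.
Qed.

Lemma tower_linear c : nr c <= 1 -> tower (fun z => 1 - c * z).
Proof.
move=> c1; apply: tower_re_gt0 => z z1.
  exact: diffableB (diffable_cst _ _) (diffableM (diffable_cst _ _) (diffable_id _)).
rewrite reD reN re1 subr_gt0; apply: le_lt_trans (ler_norm _) _.
apply: le_lt_trans (re_le_nr _) _; rewrite nrM.
by apply: le_lt_trans z1; rewrite ler_piMl ?nr_ge0.
Qed.

Lemma schwarz_pick0 f : (forall z, nr z < 1 -> differentiable f z) ->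
  (forall z, nr z < 1 -> nr (f z) <= 1) ->
  forall z, nr z < 1 -> (nr (f 0) - nr z) / (1 + nr z) <= nr (f z).
Proof.
move=> df fM z z1; have n0 : nr (0 : C) < 1 by rewrite nr0 ltr01.
have zg := nr_ge0 z.
have den : 0 < 1 + nr z by lra.
rewrite ler_pdivrMr //.
have [f1|f1] := leP 1 (nr (f 0)).
  have f1' : nr (f 0) = 1 by apply/eqP; rewrite eq_le f1 fM.
  by rewrite (strong_max df fM n0 f1' z1) f1'; lra.
have f1N : nr (- f 0) < 1 by rewrite nrN.
have h : nr (mob (- f 0) (f z)) <= 1 * nr z.
  apply: (@schwarz _ (fun w => mob (- f 0) (f w))); last exact: z1.
  - by move=> w w1; apply: diffable_comp (df w w1) (mob_diffable f1N (fM w w1)).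
  - move=> w w1; rewrite -(@ler_pXn2r _ 2) ?nnegrE ?nr_ge0 // expr1n -subr_ge0.
    rewrite nr_mob ?fM // divr_ge0 ?sqr_ge0 // mulr_ge0 // subr_ge0.
      by rewrite -(expr1n _ 2) lerXn2r ?nnegrE ?nr_ge0 // ltW.
    by rewrite -(expr1n _ 2) lerXn2r ?nnegrE ?nr_ge0 // fM.
  - by rewrite /mob subrr mul0r.
have d0 := mob_den_neq0 f1N (fM z z1).
move: h; rewrite mul1r nr_div ler_pdivrMr ?nr_gt0 // => h.
have h1 := nr_le_sub (f 0) (f 0 - f z).
have h2 : nr (1 + (- f 0)^* * f z) <= 1 + nr (f z).
  apply: le_trans (nrD _ _) _; rewrite nr1 nrM nr_conj nrN lerD2l.
  by rewrite ler_piMl ?nr_ge0 ?fM.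
have h3 : nr (f 0) - nr (f z) <= nr (f z - f 0) by rewrite nrB nr_le_sub.
by have := ler_wpM2l zg h2; lra.
Qed.

(** The Schwarz-Pick inequality says nothing when f w is small compared with the
distance of w and z, but it applies to a root of f of high enough order, whose
modulus at w is close to 1. *)
Lemma tower_lower_bound w z c : nr w < 1 -> nr z < 1 -> c != 0 ->
  exists2 d : R, 0 < d & forall G, tower G ->
    (forall y, nr y < 1 -> nr (G y) <= 1) ->
    nr c <= nr (G w) -> d <= nr (G z).
Proof.
move=> w1 z1 c0; pose y := mob (- w) z.
have wN : nr (- w) < 1 by rewrite nrN.
have y1 : nr y < 1 by apply: mob_disc.
have yE : mob w y = z by rewrite /y -{1}[w]opprK mobK // ltW.
have yg := nr_ge0 y.
pose a := (1 + nr y) / 2.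
have a1 : a < 1 by rewrite /a; lra.
have a0 : 0 < a by rewrite /a; lra.
have [k hk] : exists k : nat, a ^+ (2 ^ k) < nr c.
  have [|n hn] := @pow_unbounded R a^-1 (nr c)^-1; first by rewrite invf_gt1.
  exists n; rewrite exprVn ltf_pV2 ?posrE ?exprn_gt0 ?nr_gt0 // in hn.
  apply: le_lt_trans hn; rewrite ler_wiXn2l //; [exact: ltW|exact: ltW|].
  exact/ltnW/ltn_expl.
have b0 : 0 < (1 - nr y) / 4 by lra.
exists (((1 - nr y) / 4) ^+ (2 ^ k)); first by rewrite exprn_gt0.
move=> G tG G1 cG; have [f [df fE]] := tG k.
have k0 : (2 ^ k != 0)%N by rewrite -lt0n expn_gt0.
have f1 t : nr t < 1 -> nr (f t) <= 1.
  move=> t1.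
  by rewrite -(@expr_le1 _ (2 ^ k)) ?nr_ge0 ?expn_gt0 // -nrX fE // G1.
have fw : a <= nr (f w).
  rewrite leNgt; apply/negP => fa.
  have : nr (G w) < nr c.
    rewrite -fE // nrX; apply: le_lt_trans hk.
    by apply: lerXn2r; rewrite ?nnegrE ?nr_ge0 // ltW.
  by rewrite ltNge cG.
rewrite -fE // nrX; apply: lerXn2r; rewrite ?nnegrE ?nr_ge0 //; first exact: ltW.
rewrite -yE; apply: le_trans (@schwarz_pick0 (fun t => f (mob w t)) _ _ y y1).
- rewrite mob0 ler_pdivlMr; last lra.
  by rewrite /a in fw; nra.
- move=> t t1; apply: diffable_comp (mob_diffable w1 (ltW t1)) (df _ _).
  exact: mob_disc.
- by move=> t t1; apply: f1; apply: mob_disc.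
Qed.

(** Each root of p contributes a linear factor without zeros in the disc and, when
it lies in the disc, a Moebius factor, which has modulus one on the circle. *)
Lemma poly_inner_outer (p : {poly C}) : p != 0 -> exists G B : C -> C,
  [/\ tower G, forall z, nr z < 1 -> differentiable B z,
      forall z, nr z < 1 -> nr (B z) <= 1,
      forall e, 0 < e -> exists2 r : R, r < 1 &
        forall z, r < nr z < 1 -> 1 - e <= nr (B z) &
      forall z, nr z < 1 -> p.[z] = G z * B z].
Proof.
move=> p0; have [s pE] := closed_field_poly_normal p.
have -> : horner p = fun z => lead_coef p * \prod_(t <- s) (z - t).
  apply/funext => z; rewrite {1}pE hornerZ horner_prod.
  by congr (_ * _); apply: eq_bigr => t _; rewrite hornerXsubC.
move: (lead_coef p) => {p0 pE} c; elim: s => [|t s [G [B [tG dB B1 Bc GB]]]].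
  exists (fun=> c), (fun=> 1); split.
  - exact: tower_cst.
  - by move=> z _; apply: diffable_cst.
  - by move=> z _; rewrite nr1.
  - by move=> e e0; exists 0 => // z _; rewrite nr1; lra.
  - by move=> z _; rewrite big_nil.
have [t1|t1] := ltP (nr t) 1; last first.
  have t0 : t != 0 by rewrite -nr_gt0; lra.
  exists (fun z => G z * (- t * (1 - t^-1 * z))), B; split=> //.
    apply: tower_mul => //; apply: tower_mul; first exact: tower_cst.
    by apply: tower_linear; rewrite nrV invf_le1 //; lra.
  move=> z z1; rewrite big_cons mulrCA (GB z z1); field.
  exact: t0.
have tN : nr (- t) < 1 by rewrite nrN.
exists (fun z => G z * (1 - t^* * z)), (fun z => B z * mob (- t) z); split.
- by apply: tower_mul => //; apply: tower_linear; rewrite nr_conj ltW.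
- by move=> z z1; apply: diffableM (dB z z1) (mob_diffable tN (ltW z1)).
- move=> z z1; rewrite nrM mulr_ile1 ?nr_ge0 ?B1 // ltW //; exact: mob_disc.
- move=> e e0; have e2 : 0 < Num.min 1 (e / 2) by rewrite lt_min ltr01 divr_gt0.
  have [r r1 hr] := Bc _ e2; pose d := (1 - nr t) ^+ 2.
  have tg := nr_ge0 t.
  have d0 : 0 < d by rewrite exprn_gt0 // subr_gt0.
  exists (Num.max (Num.max r 0) (1 - e * d / 4)).
    rewrite !gt_max r1 ltr01 /= ltrBlDr ltrDl. by apply: divr_gt0; first exact: mulr_gt0.
  move=> z; rewrite !gt_max => /andP[/andP[/andP[rz z0] ez] z1].
  have {}hr : 1 - e / 2 <= nr (B z).
    apply: le_trans (hr z _); last by rewrite rz.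
    by rewrite lerD2l lerN2 ge_min lexx orbT.
  have m1 := mob_disc tN z1; have mg := nr_ge0 (mob (- t) z).
  have b1 := B1 z z1; have bg := nr_ge0 (B z).
  have : 1 - nr (mob (- t) z) ^+ 2 <= e / 2.
    rewrite (nr_mob tN (ltW z1)) nrN; have dg := mob_den_ge (- t) (ltW z1).
    rewrite nrN in dg; rewrite ler_pdivrMr; last by rewrite exprn_gt0 //; lra.
    have h1 : d <= nr (1 + (- t)^* * z) ^+ 2.
      by rewrite /d lerXn2r ?nnegrE ?nr_ge0 // subr_ge0 ltW.
    have h2 : 1 - nr z ^+ 2 <= e * d / 2 by nra.
    have h3 : 0 <= 1 - nr z ^+ 2 by nra.
    have h4 : (1 - nr t ^+ 2) * (1 - nr z ^+ 2) <= 1 - nr z ^+ 2.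
      by rewrite ler_piMl //; nra.
    have : e / 2 * d <= e / 2 * nr (1 + (- t)^* * z) ^+ 2.
      by rewrite ler_wpM2l // divr_ge0 // ltW.
    by lra.
  move=> m2; rewrite nrM; have : 1 - e / 2 <= nr (mob (- t) z) by nra.
  by nra.
move=> z z1; rewrite big_cons mulrCA GB // /mob rmorphN mulNr.
by field; have := mob_den_neq0 tN (ltW z1); rewrite rmorphN mulNr.
Qed.

End Towers.

(** * Lifting a disc in the symmetrised bidisc to a contractive disc *)

Section Lifting.
Variable R : realType.
Local Notation C := (Cplx R).
Implicit Types (z w c x y h : C) (M K e : R).

(** The symmetric matrix with rows (x, h) and (h, y) has norm at most K.  The
bound is stated for the bilinear form, in which the entries appear linearly, so
that it can be proved by the maximum principle. *)
Definition norm_le K x y h := forall a b c d : C,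
  nr (a * (x * c + h * d) + b * (h * c + y * d)) <=
  K / 2 * (nr a ^+ 2 + nr b ^+ 2 + nr c ^+ 2 + nr d ^+ 2).

Lemma quad_form_ge0 (al be g c d : R) : 0 <= al -> 0 <= be ->
  g ^+ 2 <= al * be -> 0 <= c -> 0 <= d ->
  2 * (g * c * d) <= al * c ^+ 2 + be * d ^+ 2.
Proof.
move=> a0 b0 gab c0 d0.
have [az|az] := eqVneq al 0.
  have g0 : g ^+ 2 = 0 by apply/eqP; rewrite eq_le sqr_ge0 andbT; rewrite az mul0r in gab.
  have -> : g = 0 by apply/eqP; rewrite -sqrf_eq0 g0.
  by rewrite az !mul0r mulr0 add0r mulr_ge0 ?sqr_ge0.
have ap : 0 < al by rewrite lt_neqAle eq_sym az.
rewrite -(ler_pM2l ap).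
have h1 : g ^+ 2 * d ^+ 2 <= al * be * d ^+ 2 by rewrite ler_wpM2r ?sqr_ge0.
have h2 := sqr_ge0 (al * c - g * d).
lra.
Qed.

(** The square of the Hilbert-Schmidt norm and the determinant are the symmetric
functions of the singular values, and the hypotheses say that K^2 is at least
the mean of their squares and that the characteristic polynomial of x x^* is
nonnegative at K^2. *)
Lemma norm_leP K x y h : 0 < K ->
  let s := nr x ^+ 2 + nr y ^+ 2 + 2 * nr h ^+ 2 in
  s <= 2 * K ^+ 2 -> K ^+ 2 * s <= K ^+ 4 + nr (x * y - h ^+ 2) ^+ 2 ->
  norm_le K x y h.
Proof.
move=> K0 s sK sD a b c d.
pose A := nr x ^+ 2 + nr h ^+ 2; pose B := nr h ^+ 2 + nr y ^+ 2.
pose g : C := x * h^* + h * y^*.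
have gE : A * B - nr g ^+ 2 = nr (x * y - h ^+ 2) ^+ 2.
  by rewrite /A /B /g (expr2 h) !nr_sqr !reimE; ring.
have sE : s = A + B by rewrite /s /A /B; ring.
have ab : nr g ^+ 2 <= (K ^+ 2 - A) * (K ^+ 2 - B) by rewrite sE in sD; lra.
have g0 := sqr_ge0 (nr g).
have al0 : 0 <= K ^+ 2 - A.
  rewrite leNgt; apply/negP => al; have be : 0 < K ^+ 2 - B by lra.
  have : (K ^+ 2 - A) * (K ^+ 2 - B) < 0 by rewrite nmulr_rlt0.
  by lra.
have be0 : 0 <= K ^+ 2 - B.
  rewrite leNgt; apply/negP => al; have be : 0 < K ^+ 2 - A by lra.
  have : (K ^+ 2 - A) * (K ^+ 2 - B) < 0 by rewrite pmulr_rlt0.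
  by lra.
have q := quad_form_ge0 al0 be0 ab (nr_ge0 c) (nr_ge0 d).
pose n1 := nr (x * c + h * d); pose n2 := nr (h * c + y * d).
have nE : n1 ^+ 2 + n2 ^+ 2 = A * nr c ^+ 2 + B * nr d ^+ 2 +
    2 * complex.Re (g * c * d^*).
  by rewrite /n1 /n2 /A /B /g !nr_sqr !reimE; ring.
have gre : complex.Re (g * c * d^*) <= nr g * nr c * nr d.
  by apply: le_trans (ler_norm _) _; apply: le_trans (re_le_nr _) _;
    rewrite !nrM nr_conj.
have n12 : n1 ^+ 2 + n2 ^+ 2 <= K ^+ 2 * (nr c ^+ 2 + nr d ^+ 2) by lra.
apply: le_trans (nrD _ _) _; rewrite [X in X + _]nrM [X in _ + X]nrM -/n1 -/n2.
have K2 : 0 < 2 * K by lra.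
rewrite -(ler_pM2l K2).
have e1 := sqr_ge0 (K * nr a - n1); have e2 := sqr_ge0 (K * nr b - n2).
lra.
Qed.

Lemma norm_le_entries K x y h : norm_le K x y h ->
  [/\ nr x <= K, nr y <= K & nr h <= K].
Proof.
move=> H; have h1 := H 1 0 1 0; have h2 := H 0 1 0 1; have h3 := H 1 0 0 1.
move: h1 h2 h3; rewrite !(mul1r, mul0r, mulr1, mulr0, addr0, add0r).
by rewrite nr0 nr1 expr1n expr0n /= => h1 h2 h3; split; lra.
Qed.

(** With h = (z1 + z2) / 2 and x y = h^2 - z1 z2, and |x| = |y|, the singular
values of the matrix are |z1| and |z2|; here |y| = q |x| with q close to 1. *)
Lemma norm_le_roots (k K q : R) z1 z2 x y : 0 < k -> k < K -> 1 / 2 <= q <= 1 ->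
  2 * K ^+ 2 * k ^+ 2 * (1 - q) ^+ 2 <= (K ^+ 2 - k ^+ 2) ^+ 2 ->
  nr z1 <= k -> nr z2 <= k ->
  x * y = ((z1 + z2) / 2) ^+ 2 - z1 * z2 -> nr y = nr x * q ->
  norm_le K x y ((z1 + z2) / 2).
Proof.
move=> k0 kK /andP[q0 q1] qK z1k z2k xy yx.
set h := (z1 + z2) / 2 in xy *.
have K0 : 0 < K by lra.
pose s1 := nr z1 ^+ 2; pose s2 := nr z2 ^+ 2.
have s1k : s1 <= k ^+ 2 by apply: lerXn2r; rewrite ?nnegrE ?nr_ge0 // ltW.
have s2k : s2 <= k ^+ 2 by apply: lerXn2r; rewrite ?nnegrE ?nr_ge0 // ltW.
have s10 : 0 <= s1 by apply: sqr_ge0.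
have s20 : 0 <= s2 by apply: sqr_ge0.
have kK2 : k ^+ 2 < K ^+ 2 by rewrite ltrXn2r ?nnegrE ?ltW // gt_eqF.
pose t := nr (x * y).
have tq : t = q * nr x ^+ 2 by rewrite /t nrM yx; ring.
have t0 : 0 <= t by apply: nr_ge0.
have tE : 2 * nr h ^+ 2 + 2 * t = s1 + s2.
  have -> : t = nr (z1 - z2) ^+ 2 / 4.
    have -> : 4 = nr (4 : C) by rewrite nr_nat.
    by rewrite /t xy -nrX -nr_div; congr nr; rewrite /h; field.
  have -> : nr h ^+ 2 = nr (z1 + z2) ^+ 2 / 4.
    by rewrite /h nr_div nr_nat; field.
  by rewrite /s1 /s2 !nr_sqr !reimE; field.
pose d := t * (1 - q) ^+ 2 / q.
have q00 : 0 < q by lra.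
have xyE : nr x ^+ 2 + nr y ^+ 2 = 2 * t + d.
  by rewrite yx /d tq; field; rewrite gt_eqF.
have tk : t <= k ^+ 2 by have := sqr_ge0 (nr h); lra.
have d0 : 0 <= d by apply: divr_ge0 (ltW q00); rewrite mulr_ge0 ?sqr_ge0.
have dk : d <= 2 * (k ^+ 2 * (1 - q) ^+ 2).
  rewrite /d ler_pdivrMr //.
  have h1 : t * (1 - q) ^+ 2 <= k ^+ 2 * (1 - q) ^+ 2.
    by rewrite ler_wpM2r ?sqr_ge0.
  have h2 : 0 <= k ^+ 2 * (1 - q) ^+ 2 by rewrite mulr_ge0 ?sqr_ge0.
  have : k ^+ 2 * (1 - q) ^+ 2 * 1 <= k ^+ 2 * (1 - q) ^+ 2 * (2 * q).
    by apply: ler_wpM2l => //; lra.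
  by lra.
pose eta := K ^+ 2 - k ^+ 2.
have Kd : K ^+ 2 * d <= eta ^+ 2.
  apply: le_trans qK; apply: le_trans (ler_wpM2l (sqr_ge0 K) dk) _; lra.
have eta0 : 0 < eta by rewrite /eta; lra.
have etaK : eta <= K ^+ 2 by rewrite /eta; have := sqr_ge0 k; lra.
have de : d <= eta.
  have K20 : 0 < K ^+ 2 by rewrite exprn_gt0.
  rewrite -(ler_pM2l K20); apply: le_trans Kd _.
  by rewrite expr2 ler_wpM2r // ltW.
apply: norm_leP => //; rewrite xyE.
  by rewrite /eta in de; lra.
have -> : nr (x * y - h ^+ 2) ^+ 2 = s1 * s2.
  by rewrite xy addrAC subrr sub0r nrN nrM exprMn.
have f1 : 0 <= (k ^+ 2 - s1) by lra.
have f2 : 0 <= (k ^+ 2 - s2) by lra.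
have f3 := mulr_ge0 f1 f2; have f4 := mulr_ge0 f1 (ltW eta0).
have f5 := mulr_ge0 f2 (ltW eta0).
have -> : 2 * t + d + 2 * nr h ^+ 2 = s1 + s2 + d by lra.
by rewrite /eta in f4 f5 Kd *; lra.
Qed.

(** For a root z of the perturbed polynomial, (z - w1) (z - w2) is of the order of
eta^2 (1 + |z|), while it is at least (|z| - 1)^2. *)
Lemma root_perturbation (eta : R) w1 w2 z h p : 0 < eta <= 1 ->
  nr w1 < 1 -> nr w2 < 1 ->
  nr (h - (w1 + w2) / 2) <= eta ^+ 2 -> nr (p - w1 * w2) <= eta ^+ 2 ->
  z ^+ 2 - 2 * h * z + p = 0 -> nr z <= 1 + 3 * eta.
Proof.
move=> /andP[e0 e1] w11 w21 hh pp ze; rewrite leNgt; apply/negP => big.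
pose d := nr z - 1; have d3 : 3 * eta < d by rewrite /d; lra.
have E : (z - w1) * (z - w2) = 2 * (h - (w1 + w2) / 2) * z - (p - w1 * w2).
  have -> : (z - w1) * (z - w2) = z ^+ 2 - 2 * h * z + p +
    (2 * (h - (w1 + w2) / 2) * z - (p - w1 * w2)) by field.
  by rewrite ze add0r.
have l1 : d <= nr (z - w1) by have := nr_le_sub z w1; rewrite /d; lra.
have l2 : d <= nr (z - w2) by have := nr_le_sub z w2; rewrite /d; lra.
have d0 : 0 <= d by lra.
have l3 : d ^+ 2 <= nr ((z - w1) * (z - w2)).
  by rewrite nrM expr2; apply: ler_pM.
have l4 : nr ((z - w1) * (z - w2)) <= 2 * eta ^+ 2 * (1 + d) + eta ^+ 2.
  rewrite E; apply: le_trans (nr_le_add _ _) _; rewrite !nrM nr_nat.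
  apply: lerD => //; rewrite (_ : 1 + d = nr z); last by rewrite /d; ring.
  by apply: ler_wpM2r; [exact: nr_ge0 | apply: ler_wpM2l].
have h1 : 0 <= (1 - eta) * (eta * d).
  by apply: mulr_ge0; [lra | apply: mulr_ge0 => //; exact: ltW].
have h2 : 3 * eta * d <= d ^+ 2 by rewrite expr2 ler_wpM2r // ltW.
have h3 : eta * (3 * eta) < eta * d by rewrite ltr_pM2l.
lra.
Qed.

End Lifting.

Section LiftingTheorem.
Variable R : realType.
Local Notation C := (Cplx R).
Implicit Types (z w c : C) (M K e : R).
Variables (h p : C -> C).
Hypotheses (dh : forall z, nr z < 1 -> differentiable h z)
  (dp : forall z, nr z < 1 -> differentiable p z)
  (hp : forall z, nr z < 1 -> exists w1 w2,
     [/\ nr w1 < 1, nr w2 < 1, h z = (w1 + w2) / 2 & p z = w1 * w2]).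

Lemma nr_h_le z : nr z < 1 -> nr (h z) <= 1.
Proof.
move=> /hp [w1 [w2 [h1 h2 -> _]]]; rewrite nr_div nr_nat.
by have := nrD w1 w2; lra.
Qed.

Lemma nr_p_le z : nr z < 1 -> nr (p z) <= 1.
Proof.
move=> /hp [w1 [w2 [h1 h2 _ ->]]].
by rewrite nrM mulr_ile1 ?nr_ge0 // ltW.
Qed.

(** For a polynomial approximation of the disc, the zeros of the discriminant in the
disc are finitely many and are carried by a Blaschke product, which becomes a
factor of the second diagonal entry; the first one is left without zeros. *)
Lemma lift_approx (rho eta : R) : 0 <= rho < 1 -> 0 < eta <= 1 ->
  exists x y H : C -> C,
  [/\ forall z, nr z < 1 -> differentiable x z /\ differentiable y z,
      forall z, nr z < 1 -> nr (H z - h (rho%:C%C * z)) <= eta ^+ 2,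
      forall z, nr z < 1 -> nr (x z * y z -
        (h (rho%:C%C * z) ^+ 2 - p (rho%:C%C * z))) <= 4 * eta ^+ 2,
      forall z, nr z < 1 -> norm_le (1 + 3 * eta) (x z) (y z) (H z) &
      (exists2 w, nr w < 1 & x w != 0) ->
        exists2 G, tower G & forall z, nr z < 1 -> nr (x z) ^+ 2 = nr (G z)].
Proof.
move=> r01 e01; have [e0 e1] := andP e01; have [r0 r1] := andP r01.
have e20 : 0 < eta ^+ 2 by rewrite exprn_gt0.
have e21 : eta ^+ 2 <= eta by rewrite expr2 ler_piMl // ltW.
have [Hp hHp] := poly_approx dh nr_h_le r01 e20.
have [Pp hPp] := poly_approx dp nr_p_le r01 e20.
pose rX : {poly C} := rho%:C%C *: 'X.
have rXE z : rX.[z] = rho%:C%C * z by rewrite hornerZ hornerX.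
have rz z : nr z < 1 -> nr (rho%:C%C * z) <= rho.
  by move=> z1; rewrite nrM nr_real ger0_norm // ler_piMr // ltW.
have rz1 z : nr z < 1 -> nr (rho%:C%C * z) < 1.
  by move=> /rz h1; apply: le_lt_trans r1.
pose H z := Hp.[rho%:C%C * z]; pose P z := Pp.[rho%:C%C * z].
have HH z : nr z < 1 -> nr (H z - h (rho%:C%C * z)) <= eta ^+ 2.
  by move=> /rz; apply: hHp.
have PP z : nr z < 1 -> nr (P z - p (rho%:C%C * z)) <= eta ^+ 2.
  by move=> /rz; apply: hPp.
have disc z : nr z < 1 ->
    nr (H z ^+ 2 - P z - (h (rho%:C%C * z) ^+ 2 - p (rho%:C%C * z))) <= 4 * eta ^+ 2.
  move=> z1; set u := h _; set v := p _.
  have -> : H z ^+ 2 - P z - (u ^+ 2 - v) =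
    (H z - u) * (H z - u) + (H z - u) * (2 * u) - (P z - v) by ring.
  have h1 := HH z z1; have h2 := PP z z1; have h3 := nr_h_le (rz1 z z1).
  rewrite -/u -/v in h1 h2 h3; have h4 := nr_ge0 (H z - u).
  apply: le_trans (nr_le_add _ _) _; apply: le_trans (lerD (nrD _ _) h2) _.
  rewrite !nrM nr_nat.
  have h5 : nr (H z - u) * nr (H z - u) <= eta ^+ 2 * 1.
    by apply: ler_pM => //; lra.
  have h6 : nr (H z - u) * (2 * nr u) <= eta ^+ 2 * 2.
    by apply: ler_pM => //; [have := nr_ge0 u; lra | lra].
  by lra.
have dH z : nr z < 1 -> differentiable H z.
  move=> z1; exact: diffable_comp (diffableM (diffable_cst _ _) (diffable_id _))
    (diffable_horner Hp _).
pose D : {poly C} := (Hp ^+ 2 - Pp) \Po rX.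
have DE z : D.[z] = H z ^+ 2 - P z.
  by rewrite /D horner_comp rXE /H /P hornerD hornerN horner_exp.
have k0 : 0 < 1 + 3 * eta by lra.
have [D0|D0] := eqVneq D 0.
  have D0z z : H z ^+ 2 - P z = 0 by rewrite -DE D0 horner0.
  exists (fun=> 0), (fun=> 0), H; split.
  - by move=> z _; split; exact: diffable_cst.
  - exact: HH.
  - by move=> z /disc; rewrite D0z mul0r.
  - move=> z z1; have hH : nr (H z) <= 1 + 3 * eta.
      have h1 := HH z z1; have h3 := nr_h_le (rz1 z z1).
      by have := nrD (H z - h (rho%:C%C * z)) (h (rho%:C%C * z)); rewrite subrK; lra.
    have hH2 : nr (H z) ^+ 2 <= (1 + 3 * eta) ^+ 2.
      by apply: lerXn2r; rewrite ?nnegrE ?nr_ge0 // ltW.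
    apply: norm_leP => //; rewrite nr0 expr0n /= !add0r; first lra.
    rewrite mul0r sub0r nrN nrX.
    by have := sqr_ge0 ((1 + 3 * eta) ^+ 2 - nr (H z) ^+ 2); lra.
  - by case=> w _; rewrite eqxx.
have [G [B [tG dB B1 Bc DGB]]] := poly_inner_outer D0.
have [x [dx xG]] := tG 1%N.
exists x, (fun z => x z * B z), H.
have xyE z : nr z < 1 -> x z * (x z * B z) = H z ^+ 2 - P z.
  by move=> z1; rewrite mulrA -expr2 xG // -DGB // DE.
split.
- by move=> z z1; split; [exact: dx | exact: diffableM (dx z z1) (dB z z1)].
- exact: HH.
- by move=> z z1; rewrite xyE //; apply: disc.
- move=> w w1 a b c d; set N := (_ + nr d ^+ 2); set k := 1 + 3 * eta in k0 *.
  have N0 : 0 <= N by rewrite /N !addr_ge0 ?sqr_ge0.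
  apply: (@max_principle _
    (fun z => a * (x z * c + H z * d) + b * (H z * c + x z * B z * d)));
    last exact: w1.
    move=> z z1; have dcst u := @diffable_cst R u z.
    apply: diffableD; apply: diffableM (dcst _) _; apply: diffableD;
      apply: diffableM _ (dcst _).
    + exact: dx.
    + exact: dH.
    + exact: dH.
    + exact: diffableM (dx z z1) (dB z z1).
  (* The tolerance e is spent on replacing k by K > k, which leaves room for
     |B| to be slightly smaller than 1 near the circle. *)
  move=> e ep; pose e' := 2 * e / (N + 1).
  have N1 : 0 < N + 1 by lra.
  have e'0 : 0 < e' by apply: divr_gt0 => //; lra.
  pose K := k + e'; have kK : k < K by rewrite /K; lra.
  have K0 : 0 < K by lra.
  pose t := K ^+ 2 - k ^+ 2.
  have t0 : 0 < t by rewrite /t subr_gt0 ltrXn2r ?nnegrE ?ltW // gt_eqF.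
  have KK : 0 < 2 * K * k by rewrite !mulr_gt0.
  have ee : 0 < Num.min (1 / 2) (t / (2 * K * k)) by rewrite lt_min !divr_gt0.
  have [r rl1 hr] := Bc _ ee; exists r => // z /[dup] rz' /hr hq.
  have z1 : nr z < 1 by case/andP: rz'.
  set q := nr (B z) in hq; have q1 : q <= 1 by apply: B1.
  have hq1 : 1 - q <= 1 / 2.
    have : Num.min (1 / 2) (t / (2 * K * k)) <= 1 / 2 by rewrite ge_min lexx.
    by move=> m; have := le_trans (lerB (lexx 1) m) hq; lra.
  have hq2 : (1 - q) * (2 * K * k) <= t.
    rewrite -ler_pdivlMr //.
    have : Num.min (1 / 2) (t / (2 * K * k)) <= t / (2 * K * k).
      by rewrite ge_min lexx orbT.
    by move=> m; have := le_trans (lerB (lexx 1) m) hq; lra.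
  pose s : C := sqrtc (H z ^+ 2 - P z).
  have sE : s ^+ 2 = H z ^+ 2 - P z by apply: sqrtc_sqr.
  have [w3 [w4 [w31 w41 hE pE]]] := hp (rz1 z z1).
  have pert u : u ^+ 2 - 2 * H z * u + P z = 0 -> nr u <= k.
    apply: (@root_perturbation _ eta w3 w4) => //.
      by rewrite -hE; apply: HH.
    by rewrite -pE; apply: PP.
  have HE : H z = ((H z + s) + (H z - s)) / 2 by field.
  have key : norm_le K (x z) (x z * B z) (((H z + s) + (H z - s)) / 2).
    apply: (@norm_le_roots _ k K q).
    + exact: k0.
    + exact: kK.
    + by rewrite q1 andbT; lra.
    + rewrite -/t; have q0 : 0 <= (1 - q) * (2 * K * k).
        by apply: mulr_ge0; [lra | exact: ltW].
      have : ((1 - q) * (2 * K * k)) ^+ 2 <= t ^+ 2.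
        by apply: lerXn2r; rewrite ?nnegrE // ltW.
      have : 0 <= K ^+ 2 * k ^+ 2 * (1 - q) ^+ 2.
        exact: mulr_ge0 (mulr_ge0 (sqr_ge0 _) (sqr_ge0 _)) (sqr_ge0 _).
      by lra.
    + apply: pert; have -> : (H z + s) ^+ 2 - 2 * H z * (H z + s) + P z =
         s ^+ 2 - (H z ^+ 2 - P z) by ring.
      by rewrite sE subrr.
    + apply: pert; have -> : (H z - s) ^+ 2 - 2 * H z * (H z - s) + P z =
         s ^+ 2 - (H z ^+ 2 - P z) by ring.
      by rewrite sE subrr.
    + rewrite xyE // -HE -sE; ring.
    + by rewrite nrM.
  rewrite -HE in key; apply: le_trans (key a b c d) _.
  rewrite -/N /K.
  have : e' / 2 * N <= e.
    rewrite /e'; have -> : 2 * e / (N + 1) / 2 * N = e * (N / (N + 1)).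
      by field; rewrite gt_eqF.
    rewrite ler_piMr ?ltW // ltr_pdivrMr //; lra.
  by lra.
move=> _; exists G => // z z1; by rewrite -xG // nrX.
Qed.

(** The discs of the previous lemma have limits along an ultrafilter.  The first
entry of the limit is zero-free because the discriminant at w bounds the entries
x_n away from 0 at w, hence at every other point, by [tower_lower_bound]. *)
Theorem lifting : exists x y : C -> C,
  [/\ forall z, nr z < 1 -> differentiable x z /\ differentiable y z,
      forall z, nr z < 1 -> x z * y z = h z ^+ 2 - p z,
      forall z, nr z < 1 -> norm_le 1 (x z) (y z) (h z) &
      (exists2 w, nr w < 1 & h w ^+ 2 != p w) ->
        forall z, nr z < 1 -> x z != 0].
Proof.
pose eta (n : nat) : R := n.+1%:R^-1; pose rho (n : nat) : R := 1 - n.+1%:R^-1.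
have n0 (n : nat) : 0 < n.+1%:R :> R by rewrite ltr0n.
have eta01 n : 0 < eta n <= 1 by rewrite invr_gt0 n0 invf_le1 // ler1n.
have rho01 n : 0 <= rho n < 1.
  have /andP[h1 h2] := eta01 n; rewrite /rho -/(eta n); lra.
have /choice [x /choice [y /choice [H hn]]] := fun n => lift_approx (rho01 n) (eta01 n).
have [U [UU UF]] := ultraFilterLemma (eventually_filter).
have uD a b (u v : C) := @ulimD R U UU a b u v.
have uB a b (u v : C) := @ulimB R U UU a b u v.
have uM a b (u v : C) := @ulimM R U UU a b u v.
have small e : 0 < e -> U [set n | eta n <= e].
  move=> e0; apply: UF; exists (Num.truncn e^-1) => // n /= hn'.
  rewrite /eta -(invrK e) lef_pV2 ?posrE ?invr_gt0 //.
  apply: ltW; apply: lt_le_trans (truncnS_gt _) _.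
  by rewrite ler_nat ltnS.
have small2 e : 0 < e -> U [set n | eta n ^+ 2 <= e].
  move=> e0; apply: filterS (small e e0) => n /= h1; apply: le_trans h1.
  by have /andP[h2 h3] := eta01 n; rewrite expr2 ler_piMl // ltW.
have bnd n z : nr z < 1 -> nr (x n z) <= 4 /\ nr (y n z) <= 4.
  move=> z1; have [_ _ _ nl _] := hn n; have [h1 h2 _] := norm_le_entries (nl z z1).
  by have /andP[h3 h4] := eta01 n; lra.
have bx n z : nr z < 1 -> nr (x n z) <= 4 by move=> z1; case: (bnd n z z1).
have bdy n z : nr z < 1 -> nr (y n z) <= 4 by move=> z1; case: (bnd n z z1).
have dx n z : nr z < 1 -> differentiable (x n) z.
  by move=> z1; have [d _ _ _ _] := hn n; case: (d z z1).
have dy n z : nr z < 1 -> differentiable (y n) z.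
  by move=> z1; have [d _ _ _ _] := hn n; case: (d z z1).
have [X [dX limX]] := montel (U := U) dx bx.
have [Y [dY limY]] := montel (U := U) dy bdy.
have cvg_rho (f : C -> C) z : nr z < 1 -> differentiable f z ->
    (fun n => f ((rho n)%:C%C * z)) @ U --> f z.
  move=> z1 /differentiable_cont cf; apply/cvg_nrP => e e0.
  have [d d0 hd] := cf e e0; apply: filterS (small (d / 2) _); last lra.
  move=> n /= en; apply: hd.
  have -> : (rho n)%:C%C * z - z = - ((eta n)%:C%C * z).
    by rewrite /rho -/(eta n) rmorphB rmorph1; ring.
  rewrite nrN nrM nr_real; have /andP[h1 h2] := eta01 n.
  rewrite gtr0_norm //; have := nr_ge0 z; nra.
have limH z : nr z < 1 -> (fun n => H n z) @ U --> h z.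
  move=> z1; apply/cvg_nrP => e e0; have e2 : 0 < e / 2 by lra.
  have /cvg_nrP/(_ _ e2) c1 := cvg_rho h z z1 (dh z1).
  apply: filterS2 c1 (small2 _ e2) => n /= h1 h2.
  have [_ hh _ _ _] := hn n; have := hh z z1.
  have := nrD (H n z - h ((rho n)%:C%C * z)) (h ((rho n)%:C%C * z) - h z).
  by rewrite addrA subrK; lra.
have XY z : nr z < 1 -> X z * Y z = h z ^+ 2 - p z.
  move=> z1; apply/eqP; rewrite -subr_eq0 -nr_eq0 eq_le nr_ge0 andbT.
  have ch := cvg_rho h z z1 (dh z1); have cp := cvg_rho p z z1 (dp z1).
  have l1 := uB _ _ _ _ (uM _ _ _ _ (limX z z1) (limY z z1)) (uB _ _ _ _ (uM _ _ _ _ ch ch) cp).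
  rewrite expr2; apply: (ultra_limit_le l1) => e e0.
  have e4 : 0 < e / 4 by lra.
  apply: filterS (small2 _ e4) => n /= h1; have [_ _ hh _ _] := hn n.
  by have := hh z z1; rewrite expr2; lra.
exists X, Y; split=> //.
- by move=> z z1; split; [exact: dX | exact: dY].
- move=> z z1 a b c d; set N := (_ + nr d ^+ 2).
  have N0 : 0 <= N by rewrite /N !addr_ge0 ?sqr_ge0.
  have cst (u : C) : (fun _ : nat => u) @ U --> u by apply: ulim_cst.
  have l := uD _ _ _ _ (uM _ _ _ _ (cst a) (uD _ _ _ _ (uM _ _ _ _ (limX z z1) (cst c)) (uM _ _ _ _ (limH z z1) (cst d))))
    (uM _ _ _ _ (cst b) (uD _ _ _ _ (uM _ _ _ _ (limH z z1) (cst c)) (uM _ _ _ _ (limY z z1) (cst d)))).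
  apply: (ultra_limit_le l) => e e0.
  have e4 : 0 < e / (2 * (N + 1)) by apply: divr_gt0 => //; lra.
  apply: filterS (small _ e4) => n /=.
  rewrite ler_pdivlMr; last lra.
  move=> h1; have [_ _ _ nl _] := hn n; apply: le_trans (nl z z1 a b c d) _.
  have /andP[h2 h3] := eta01 n; rewrite -/N; lra.
case=> w w1 hw z z1; apply/negP => /eqP X0.
pose c : C := h w ^+ 2 - p w; have c0 : 0 < nr c by rewrite nr_gt0 subr_eq0.
(* Since |x_n| <= 4 and |y_n| <= 4, the function |x_n|^2 / 16 is at most 1, and it
   is at least (|c| / 8)^2 / 16 = (|c| / 32)^2 at w. *)
pose b : C := (nr c / 32)%:C%C; have bE : nr b = nr c / 32.
  by rewrite nr_real gtr0_norm // divr_gt0.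
have b0 : b ^+ 2 != 0.
  by rewrite expf_neq0 // -nr_gt0 bE divr_gt0.
have [d d0 hd] := tower_lower_bound w1 z1 b0.
have lim0 := limX z z1; rewrite X0 in lim0.
have /cvg_nrP H1 := lim0.
have /cvg_nrP H2 := uM _ _ _ _ (limX w w1) (limY w w1).
have s0 : 0 < Num.min d 1 / 2 by apply: divr_gt0; rewrite // lt_min d0 ltr01.
have c2 : 0 < nr c / 2 by lra.
have /filter_ex [n /= [g1 g2]] : U ([set n | nr (x n z - 0) <= Num.min d 1 / 2] `&`
    [set n | nr (x n w * y n w - X w * Y w) <= nr c / 2]).
  by apply: filterI; [exact: H1 | exact: H2].
have [_ _ _ _ tw] := hn n.
have xy : nr c / 2 <= nr (x n w) * 4.
  have := nrD (X w * Y w - x n w * y n w) (x n w * y n w).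
  rewrite subrK (nrB (X w * Y w)) XY // -/c nrM.
  have [_ y4] := bnd n w w1.
  have : nr (x n w) * nr (y n w) <= nr (x n w) * 4 by rewrite ler_wpM2l ?nr_ge0.
  by rewrite XY // in g2; lra.
have [G tG GE] : exists2 G, tower G & forall z, nr z < 1 -> nr (x n z) ^+ 2 = nr (G z).
  by apply: tw; exists w => //; rewrite -nr_gt0; lra.
have t16 : tower (fun y => (1 / 16 : C) * G y) by apply: tower_mul => //; apply: tower_cst.
have n16 : nr (1 / 16 : C) = 1 / 16 by rewrite nr_div nr1 nr_nat.
have hG t : nr t < 1 -> nr ((1 / 16 : C) * G t) = 1 / 16 * nr (x n t) ^+ 2.
  by move=> t1; rewrite nrM n16 GE.
have := hd _ t16; rewrite nrX bE (hG w w1) (hG z z1) => hd'.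
have : d <= 1 / 16 * nr (x n z) ^+ 2.
  apply: hd'.
    move=> t t1; rewrite hG //; have [x4 _] := bnd n t t1.
    by have := nr_ge0 (x n t); nra.
  nra.
move: g1; rewrite subr0; have := nr_ge0 (x n z).
have m1 : Num.min d 1 <= d by rewrite ge_min lexx.
have m2 : Num.min d 1 <= 1 by rewrite ge_min lexx orbT.
nra.
Qed.

End LiftingTheorem.

(** * Positive definite matrices and their square roots *)

Section Positive.
Variable R : realType.
Local Notation C := (Cplx R).

Definition vn n (v : 'cV[C]_n) : R := \sum_i nr (v i 0) ^+ 2.

Lemma vn_ge0 n (v : 'cV[C]_n) : 0 <= vn v.
Proof. by apply: sumr_ge0 => i _; apply: sqr_ge0. Qed.

Lemma vn_eq0 n (v : 'cV[C]_n) : (vn v == 0) = (v == 0).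
Proof.
rewrite /vn psumr_eq0; last by move=> i _; apply: sqr_ge0.
apply/allP/eqP => [h|-> i _]; last by rewrite mxE nr0 expr0n eqxx.
apply/matrixP => i j; rewrite ord1 mxE; apply/eqP.
by have := h i (mem_index_enum i); rewrite sqrf_eq0 nr_eq0.
Qed.

Lemma vn_gt0 n (v : 'cV[C]_n) : (0 < vn v) = (v != 0).
Proof. by rewrite lt_neqAle vn_ge0 andbT eq_sym vn_eq0. Qed.

Lemma vn0 n : vn (0 : 'cV[C]_n) = 0.
Proof. by apply/eqP; rewrite vn_eq0. Qed.

Lemma vnN n (v : 'cV[C]_n) : vn (- v) = vn v.
Proof. by apply: eq_bigr => i _; rewrite mxE nrN. Qed.

Lemma vnZ n c (v : 'cV[C]_n) : vn (c *: v) = nr c ^+ 2 * vn v.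
Proof. by rewrite mulr_sumr; apply: eq_bigr => i _; rewrite mxE nrM exprMn. Qed.

Lemma vn_form n (v : 'cV[C]_n) : (v^t* *m v) 0 0 = (vn v)%:C%C.
Proof.
rewrite mxE rmorph_sum /=; apply: eq_bigr => i _.
by rewrite !mxE sqr_nrC mulrC.
Qed.

Lemma adjM m n p (A : 'M[C]_(m, n)) (B : 'M[C]_(n, p)) :
  (A *m B)^t* = B^t* *m A^t*.
Proof. by rewrite trmx_mul map_mxM. Qed.

Lemma adjK m n (A : 'M[C]_(m, n)) : (A^t*)^t* = A.
Proof. by apply/matrixP => i j; rewrite !mxE conjCK. Qed.

Lemma adjB m n (A B : 'M[C]_(m, n)) : (A - B)^t* = A^t* - B^t*.
Proof. by apply/matrixP => i j; rewrite !mxE rmorphB. Qed.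

Lemma adj1 n : (1%:M : 'M[C]_n)^t* = 1%:M.
Proof. by apply/matrixP => i j; rewrite !mxE eq_sym rmorph_nat. Qed.

Lemma posdef_ge0 n (A : 'M[C]_n) (v : 'cV[C]_n) :
  posdef A -> 0 <= (v^t* *m A *m v) 0 0.
Proof.
move=> pA; have [->|v0] := eqVneq v 0; last exact/ltW/pA.
by rewrite mulmx0 mxE.
Qed.

Lemma mx_inj_unit n (A : 'M[C]_n) :
  (forall v : 'cV[C]_n, A *m v = 0 -> v = 0) -> A \in unitmx.
Proof.
move=> h; rewrite -unitmx_tr -row_free_unit -kermx_eq0.
apply/eqP/row_matrixP => i; rewrite row0; apply: trmx_inj.
rewrite trmx0; apply: h; apply: trmx_inj; rewrite trmx_mul trmxK trmx0.
by rewrite -row_mul mulmx_ker row0.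
Qed.

Lemma posdef_unit n (A : 'M[C]_n) : posdef A -> A \in unitmx.
Proof.
move=> pA; apply: mx_inj_unit => v Av; apply/eqP; apply: contraT => v0.
by have := pA v v0; rewrite -mulmxA Av mulmx0 mxE ltxx.
Qed.

Lemma trace_form n (S Y : 'M[C]_n) :
  \tr (Y^t* *m S *m Y) = \sum_j ((col j Y)^t* *m S *m col j Y) 0 0.
Proof.
apply: eq_bigr => j _; rewrite -[in RHS]mulmxA -[in LHS]mulmxA !mxE.
apply: eq_bigr => k _; rewrite !mxE; congr (_ * _).
by apply: eq_bigr => l _; rewrite !mxE.
Qed.

(** Uniqueness of the solution of a Sylvester equation: both traces below are
nonnegative and they add up to zero.  It yields the uniqueness of positive
square roots and their intertwining relations in the same way. *)
Lemma sylvester_posdef n (S T Y : 'M[C]_n) : posdef S -> posdef T ->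
  S *m Y + Y *m T = 0 -> Y = 0.
Proof.
move=> pS pT h; apply/eqP; apply: contraT => Y0.
have [j Yj] : exists j, col j Y != 0.
  apply/existsP; apply: contraR Y0 => /existsPn H; apply/eqP/matrixP => i j.
  have := H j; rewrite negbK => /eqP/matrixP/(_ i 0); by rewrite !mxE.
have e : \tr (Y^t* *m S *m Y) + \tr ((Y^t*)^t* *m T *m Y^t*) = 0.
  rewrite adjK [X in _ + X]mxtrace_mulC -mxtraceD -mulmxA mulmxA -mulmxA.
  by rewrite -mulmxDr h mulmx0 mxtrace0.
have : 0 < \tr (Y^t* *m S *m Y).
  rewrite trace_form (bigD1 j) //= ltr_pwDl //; first exact: pS.
  by apply: sumr_ge0 => i _; apply: posdef_ge0.
have : 0 <= \tr ((Y^t*)^t* *m T *m Y^t*).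
  by rewrite trace_form; apply: sumr_ge0 => i _; apply: posdef_ge0.
by move=> h1 h2; have := ltr_wpDr h1 h2; rewrite e ltxx.
Qed.

Lemma posdef_sqrt_unique n (S T : 'M[C]_n) : posdef S -> posdef T ->
  S *m S = T *m T -> S = T.
Proof.
move=> pS pT h; apply/eqP; rewrite -subr_eq0; apply/eqP.
apply: (sylvester_posdef pS pT).
by rewrite mulmxBr mulmxBl h addrA subrK subrr.
Qed.

Lemma posdef_adj n (S : 'M[C]_n) : posdef S -> posdef (S^t*).
Proof.
move=> pS v /pS h; have -> : v^t* *m S^t* *m v = (v^t* *m S *m v)^t*.
  by rewrite !adjM adjK mulmxA.
by rewrite [_ 0 0]mxE [_ 0 0]mxE conj_Creal // gtr0_real.
Qed.

Lemma posdef_tr n (S : 'M[C]_n) : posdef S -> posdef (S^T).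
Proof.
move=> pS v v0; pose w : 'cV[C]_n := map_mx Num.conj v.
have w0 : w != 0.
  apply: contraNneq v0 => w0; apply/eqP/matrixP => i j.
  have := congr1 (fun M : 'cV[C]_n => M i j) w0; rewrite !mxE.
  by move=> /eqP; rewrite conjC_eq0 => /eqP.
have := pS w w0; have -> // : (w^t* *m S *m w) 0 0 = (v^t* *m S^T *m v) 0 0.
have <- : (w^t* *m S *m w)^T = v^t* *m S^T *m v.
  rewrite !trmx_mul mulmxA; congr (_ *m _ *m _).
    by apply/matrixP => i j; rewrite !mxE.
  by apply/matrixP => i j; rewrite !mxE conjCK.
by rewrite [RHS]mxE.
Qed.

Lemma hermitian_normal n (A : 'M[C]_n) : A^t* = A -> A \is normalmx.
Proof. by move=> h; apply/normalmxP; rewrite h. Qed.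

End Positive.

(** * The Cartan domain and its automorphisms *)

Section Cartan.
Variable R : realType.
Local Notation C := (Cplx R).
Implicit Types (a x y : 'M[C]_2).

Definition contr x := forall v : 'cV[C]_2, vn (x *m v) <= vn v.
Definition scontr x := forall v : 'cV[C]_2, v != 0 -> vn (x *m v) < vn v.

Lemma scontrW x : scontr x -> contr x.
Proof.
move=> h v; have [->|/h/ltW//] := eqVneq v 0.
by rewrite mulmx0.
Qed.

Lemma vn_conj n (v : 'cV[C]_n) : vn (map_mx Num.conj v) = vn v.
Proof. by apply: eq_bigr => i _; rewrite mxE nr_conj. Qed.

Lemma sym_adj x : x^T = x -> x^t* = map_mx Num.conj x.
Proof. by move=> ->. Qed.

Lemma map_conjK m n (v : 'M[C]_(m, n)) : map_mx Num.conj (map_mx Num.conj v) = v.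
Proof. by apply/matrixP => i j; rewrite !mxE conjCK. Qed.

Lemma map_conj_eq0 m n (v : 'M[C]_(m, n)) : (map_mx Num.conj v == 0) = (v == 0).
Proof.
apply/eqP/eqP => [h|->]; last by rewrite map_mx0.
by rewrite -[v]map_conjK h map_mx0.
Qed.

Lemma vn_adj_mul x (v : 'cV[C]_2) : x^T = x ->
  vn (x^t* *m v) = vn (x *m map_mx Num.conj v).
Proof.
move=> /sym_adj ->; rewrite -[in RHS]vn_conj map_mxM map_conjK //.
Qed.

Lemma scontr_adj x : x^T = x -> scontr x -> scontr (x^t*).
Proof.
by move=> xs h v v0; rewrite vn_adj_mul // -[vn v]vn_conj h // map_conj_eq0.
Qed.

Lemma defect_form x (v : 'cV[C]_2) :
  (v^t* *m (1%:M - x *m x^t*) *m v) 0 0 = (vn v - vn (x^t* *m v))%:C%C.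
Proof.
rewrite mulmxBr mulmx1 mulmxBl rmorphB /= -!vn_form adjM adjK.
by rewrite [LHS]mxE [X in _ + X]mxE !mulmxA.
Qed.

Lemma posdef_defect x : scontr (x^t*) -> posdef (1%:M - x *m x^t*).
Proof. by move=> h v v0; rewrite defect_form ltcR subr_gt0 h. Qed.

Lemma cartan_IIP x : cartan_II x <-> x^T = x /\ scontr x.
Proof.
split=> [[xs px]|[xs cx]]; split=> //; last exact/posdef_defect/scontr_adj.
move=> v v0; have w0 : map_mx Num.conj v != 0 by rewrite map_conj_eq0.
have := px _ w0; rewrite defect_form ltcR subr_gt0 vn_conj.
by rewrite vn_adj_mul // map_conjK.
Qed.

Lemma real_sub_inj (x1 x2 x3 x4 : R) :
  x1%:C%C - x2%:C%C = x3%:C%C - x4%:C%C :> C -> x1 - x2 = x3 - x4.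
Proof. by rewrite -!rmorphB => /complexI. Qed.

(** The polynomial identity behind the isometry property of Phi_a: b, P and Q stand
for the adjoint of a and for the inverses of 1 - b a and 1 - a b, while w' and q'
stand for the adjoints of w and q. *)
Lemma isometry_core (a b P Q : 'M[C]_2) (w' q' : 'rV[C]_2) (w q : 'cV[C]_2) :
  Q *m a = a *m P -> P *m b = b *m Q ->
  (1%:M - b *m a) *m P = 1%:M -> (1%:M - a *m b) *m Q = 1%:M ->
  ((w' - q' *m a) *m P *m (w - b *m q)) 0 0 -
  ((q' - w' *m b) *m Q *m (q - a *m w)) 0 0 = (w' *m w) 0 0 - (q' *m q) 0 0.
Proof.
move=> Qa Pb Pu Qu.
have E1 : P - b *m Q *m a = 1%:M by rewrite -mulmxA Qa mulmxA -{1}[P]mul1mx -mulmxBl.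
have E2 : Q - a *m P *m b = 1%:M by rewrite -mulmxA Pb mulmxA -{1}[Q]mul1mx -mulmxBl.
have -> : w' *m w = w' *m (P - b *m Q *m a) *m w by rewrite E1 mulmx1.
have -> : q' *m q = q' *m (Q - a *m P *m b) *m q by rewrite E2 mulmx1.
have e1 : w' *m P *m (b *m q) = w' *m b *m Q *m q.
  by rewrite mulmxA -(mulmxA w') Pb !mulmxA.
have e2 : q' *m Q *m (a *m w) = q' *m a *m P *m w.
  by rewrite mulmxA -(mulmxA q') Qa !mulmxA.
rewrite !(mulmxBl, mulmxBr) e1 e2 !mulmxA; apply/eqP; rewrite -subr_eq0; apply/eqP.
move: (w' *m P *m w) (w' *m b *m Q *m q) (q' *m a *m P *m w) => x1 x2 x3.
move: (q' *m a *m P *m b *m q) (q' *m Q *m q) (w' *m b *m Q *m a *m w) => x4 x5 x6.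
by rewrite !mxE; ring.
Qed.

(** With b in the role of the adjoint of a and W for the inverse of 1 - x b, both
sides of the identity that expresses the symmetry of Phi_a x are equal to
(1 - a b) W x (1 - b a) - (1 - a b) a. *)
Lemma Phi_sym_core (a b x S T : 'M[C]_2) : S \in unitmx -> T \in unitmx ->
  S^T = T -> T^T = S -> a^T = a -> b^T = b -> x^T = x ->
  1%:M - b *m x \in unitmx -> S *m S = 1%:M - a *m b -> T *m T = 1%:M - b *m a ->
  (invmx S *m (x - a) *m invmx (1%:M - b *m x) *m T)^T =
  invmx S *m (x - a) *m invmx (1%:M - b *m x) *m T.
Proof.
move=> Su Tu ST TS as_ bs xs Du SS TT.
have DT : (1%:M - b *m x)^T = 1%:M - x *m b.
  by rewrite linearB /= trmx1 trmx_mul bs xs.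
have Eu : 1%:M - x *m b \in unitmx by rewrite -DT unitmx_tr.
rewrite !trmx_mul !trmx_inv ST TS DT linearB /= xs as_.
have [D DE] : exists D, D = 1%:M - b *m x by exact: (ex_intro _ _ erefl).
have [E EE] : exists E, E = 1%:M - x *m b by exact: (ex_intro _ _ erefl).
rewrite -DE -EE in Du Eu *.
have xD : E *m x = x *m D by rewrite EE DE mulmxBl mulmxBr (mul1mx x) (mulmx1 x) mulmxA.
have WE : invmx E *m (1%:M - x *m b) = 1%:M by rewrite -EE mulVmx.
have VE : (1%:M - b *m x) *m invmx D = 1%:M by rewrite -DE mulmxV.
have xV : x *m invmx D = invmx E *m x.
  by rewrite -[LHS](mulKmx Eu) (mulmxA E) xD (mulmxK Du).
move: (invmx D) (invmx E) xV WE VE => V W xV WE VE.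
have {}WE : W = 1%:M + W *m x *m b.
  by rewrite -WE mulmxBr (mulmx1 W) mulmxA subrK.
have {}VE : V = 1%:M + b *m (W *m x).
  by rewrite -VE -xV mulmxBl (mul1mx V) mulmxA subrK.
have l : W *m (x - a) = W *m x *m (1%:M - b *m a) - a.
  rewrite mulmxBr {2}WE mulmxDl (mul1mx a) mulmxBr (mulmx1 (W *m x)).
  by rewrite opprD addrA addrAC !mulmxA.
have r : (x - a) *m V = (1%:M - a *m b) *m (W *m x) - a.
  rewrite mulmxBl xV VE mulmxDr (mulmx1 a) mulmxBl (mul1mx (W *m x)).
  by rewrite opprD addrA addrAC !mulmxA.
have key : S *m S *m (W *m (x - a)) = (x - a) *m V *m (T *m T).
  rewrite l r -SS -TT mulmxBr mulmxBl !mulmxA; congr (_ - _).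
  by rewrite SS -!mulmxA TT mulmxBl mulmxBr (mul1mx a) (mulmx1 a) mulmxA.
apply: (can_inj (mulKmx Su)); apply: (can_inj (mulmxK Tu)).
rewrite -!mulmxA (mulVmx Tu) (mulmx1 (x - a)) (mulKVmx Su).
by rewrite (mulmxA S S) key !mulmxA.
Qed.

(** Every property of Phi_a follows from these algebraic relations between its two
square roots, so that their spectral definition is not met again. *)
Record defect_roots a (S T : 'M[C]_2) : Prop := DefectRoots {
  dr_S : S \in unitmx;
  dr_T : T \in unitmx;
  dr_ST : S^T = T;
  dr_Sadj : S^t* = S;
  dr_SS : S *m S = 1%:M - a *m a^t*;
  dr_TT : T *m T = 1%:M - a^t* *m a;
  dr_Sa : S *m a = a *m T;
  dr_Ta : T *m a^t* = a^t* *m S;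
  dr_Phi : forall x, cartan_Phi a x =
    invmx S *m (x - a) *m invmx (1%:M - a^t* *m x) *m T;
  dr_PhiN : forall x, cartan_Phi (- a) x =
    invmx S *m (x + a) *m invmx (1%:M + a^t* *m x) *m T }.

Lemma adjN m n (A : 'M[C]_(m, n)) : (- A)^t* = - A^t*.
Proof. by apply/matrixP => i j; rewrite !mxE rmorphN. Qed.

(** Each relation is an instance of uniqueness: S^T and T are positive square roots
of the same matrix, and S a - a T solves a homogeneous Sylvester equation. *)
Lemma defect_rootsP a : a^T = a -> scontr a -> exists S T, defect_roots a S T.
Proof.
move=> as_ ca.
have [A AE] : exists A, A = 1%:M - a *m a^t* by exists (1%:M - a *m a^t*).
have [B BE] : exists B, B = 1%:M - a^t* *m a by exists (1%:M - a^t* *m a).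
have pA : posdef A by rewrite AE; apply/posdef_defect/scontr_adj.
have pB : posdef B.
  by have := @posdef_defect (a^t*); rewrite adjK BE; apply.
have Ah : A^t* = A by rewrite AE adjB adj1 adjM adjK.
have Bh : B^t* = B by rewrite BE adjB adj1 adjM adjK.
have as2 : (a^t*)^T = a^t* by rewrite map_trmx trmxK as_.
have AB : A^T = B.
  rewrite AE BE linearB /= trmx1 trmx_mul as2; congr (_ - _ *m _); exact: as_.
have [S SE] : exists S, S = sqrtmx A by exact: (ex_intro _ _ erefl).
have [T TE] : exists T, T = sqrtmx B by exact: (ex_intro _ _ erefl).
have pS : posdef S by rewrite SE; exact: sqrtmx_posdef (hermitian_normal Ah) pA.
have pT : posdef T by rewrite TE; exact: sqrtmx_posdef (hermitian_normal Bh) pB.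
have SS : S *m S = A by rewrite SE; exact: sqrtmxK (hermitian_normal Ah).
have TT : T *m T = B by rewrite TE; exact: sqrtmxK (hermitian_normal Bh).
have Sh : S^t* = S.
  by apply: posdef_sqrt_unique (posdef_adj pS) pS _; rewrite -adjM SS Ah.
have ST : S^T = T.
  by apply: posdef_sqrt_unique (posdef_tr pS) pT _; rewrite -trmx_mul SS AB.
have Th : T^t* = T.
  by apply: posdef_sqrt_unique (posdef_adj pT) pT _; rewrite -adjM TT Bh.
have Sa : S *m a = a *m T.
  apply/eqP; rewrite -subr_eq0; apply/eqP; apply: (sylvester_posdef pS pT).
  rewrite mulmxBr mulmxBl !mulmxA SS -!mulmxA TT addrA subrK.
  by rewrite AE BE mulmxBl mul1mx mulmxBr mulmx1 mulmxA subrr.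
have Ta : T *m a^t* = a^t* *m S by rewrite -[T in LHS]Th -adjM -Sa adjM Sh.
exists S, T; constructor.
- exact: posdef_unit.
- exact: posdef_unit.
- exact: ST.
- exact: Sh.
- by rewrite SS.
- by rewrite TT.
- exact: Sa.
- exact: Ta.
- by move=> x; rewrite SE TE AE BE.
- move=> x; rewrite SE TE AE BE /cartan_Phi adjN.
  by rewrite !mulmxN !mulNmx !opprK.
Qed.

Section WithRoots.
Variables (a S T : 'M[C]_2).
Hypotheses (as_ : a^T = a) (ca : scontr a) (dr : defect_roots a S T).

Lemma defect_den_unit x : contr x -> 1%:M - a^t* *m x \in unitmx.
Proof.
move=> cx; apply: mx_inj_unit => v.
rewrite mulmxBl mul1mx => /eqP; rewrite subr_eq0 => /eqP vE.
apply/eqP; rewrite -vn_eq0; apply: contraT => v0.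
have xv : x *m v != 0.
  by apply: contraNneq v0 => xv; rewrite vE -mulmxA xv mulmx0 vn0.
have := scontr_adj as_ ca xv; rewrite mulmxA -vE => h.
by have := lt_le_trans h (cx v); rewrite ltxx.
Qed.

Local Notation Si := (invmx S).
Local Notation Ti := (invmx T).

Lemma Phi_apply x (w : 'cV[C]_2) : contr x ->
  cartan_Phi a x *m (Ti *m (w - a^t* *m (x *m w))) = Si *m (x *m w - a *m w).
Proof.
move=> cx; have := defect_den_unit cx => Du; rewrite (dr_Phi dr).
have -> : w - a^t* *m (x *m w) = (1%:M - a^t* *m x) *m w.
  by rewrite mulmxBl mul1mx mulmxA.
rewrite !mulmxA (mulmxK (dr_T dr)) (mulmxKV Du).
by rewrite -!mulmxA mulmxBl.
Qed.

Lemma isometry_form (w q : 'cV[C]_2) :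
  ((w - a^t* *m q)^t* *m Ti^t* *m (Ti *m (w - a^t* *m q))) 0 0 -
  ((q - a *m w)^t* *m Si^t* *m (Si *m (q - a *m w))) 0 0 =
  (w^t* *m w) 0 0 - (q^t* *m q) 0 0.
Proof.
have [Su Tu ST Sh SS TT Sa Ta _ _] := dr.
have Th : T^t* = T by rewrite -ST; apply/matrixP => i j; rewrite -[in RHS]Sh !mxE.
have inv_adj (M : 'M[C]_2) : M \in unitmx -> M^t* = M -> (invmx M)^t* = invmx M.
  move=> Mu Mh; apply: (can_inj (mulKmx Mu)).
  by rewrite mulmxV // -{1}Mh -adjM mulVmx // adj1.
rewrite (inv_adj T Tu Th) (inv_adj S Su Sh) !adjB !adjM adjK.
move: (w^t*) (q^t*) (a^t*) SS TT Ta => w' q' b SS TT Ta.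
have SaT : Si *m a = a *m Ti.
  by apply: (can_inj (mulKmx Su)); rewrite mulKVmx // mulmxA Sa mulmxK.
have TbS : Ti *m b = b *m Si.
  by apply: (can_inj (mulKmx Tu)); rewrite mulKVmx // mulmxA Ta mulmxK.
have Pu : (1%:M - b *m a) *m (Ti *m Ti) = 1%:M.
  by rewrite -TT -mulmxA (mulKVmx Tu) mulmxV.
have Qu : (1%:M - a *m b) *m (Si *m Si) = 1%:M.
  by rewrite -SS -mulmxA (mulKVmx Su) mulmxV.
have Qa : Si *m Si *m a = a *m (Ti *m Ti).
  by rewrite -[LHS]mulmxA SaT mulmxA SaT mulmxA.
have Pb : Ti *m Ti *m b = b *m (Si *m Si).
  by rewrite -[LHS]mulmxA TbS mulmxA TbS mulmxA.
rewrite !(mulmxA _ Ti) !(mulmxA _ Si) -(mulmxA _ Ti Ti) -(mulmxA _ Si Si).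
exact: isometry_core Qa Pb Pu Qu.
Qed.

(** The linear fractional map underlying Phi_a is an isometry for the
indefinite form |w|^2 - |q|^2. *)
Lemma Phi_isometry (w q : 'cV[C]_2) :
  vn (Ti *m (w - a^t* *m q)) - vn (Si *m (q - a *m w)) = vn w - vn q.
Proof.
have h := isometry_form w q.
have h1 := vn_form (Ti *m (w - a^t* *m q)); rewrite adjM in h1.
have h2 := vn_form (Si *m (q - a *m w)); rewrite adjM in h2.
have e1 := etrans (congr2 (fun s t : C => s - t) (esym h1) (esym h2)) h.
exact: real_sub_inj (etrans e1 (congr2 (fun s t : C => s - t) (vn_form w) (vn_form q))).
Qed.

Lemma Phi_vn x (v : 'cV[C]_2) : contr x -> exists w : 'cV[C]_2,
  [/\ vn v - vn (cartan_Phi a x *m v) = vn w - vn (x *m w) & (w == 0) = (v == 0)].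
Proof.
move=> cx; have Du := defect_den_unit cx; have Tu := dr_T dr.
pose u := invmx (1%:M - a^t* *m x) *m (T *m v).
have vE : v = Ti *m (u - a^t* *m (x *m u)).
  have -> : u - a^t* *m (x *m u) = (1%:M - a^t* *m x) *m u.
    by rewrite mulmxBl mul1mx mulmxA.
  by rewrite /u mulKVmx // mulKmx.
exists u; split.
  by rewrite -(Phi_isometry u (x *m u)) -(Phi_apply u cx) -vE.
apply/eqP/eqP => [h|h]; last by rewrite /u h !mulmx0.
by rewrite vE h !mulmx0 subr0 mulmx0.
Qed.

Lemma Phi_contr x : contr x -> contr (cartan_Phi a x).
Proof.
by move=> cx v; have [w [h _]] := Phi_vn v cx; rewrite -subr_ge0 h subr_ge0.
Qed.

Lemma Phi_scontr x : scontr x -> scontr (cartan_Phi a x).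
Proof.
move=> sx v v0; have [w [h h0]] := Phi_vn v (scontrW sx).
by rewrite -subr_gt0 h subr_gt0 sx // h0.
Qed.

Lemma PhiNK x : contr x -> cartan_Phi (- a) (cartan_Phi a x) = x.
Proof.
move=> cx; have Du := defect_den_unit cx.
have [Su Tu ST Sh SS TT Sa Ta PhiE PhiNE] := dr.
have SaT : Si *m a = a *m Ti.
  by apply: (can_inj (mulKmx Su)); rewrite mulKVmx // mulmxA Sa mulmxK.
have TaS : Ti *m a^t* = a^t* *m Si.
  by apply: (can_inj (mulKmx Tu)); rewrite mulKVmx // mulmxA Ta mulmxK.
have [D DE] : exists D, D = 1%:M - a^t* *m x by exact: (ex_intro _ _ erefl).
have [N NE] : exists N, N = Ti *m D by exact: (ex_intro _ _ erefl).
rewrite -DE in Du.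
have Nu : N \in unitmx by rewrite NE unitmx_mul unitmx_inv Tu.
have [y yE] : exists y, y = cartan_Phi a x by exact: (ex_intro _ _ erefl).
rewrite -yE; have yN : y *m N = Si *m (x - a).
  by rewrite yE PhiE NE -DE mulmxA (mulmxK Tu) (mulmxKV Du).
have e1 : (1%:M + a^t* *m y) *m N = T.
  rewrite mulmxDl mul1mx -mulmxA yN mulmxA -TaS -mulmxA NE -mulmxDr.
  by rewrite DE mulmxBr addrA subrK -TT (mulKmx Tu).
have e2 : (y + a) *m N = S *m x.
  rewrite mulmxDl yN NE mulmxA -SaT -mulmxA -mulmxDr DE mulmxBr mulmx1 mulmxA.
  have -> : x - a + (a - a *m a^t* *m x) = (1%:M - a *m a^t*) *m x.
    rewrite addrA subrK (mulmxBl 1%:M (a *m a^t*) x) (mul1mx x); exact: erefl.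
  by rewrite -SS -mulmxA (mulKmx Su).
have e3 : 1%:M + a^t* *m y \in unitmx.
  have h : (1%:M + a^t* *m y) *m N \in unitmx by rewrite e1.
  by rewrite unitmx_mul in h; case/andP: h.
by rewrite PhiNE -[X in _ *m X]e1 mulmxA (mulmxKV e3) -mulmxA e2 (mulKmx Su).
Qed.

Lemma Phi_sym x : x^T = x -> contr x -> (cartan_Phi a x)^T = cartan_Phi a x.
Proof.
move=> xs cx; have Du := defect_den_unit cx.
have [Su Tu ST Sh SS TT Sa Ta PhiE _] := dr.
have TS : T^T = S by rewrite -ST trmxK.
have as2 : (a^t*)^T = a^t* by rewrite map_trmx trmxK as_.
rewrite PhiE; move: (a^t*) as2 Du SS TT {Ta PhiE} => b bs Du SS TT.
exact: (Phi_sym_core Su Tu ST TS as_ bs xs Du SS TT).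
Qed.

Lemma Phi_self : cartan_Phi a a = 0.
Proof. by rewrite (dr_Phi dr) subrr mulmx0 !mul0mx. Qed.

End WithRoots.
End Cartan.

(** * Holomorphic discs of contractive symmetric matrices *)

Section MatrixFunctions.
Variable R : realType.
Local Notation C := (Cplx R).
Implicit Types (z w c : C).

Definition mhol m n (F : C -> 'M[C]_(m, n)) z :=
  forall i j, differentiable (fun w => F w i j) z.

Lemma mhol_cst m n (A : 'M[C]_(m, n)) z : mhol (fun=> A) z.
Proof. by move=> i j; apply: diffable_cst. Qed.

Lemma mholB m n (F G : C -> 'M[C]_(m, n)) z :
  mhol F z -> mhol G z -> mhol (fun w => F w - G w) z.
Proof.
move=> hF hG i j; apply: differentiable_ext (diffableB (hF i j) (hG i j)) => w.
by rewrite !mxE.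
Qed.

Lemma mholM m n p (F : C -> 'M[C]_(m, n)) (G : C -> 'M[C]_(n, p)) z :
  mhol F z -> mhol G z -> mhol (fun w => F w *m G w) z.
Proof.
move=> hF hG i j.
apply: (@differentiable_ext _ (fun w => \sum_(k <- index_enum 'I_n) F w i k * G w k j)).
  by move=> w; rewrite mxE.
by apply: diffable_sum => k; apply: diffableM.
Qed.

Lemma mholZ m n (k : C -> C) (F : C -> 'M[C]_(m, n)) z :
  differentiable k z -> mhol F z -> mhol (fun w => k w *: F w) z.
Proof.
move=> hk hF i j; apply: differentiable_ext (diffableM hk (hF i j)) => w.
by rewrite mxE.
Qed.

Lemma diffable_det n (F : C -> 'M[C]_n) z : mhol F z ->
  differentiable (fun w => \det (F w)) z.
Proof.
move=> hF; rewrite /determinant; apply: diffable_sum => s.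
by apply: diffableM (diffable_cst _ _) _; apply: diffable_prod => i.
Qed.

Lemma cont_neq0 (f : C -> C) z : cont f z -> f z != 0 ->
  exists2 r : R, 0 < r & forall w, nr (w - z) < r -> f w != 0.
Proof.
move=> cf f0; have n0 : 0 < nr (f z) by rewrite nr_gt0.
have [r r0 hr] := cf _ (divr_gt0 n0 (ltr0Sn R 1)); exists r => // w /hr h.
rewrite -nr_gt0; have := nrD (f z - f w) (f w); rewrite subrK (nrB (f z)); lra.
Qed.

Lemma mhol_inv n (F : C -> 'M[C]_n) z : mhol F z -> F z \in unitmx ->
  mhol (fun w => invmx (F w)) z.
Proof.
move=> hF Fu i j; have dd := diffable_det hF.
have d0 : \det (F z) != 0 by rewrite unitmxE unitfE in Fu.
have [r r0 hr] := cont_neq0 (differentiable_cont dd) d0.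
apply: (@differentiable_near _ (fun w => (\det (F w))^-1 * cofactor (F w) j i) _ _ _ r0).
  by move=> w /hr dw; rewrite /invmx unitmxE unitfE dw !mxE.
apply: diffableM (diffableV dd d0) _; rewrite /cofactor.
apply: diffableM (diffable_cst _ _) _; apply: diffable_det => k l.
by apply: differentiable_ext (hF (lift j k) (lift i l)) => w; rewrite !mxE.
Qed.

Lemma Phi_mhol (a S T : 'M[C]_2) (F : C -> 'M[C]_2) z : defect_roots a S T ->
  mhol F z -> 1%:M - a^t* *m F z \in unitmx ->
  mhol (fun w => cartan_Phi a (F w)) z.
Proof.
move=> dr hF u i j.
apply: (@differentiable_ext _ (fun w =>
  (invmx S *m (F w - a) *m invmx (1%:M - a^t* *m F w) *m T) i j)).
  by move=> w; rewrite (dr_Phi dr).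
have cst (A : 'M[C]_2) : mhol (fun=> A) z by apply: mhol_cst.
apply: (mholM (mholM (mholM (cst _) (mholB hF (cst _))) _) (cst _)).
exact: mhol_inv (mholB (cst _) (mholM (cst _) hF)) u.
Qed.

(** The bilinear form depends holomorphically on x, which brings contractions within
the reach of the maximum principle. *)
Lemma contr_bilinear (x : 'M[C]_2) : contr x <-> forall v w : 'cV[C]_2,
  nr ((v^T *m x *m w) 0 0) <= (vn v + vn w) / 2.
Proof.
have dot (v u : 'cV[C]_2) : nr ((v^T *m u) 0 0) <= (vn v + vn u) / 2.
  rewrite mxE; apply: le_trans (nr_sum _ _ _) _.
  rewrite /vn -big_split mulr_suml /=; apply: ler_sum => i _.
  rewrite mxE nrM; have := sqr_ge0 (nr (v i 0) - nr (u i 0)); lra.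
split=> [h v w|h w].
  rewrite -mulmxA; apply: le_trans (dot _ _) _; have := h w; lra.
have := h (map_mx Num.conj (x *m w)) w; rewrite vn_conj -mulmxA map_trmx.
by rewrite vn_form nr_real ger0_norm ?vn_ge0 //; lra.
Qed.

Lemma contr_entry (x : 'M[C]_2) i j : contr x -> nr (x i j) <= 1.
Proof.
move=> /contr_bilinear h.
have vd (k : 'I_2) : vn (delta_mx k 0 : 'cV[C]_2) = 1.
  rewrite /vn (bigD1 k) //= big1 ?addr0; first by rewrite mxE !eqxx nr1 expr1n.
  by move=> l lk; rewrite mxE (negbTE lk) nr0 expr0n.
have := h (delta_mx i 0) (delta_mx j 0).
rewrite !vd trmx_delta -rowE -colE !mxE; lra.
Qed.

Lemma cont_le_punctured (f : C -> C) c (K : R) : nr c < 1 -> cont f c ->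
  (forall z, nr z < 1 -> z != c -> nr (f z) <= K) -> nr (f c) <= K.
Proof.
move=> c1 cf h; apply: (@le_eps _ _ _ 1) => e e0; rewrite mul1r.
have [d d0 hd] := cf e e0.
pose t := Num.min d (1 - nr c) / 2.
have m0 : 0 < Num.min d (1 - nr c) by rewrite lt_min d0 subr_gt0.
have m1 : Num.min d (1 - nr c) <= d by rewrite ge_min lexx.
have m2 : Num.min d (1 - nr c) <= 1 - nr c by rewrite ge_min lexx orbT.
have t0 : 0 < t by rewrite /t; lra.
pose w : C := c + t%:C%C.
have tn : nr (w - c) = t by rewrite /w addrAC subrr add0r nr_real gtr0_norm.
have w1 : nr w < 1.
  by have := nrD (w - c) c; rewrite subrK tn /t; lra.
have wc : w != c by rewrite -subr_eq0 -nr_gt0 tn.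
have h1 := h w w1 wc; have h2 : nr (f w - f c) <= e by apply: hd; rewrite tn /t; lra.
by have := nrD (f c - f w) (f w); rewrite subrK (nrB (f c)); lra.
Qed.

Definition schur_disc (F : C -> 'M[C]_2) := forall z, nr z < 1 ->
  [/\ mhol F z, (F z)^T = F z & contr (F z)].

(** Division is possible entry by entry, and contractivity of the quotient is the
scalar Schwarz lemma for the bilinear forms v^T F w; the symmetry of the quotient
extends to c by continuity. *)
Lemma schur_divide (F : C -> 'M[C]_2) c : nr c < 1 -> schur_disc F -> F c = 0 ->
  exists2 G, schur_disc G &
    forall z, nr z < 1 -> F z = mob (- c) z *: G z.
Proof.
move=> c1 sF Fc; have cN : nr (- c) < 1 by rewrite nrN.
have dF i j z : nr z < 1 -> differentiable (fun w => F w i j) z.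
  by move=> z1; have [h _ _] := sF z z1.
have FM i j z : nr z < 1 -> nr (F z i j) <= 1.
  by move=> z1; have [_ _ h] := sF z z1; apply: contr_entry.
have /choice [g /all_and3 [dg gE _]] := fun ij : 'I_2 * 'I_2 =>
  divide c1 (dF ij.1 ij.2) (FM ij.1 ij.2).
pose G z : 'M[C]_2 := \matrix_(i, j) ((1 - c^* * z) * g (i, j) z).
have FG z : nr z < 1 -> F z = mob (- c) z *: G z.
  move=> z1; apply/matrixP => i j; have := gE (i, j) z; rewrite /= Fc mxE add0r !mxE => ->.
  have := mob_den_neq0 cN (ltW z1).
  by rewrite /mob rmorphN mulNr => d0; field.
have mG z : nr z < 1 -> mhol G z.
  move=> z1 i j; apply: (@differentiable_ext _ (fun w => (1 - c^* * w) * g (i, j) w)).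
    by move=> w; rewrite mxE.
  apply: diffableM (dg (i, j) z z1).
  exact: diffableB (diffable_cst _ _) (diffableM (diffable_cst _ _) (diffable_id _)).
have bz z : nr z < 1 -> z != c -> mob (- c) z != 0.
  move=> z1 zc; rewrite mulf_neq0 ?subr_eq0 //.
  by rewrite invr_neq0 // mob_den_neq0 // ltW.
have extend (k : 'M[C]_2 -> C) (K : R) :
    (forall z, nr z < 1 -> differentiable (fun w => k (G w)) z) ->
    (forall z, nr z < 1 -> z != c -> nr (k (G z)) <= K) ->
    forall z, nr z < 1 -> nr (k (G z)) <= K.
  move=> dk hk z z1; have [->|zc] := eqVneq z c; last exact: hk.
  exact: cont_le_punctured c1 (differentiable_cont (dk c c1)) hk.
exists G => // z z1; split; first exact: mG.
- apply/matrixP => i j; rewrite mxE; apply/eqP; rewrite -subr_eq0 -nr_eq0.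
  rewrite eq_le nr_ge0 andbT; apply: (extend (fun M => M j i - M i j)) z1.
    by move=> y y1; apply: diffableB; apply: mG.
  move=> y y1 yc; have [_ /matrixP/(_ i j) h _] := sF y y1.
  rewrite mxE FG // !mxE in h.
  by rewrite !mxE (mulfI (bz y y1 yc) h) subrr nr0.
- apply/contr_bilinear => v w.
  apply: (extend (fun M => (v^T *m M *m w) 0 0)) z1.
    move=> y y1; have cst n m (A : 'M[C]_(n, m)) : mhol (fun=> A) y by apply: mhol_cst.
    exact: (mholM (mholM (cst _ _ _) (mG y y1)) (cst _ _ _)).
  move=> y y1 yc; set K := (vn v + vn w) / 2.
  have m1 : nr (mob (- c) y) < 1 by apply: mob_disc.
  have mE : mob c (mob (- c) y) = y by rewrite -{1}[c]opprK mobK // ltW.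
  have h : nr ((v^T *m F y *m w) 0 0) <= K * nr (mob (- c) y).
    rewrite -{1}mE; apply: (@schwarz _ (fun t => (v^T *m F (mob c t) *m w) 0 0)) m1.
    + move=> t t1; have mt := mob_disc c1 t1.
      apply: (@diffable_comp _ (mob c) (fun y => (v^T *m F y *m w) 0 0) t
        (mob_diffable c1 (ltW t1))).
      have cst n m (A : 'M[C]_(n, m)) : mhol (fun=> A) (mob c t) by apply: mhol_cst.
      have [mF _ _] := sF _ mt.
      exact: (mholM (mholM (cst _ _ _) mF) (cst _ _ _)).
    + move=> t t1; have [_ _ /contr_bilinear cF] := sF _ (mob_disc c1 t1).
      exact: cF.
    + by rewrite mob0 Fc mulmx0 mul0mx mxE.
  have b0 : 0 < nr (mob (- c) y) by rewrite nr_gt0 bz.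
  move: h; rewrite FG // -scalemxAr -scalemxAl mxE nrM (mulrC (nr _)).
  by rewrite ler_pM2r.
Qed.

Lemma vn_sub (x y : 'cV[C]_2) :
  vn (x - y) = vn x + vn y - 2 * complex.Re ((y^t* *m x) 0 0).
Proof.
rewrite mxE (big_morph _ (@reD R) (re0 R)) mulr_sumr /vn -big_split -sumrB /=.
by apply: eq_bigr => i _; rewrite !mxE !nr_sqr !reimE; ring.
Qed.

Lemma eq_of_inner_product (x y : 'cV[C]_2) (k : R) :
  complex.Re ((y^t* *m x) 0 0) = k -> vn x <= k -> vn y = k -> x = y.
Proof.
move=> xy xk yk; apply/eqP; rewrite -subr_eq0 -vn_eq0 eq_le vn_ge0 andbT vn_sub.
by rewrite xy; lra.
Qed.

(** A contractive disc which is not strictly contractive at one point is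
isometric on a fixed vector, by the strong maximum principle; the symmetry gives
the second relation. *)
Lemma boundary_const (F : C -> 'M[C]_2) z0 : schur_disc F -> nr z0 < 1 ->
  ~ scontr (F z0) -> exists p q : 'cV[C]_2, p != 0 /\ forall z, nr z < 1 ->
    F z *m p = q /\ F z *m map_mx Num.conj q = map_mx Num.conj p.
Proof.
move=> sF z01 ns.
have [p [p0 pF]] : exists p : 'cV[C]_2, p != 0 /\ vn p <= vn (F z0 *m p).
  apply: contrapT => H; apply: ns => v v0; rewrite ltNge; apply/negP => h.
  by apply: H; exists v.
pose q := F z0 *m p; have vq : vn q = vn p.
  by apply/eqP; rewrite eq_le pF andbT; have [_ _ ->] := sF z0 z01.
exists p, q; split=> // z z1.
have vp : 0 < vn p by rewrite vn_gt0.
pose k : C := (vn p)%:C%C; have k0 : k != 0 by rewrite -nr_gt0 nr_real gtr0_norm.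
have cst n m (A : 'M[C]_(n, m)) y : mhol (fun=> A) y by apply: mhol_cst.
pose f y := (q^t* *m F y *m p) 0 0 / k.
have f0 : f z0 = 1 by rewrite /f -mulmxA -/q vn_form vq divff.
have df y : nr y < 1 -> differentiable f y.
  move=> y1; apply: diffableM (diffable_cst _ _); have [mF _ _] := sF y y1.
  exact: (mholM (mholM (cst _ _ _ _) mF) (cst _ _ _ _)).
have fM y : nr y < 1 -> nr (f y) <= 1.
  move=> y1; have [_ _ /contr_bilinear cF] := sF y y1.
  rewrite nr_div nr_real gtr0_norm // ler_pdivrMr // mul1r.
  have := cF (map_mx Num.conj q) p; rewrite vn_conj map_trmx vq; lra.
have fz : f z = 1.
  by rewrite (strong_max df fM z01 _ z1) f0 // nr1.
have e1 : (q^t* *m (F z *m p)) 0 0 = k.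
  by move: fz; rewrite /f mulmxA => /(congr1 (fun t => t * k)); rewrite divfK // mul1r.
have [_ Fs cF] := sF z z1.
split; apply: (eq_of_inner_product (k := vn p)).
- exact: (congr1 (fun t : C => complex.Re t) e1).
- exact: cF.
- exact: vq.
- suff -> : ((map_mx Num.conj p)^t* *m (F z *m map_mx Num.conj q)) 0 0 = k by [].
  rewrite -e1; have <- : ((q^t* *m (F z *m p))^T) 0 0 = (q^t* *m (F z *m p)) 0 0.
    by rewrite mxE.
  have a1 : (map_mx Num.conj p)^t* = p^T by apply/matrixP => i j; rewrite !mxE conjCK.
  have a2 : (q^t*)^T = map_mx Num.conj q by apply/matrixP => i j; rewrite !mxE.
  by rewrite (trmx_mul (q^t*)) (trmx_mul (F z) p) Fs a1 a2 -(mulmxA p^T).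
- by apply: le_trans (cF _) _; rewrite vn_conj vq.
- exact: vn_conj.
Qed.

End MatrixFunctions.

(** * Discs mapping one polynomial vector to another *)

Section Degree.
Variable R : realType.
Local Notation C := (Cplx R).
Implicit Types (z w c : C) (p q : nat -> 'cV[C]_2) (F G : C -> 'M[C]_2).

(** A polynomial is a sequence of coefficients with a separate degree bound d, since
reversing the coefficients depends on d and not on the actual degree. *)
Definition ev (d : nat) p z : 'cV[C]_2 := \sum_(k < d.+1) z ^+ k *: p k.

(** The polynomial z^d conj (p (1 / conj z)). *)
Definition sharp (d : nat) p (k : nat) : 'cV[C]_2 := map_mx Num.conj (p (d - k)%N).

(** F maps the nonzero polynomial p of degree at most d to the polynomial q.  The
second equation expresses that F is isometric on p on the unit circle, where a
symmetric contraction with F p = q and |p| = |q| satisfies F (conj q) = conj p.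
It turns the vanishing of q at 0 into a drop of the degree of p, which is what
makes the Schur algorithm terminate. *)
Definition inner_degree (d : nat) F := exists p q : nat -> 'cV[C]_2,
  (exists2 z, nr z < 1 & ev d p z != 0) /\
  forall z, nr z < 1 -> F z *m ev d p z = ev d q z /\
    F z *m ev d (sharp d q) z = ev d (sharp d p) z.

Lemma ev_eq d p q z : (forall k, (k <= d)%N -> p k = q k) -> ev d p z = ev d q z.
Proof. by move=> h; apply: eq_bigr => k _; rewrite h // -ltnS. Qed.

Lemma ev_linear d (A B : 'M[C]_2) p q z :
  ev d (fun k => A *m (p k - B *m q k)) z = A *m (ev d p z - B *m ev d q z).
Proof.
rewrite /ev [B *m _]mulmx_sumr -sumrB mulmx_sumr; apply: eq_bigr => k _.
by rewrite -scalemxAr -scalerBr -scalemxAr.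
Qed.

Lemma ev_0 p d : ev d p 0 = p 0%N.
Proof.
rewrite /ev big_ord_recl /= expr0 scale1r big1 ?addr0 // => k _.
by rewrite /= exprS mul0r scale0r.
Qed.

Lemma ev_const p z : ev 0 p z = p 0%N.
Proof. by rewrite /ev big_ord_recl big_ord0 addr0 expr0 scale1r. Qed.

(** Multiplication by u + v z; the test k <= d discards the irrelevant coefficients
of p, so that the result has degree at most d + 1. *)
Definition mul_lin d (u v : C) p (k : nat) : 'cV[C]_2 :=
  (if (k <= d)%N then u *: p k else 0) + (if k is j.+1 then v *: p j else 0).

Lemma ev_mul_lin d u v p z : ev d.+1 (mul_lin d u v p) z = (u + v * z) *: ev d p z.
Proof.
rewrite /ev /mul_lin.
under eq_bigr do rewrite scalerDr.
rewrite big_split /= scalerDl; congr (_ + _).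
  rewrite big_ord_recr /= ltnn scaler0 addr0 scaler_sumr.
  apply: eq_bigr => k _; rewrite -ltnS ltn_ord !scalerA; congr (_ *: _); ring.
rewrite big_ord_recl /= scaler0 add0r scaler_sumr.
apply: eq_bigr => k _; rewrite !scalerA exprS; congr (_ *: _); ring.
Qed.

Lemma sharp_mul_lin d u v p k : (k <= d.+1)%N ->
  sharp d.+1 (mul_lin d u v p) k = mul_lin d v^* u^* (sharp d p) k.
Proof.
move=> kd; rewrite /sharp /mul_lin map_mxD addrC; congr (_ + _).
  case: (leqP k d) => h.
    by rewrite subSn //= map_mxZ.
  have -> : k = d.+1 by apply/eqP; rewrite eqn_leq kd.
  by rewrite subnn map_mx0.
case: k kd => [|k] kd; first by rewrite subn0 ltnn map_mx0.
by rewrite subSS leq_subr /= map_mxZ.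
Qed.

Lemma inner_degree_const F (p q : 'cV[C]_2) : p != 0 ->
  (forall z, nr z < 1 -> F z *m p = q /\
     F z *m map_mx Num.conj q = map_mx Num.conj p) -> inner_degree 0 F.
Proof.
move=> p0 h; exists (fun=> p), (fun=> q); split.
  by exists 0; rewrite ?nr0 ?ltr01 // ev_const.
by move=> z /h; rewrite !ev_const.
Qed.

(** The two relations force |p| = |q|. *)
Lemma inner_degree0 F : inner_degree 0 F -> ~ scontr (F 0).
Proof.
move=> [p [q [[z z1 pz] h]]] s; have n0 : nr (0 : C) < 1 by rewrite nr0 ltr01.
have [] := h 0 n0; rewrite !ev_const /sharp /= => h1 h2.
rewrite ev_const in pz; have := s _ pz; rewrite h1 => h3.
have := scontrW s (map_mx Num.conj (q 0%N)); rewrite h2 !vn_conj => h4.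
by have := lt_le_trans h3 h4; rewrite ltxx.
Qed.

Lemma inner_degree_mob d F c : nr c < 1 -> inner_degree d F ->
  inner_degree d.+1 (fun z => mob (- c) z *: F z).
Proof.
move=> c1 [p [q [[z0 z01 pz] h]]]; have cN : nr (- c) < 1 by rewrite nrN.
have nz z : nr z < 1 -> 1 + - c^* * z != 0.
  by move=> z1; rewrite -rmorphN mob_den_neq0 // ltW.
exists (mul_lin d 1 (- c^*) p), (mul_lin d (- c) 1 q); split.
  by exists z0 => //; rewrite ev_mul_lin scaler_eq0 negb_or pz nz.
move=> z z1; have [h1 h2] := h z z1.
have mE : mob (- c) z * (1 + - c^* * z) = - c + 1 * z.
  by rewrite /mob rmorphN divfK ?nz // mul1r addrC.
have e1 : ev d.+1 (sharp d.+1 (mul_lin d (- c) 1 q)) z =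
    (1 + - c^* * z) *: ev d (sharp d q) z.
  rewrite -ev_mul_lin; apply: ev_eq => k kd; rewrite sharp_mul_lin //.
  by rewrite rmorphN rmorph1.
have e2 : ev d.+1 (sharp d.+1 (mul_lin d 1 (- c^*) p)) z =
    (- c + 1 * z) *: ev d (sharp d p) z.
  rewrite -ev_mul_lin; apply: ev_eq => k kd; rewrite sharp_mul_lin //.
  by rewrite rmorphN rmorph1 /= conjCK.
rewrite e1 e2 !ev_mul_lin; split.
  by rewrite -scalemxAl -scalemxAr scalerA mE h1.
by rewrite -scalemxAl -scalemxAr scalerA mE h2.
Qed.

(** Dividing by z lowers the degree of both polynomials: F 0 = 0 makes q vanish
at 0, and, through the second relation, also the leading coefficient of p. *)
Lemma inner_degree_div d F G :
  (forall z, nr z < 1 -> mhol G z) ->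
  (forall z, nr z < 1 -> F z = z *: G z) ->
  inner_degree d.+1 F -> inner_degree d G.
Proof.
move=> mG FG [p [q [[z0 z01 pz] h]]].
have n0 : nr (0 : C) < 1 by rewrite nr0 ltr01.
have [] := h 0 n0; rewrite (FG 0 n0) scale0r !mul0mx !ev_0 => q0 p0.
have {}p0 : p d.+1 = 0.
  by apply/eqP; rewrite -map_conj_eq0; apply/eqP; rewrite [RHS]p0 /sharp subn0.
pose q' k := q k.+1.
have pE z : ev d.+1 p z = ev d p z.
  by rewrite /ev big_ord_recr /= p0 scaler0 addr0.
have qE z : ev d.+1 q z = z *: ev d q' z.
  rewrite /ev big_ord_recl /= -q0 scaler0 add0r scaler_sumr.
  by apply: eq_bigr => k _; rewrite scalerA -exprS.
have spE z : ev d.+1 (sharp d.+1 p) z = z *: ev d (sharp d p) z.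
  rewrite /ev big_ord_recl /= {1}/sharp /= p0 map_mx0 scaler0 add0r scaler_sumr.
  by apply: eq_bigr => k _; rewrite scalerA -exprS /sharp /= subSS.
have sqE z : ev d.+1 (sharp d.+1 q) z = ev d (sharp d q') z.
  rewrite /ev big_ord_recr /= {2}/sharp subnn -q0 map_mx0 scaler0 addr0.
  by apply: eq_bigr => k _; rewrite /sharp /q' subSn // -ltnS.
have evh p' (z : C) : mhol (ev d p') z.
  move=> i j; apply: (@differentiable_ext _
    (fun w => \sum_(k <- index_enum 'I_d.+1) w ^+ k * p' k i j)).
    by move=> w; rewrite summxE; apply: eq_bigr => k _; rewrite mxE.
  apply: diffable_sum => k; apply: diffableM (diffable_cst _ _).
  exact: diffableX (diffable_id _).
have extend (u v : nat -> 'cV[C]_2) :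
    (forall z, nr z < 1 -> (z *: G z) *m ev d u z = z *: ev d v z) ->
    forall z, nr z < 1 -> G z *m ev d u z = ev d v z.
  move=> huv; have off z : nr z < 1 -> z != 0 -> G z *m ev d u z = ev d v z.
    move=> z1 zn; apply: (scalerI zn); rewrite -huv //; exact: scalemxAl.
  move=> z z1; have [->|zn] := eqVneq z 0; last exact: off.
  apply/matrixP => i j; apply/eqP; rewrite -subr_eq0 -nr_eq0 eq_le nr_ge0 andbT.
  apply: (@cont_le_punctured _ (fun w => (G w *m ev d u w) i j - ev d v w i j) _ _ n0).
    apply: differentiable_cont; apply: diffableB; last exact: evh.
    exact: (mholM (mG 0 n0) (evh _ _)).
  by move=> w w1 wn; rewrite off // subrr nr0.
exists p, q'; split; first by exists z0 => //; rewrite -pE.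
move=> z z1; split.
  by apply: extend z1 => w w1; have [] := h w w1; rewrite pE qE FG.
by apply: extend z1 => w w1; have [] := h w w1; rewrite sqE spE FG.
Qed.

Lemma inner_degree_ext d F G : (forall z, nr z < 1 -> F z = G z) ->
  inner_degree d F -> inner_degree d G.
Proof.
move=> FG [p [q [p0 h]]]; exists p, q; split=> // z z1.
by rewrite -FG //; apply: h.
Qed.

Lemma inner_degree_Phi d a F : a^T = a -> scontr a ->
  (forall z, nr z < 1 -> contr (F z)) ->
  inner_degree d F -> inner_degree d (fun z => cartan_Phi a (F z)).
Proof.
move=> as_ ca cF [p [q [[z0 z01 pz] h]]].
have [S [T dr]] := defect_rootsP as_ ca.
have as2 : a^t* = map_mx Num.conj a by rewrite as_.
have STi : map_mx Num.conj (invmx S) = invmx T.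
  rewrite map_invmx; congr invmx; rewrite -(dr_ST dr) -{1}(dr_Sadj dr).
  exact: map_conjK.
have TSi : map_mx Num.conj (invmx T) = invmx S by rewrite -STi map_conjK.
pose p' k := invmx T *m (p k - a^t* *m q k).
pose q' k := invmx S *m (q k - a *m p k).
have spE z : ev d (sharp d p') z =
    invmx S *m (ev d (sharp d p) z - a *m ev d (sharp d q) z).
  rewrite -ev_linear; apply: ev_eq => k kd.
  by rewrite /sharp /p' map_mxM TSi map_mxB map_mxM as2 map_conjK.
have sqE z : ev d (sharp d q') z =
    invmx T *m (ev d (sharp d q) z - a^t* *m ev d (sharp d p) z).
  rewrite -ev_linear; apply: ev_eq => k kd.
  by rewrite /sharp /q' map_mxM STi map_mxB map_mxM as2.
exists p', q'; split.
  exists z0 => //; rewrite ev_linear; have [<- _] := h z0 z01.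
  apply: contraNneq pz => e; apply/eqP; have Du := defect_den_unit as_ ca (cF z0 z01).
  have {}e : (1%:M - a^t* *m F z0) *m ev d p z0 = 0.
    have := congr1 (mulmx T) e; rewrite (mulKVmx (dr_T dr)) mulmx0 => {}e.
    by rewrite mulmxBl (mul1mx (ev d p z0)) -(mulmxA (a^t*)).
  by have := congr1 (mulmx (invmx (1%:M - a^t* *m F z0))) e; rewrite (mulKmx Du) mulmx0.
move=> z z1; have [h1 h2] := h z z1.
have e3 : ev d p' z = _ := ev_linear d (invmx T) (a^t*) p q z.
have e4 : ev d q' z = _ := ev_linear d (invmx S) a q p z.
have k1 := Phi_apply as_ ca dr (ev d p z) (cF z z1).
have k2 := Phi_apply as_ ca dr (ev d (sharp d q) z) (cF z z1).
rewrite h1 in k1; rewrite h2 in k2.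
split; first exact: etrans (congr1 (mulmx _) e3) (etrans k1 (esym e4)).
exact: etrans (congr1 (mulmx _) (sqE z)) (etrans k2 (esym (spE z))).
Qed.

End Degree.

(** * Discs touching the boundary of the Cartan domain *)

Section TwoByTwo.
Variable R : realType.
Local Notation C := (Cplx R).

Lemma ord2P (P : 'I_2 -> Prop) : P 0 -> P 1 -> forall i, P i.
Proof.
move=> p0 p1 [[|[|//]] h].
  by rewrite (_ : Ordinal h = 0) //; apply: val_inj.
by rewrite (_ : Ordinal h = 1) //; apply: val_inj.
Qed.

Lemma sum2 (f : 'I_2 -> C) : \sum_i f i = f 0 + f 1.
Proof.
rewrite big_ord_recl big_ord_recl big_ord0 addr0; congr (f _ + f _).
exact: val_inj.
Qed.

Lemma sum2R (f : 'I_2 -> R) : \sum_i f i = f 0 + f 1.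
Proof.
rewrite big_ord_recl big_ord_recl big_ord0 addr0; congr (f _ + f _).
exact: val_inj.
Qed.

Lemma mul2E m n (A : 'M[C]_(m, 2)) (B : 'M[C]_(2, n)) i j :
  (A *m B) i j = A i 0 * B 0 j + A i 1 * B 1 j.
Proof. by rewrite mxE sum2. Qed.

Definition mx2 (a b c d : C) : 'M[C]_2 :=
  \matrix_(i, j) (if i == 0 then if j == 0 then a else b
                  else if j == 0 then c else d).

Lemma mx2_00 a b c d : mx2 a b c d 0 0 = a. Proof. by rewrite mxE. Qed.
Lemma mx2_01 a b c d : mx2 a b c d 0 1 = b. Proof. by rewrite mxE. Qed.
Lemma mx2_10 a b c d : mx2 a b c d 1 0 = c. Proof. by rewrite mxE. Qed.
Lemma mx2_11 a b c d : mx2 a b c d 1 1 = d. Proof. by rewrite mxE. Qed.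
Definition mx2E := (mx2_00, mx2_01, mx2_10, mx2_11).

Lemma mx2_eta (A : 'M[C]_2) : A = mx2 (A 0 0) (A 0 1) (A 1 0) (A 1 1).
Proof.
apply/matrixP; apply: ord2P; apply: ord2P; by rewrite mx2E.
Qed.

Lemma mx2_mul a b c d a' b' c' d' : mx2 a b c d *m mx2 a' b' c' d' =
  mx2 (a * a' + b * c') (a * b' + b * d') (c * a' + d * c') (c * b' + d * d').
Proof. by rewrite [LHS]mx2_eta !mul2E !mx2E. Qed.

Lemma mx2_tr a b c d : (mx2 a b c d)^T = mx2 a c b d.
Proof. by rewrite [LHS]mx2_eta; congr mx2; rewrite mxE mx2E. Qed.

Lemma diag2E x y : diag2 x y = mx2 x 0 0 y.
Proof.
rewrite [LHS]mx2_eta; congr mx2; rewrite /diag2 !mxE /= ?mulr1n ?mulr0n //.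
Qed.

Lemma det2 (A : 'M[C]_2) : \det A = A 0 0 * A 1 1 - A 0 1 * A 1 0.
Proof.
have l0 : lift (0 : 'I_2) 0 = 1 by apply: val_inj.
have l1 : lift (1 : 'I_2) 0 = 0 by apply: val_inj.
rewrite (expand_det_row A 0) sum2 /cofactor !det_mx11 !mxE l0 l1 /=.
by rewrite expr0 expr1; ring.
Qed.

Definition rot (u v : C) := mx2 u (- v^*) v u^*.

Lemma rot_unitary u v : nr u ^+ 2 + nr v ^+ 2 = 1 -> rot u v \is unitarymx.
Proof.
move=> /(congr1 (real_complex R)); rewrite rmorphD rmorph1 /= !sqr_nrC => n1.
apply/unitarymxP; have -> : (rot u v)^t* = mx2 u^* v^* (- v) u.
  rewrite /rot mx2_tr [LHS]mx2_eta; congr mx2;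
  by rewrite mxE mx2E ?rmorphN /= ?conjCK.
have -> : 1%:M = mx2 1 0 0 1 by rewrite [LHS]mx2_eta; congr mx2; rewrite !mxE.
rewrite /rot mx2_mul; congr mx2; rewrite -?n1; ring.
Qed.

(** A symmetric matrix F with F (conj u) = u, where u is a unit vector, is
determined by the value W of the form on the orthogonal direction. *)
Lemma rot_diag (F : 'M[C]_2) u v : F^T = F -> nr u ^+ 2 + nr v ^+ 2 = 1 ->
  F 0 0 * u^* + F 0 1 * v^* = u -> F 0 1 * u^* + F 1 1 * v^* = v ->
  F = rot u v *m diag2 1 (F 0 0 * v ^+ 2 - 2 * F 0 1 * u * v + F 1 1 * u ^+ 2)
        *m (rot u v)^T.
Proof.
move=> Fs /(congr1 (real_complex R)); rewrite rmorphD rmorph1 /= !sqr_nrC.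
move=> n1 e1 e2; have F10 : F 1 0 = F 0 1 by rewrite -[in LHS]Fs mxE.
rewrite [LHS]mx2_eta F10 diag2E /rot mx2_tr !mx2_mul.
move: (F 0 0) (F 0 1) (F 1 1) (u^*) (v^*) n1 e1 e2 => x h y a b n1 e1 e2.
have N0 : u * a + v * b - 1 = 0 by rewrite n1 subrr.
have E1 : x * a + h * b - u = 0 by rewrite e1 subrr.
have E2 : h * a + y * b - v = 0 by rewrite e2 subrr.
pose W := x * v ^+ 2 - 2 * h * u * v + y * u ^+ 2; rewrite -/W.
have k1 : x = u ^+ 2 + W * b ^+ 2.
  (* The difference is a combination of the three vanishing expressions N0, E1, E2. *)
  apply/eqP; rewrite -subr_eq0; have -> : x - (u ^+ 2 + W * b ^+ 2) =
    - x * (u * a + v * b - 1) * (u * a + v * b + 1) + u ^+ 2 * (u * a + v * b - 1)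
    + (2 * u * v * b + u ^+ 2 * a) * (x * a + h * b - u)
    - u ^+ 2 * b * (h * a + y * b - v) by rewrite /W; ring.
  by rewrite N0 E1 E2 !(mulr0, mul0r) subr0 !addr0.
have k2 : h = u * v - W * a * b.
  apply/eqP; rewrite -subr_eq0; have -> : h - (u * v - W * a * b) =
    - h * (u * a + v * b - 1) * (u * a + v * b + 1) + u * v * (u * a + v * b - 1)
    + v ^+ 2 * b * (x * a + h * b - u)
    + u ^+ 2 * a * (h * a + y * b - v) by rewrite /W; ring.
  by rewrite N0 E1 E2 !(mulr0, mul0r) !addr0.
have k3 : y = v ^+ 2 + W * a ^+ 2.
  apply/eqP; rewrite -subr_eq0; have -> : y - (v ^+ 2 + W * a ^+ 2) =
    - y * (u * a + v * b - 1) * (u * a + v * b + 1) + v ^+ 2 * (u * a + v * b - 1)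
    + (2 * u * v * a + v ^+ 2 * b) * (h * a + y * b - v)
    - v ^+ 2 * a * (x * a + h * b - u) by rewrite /W; ring.
  by rewrite N0 E1 E2 !(mulr0, mul0r) subr0 !addr0.
move: W k1 k2 k3 => W k1 k2 k3.
congr mx2; [rewrite k1 | rewrite k2 | rewrite k2 | rewrite k3]; ring.
Qed.

Lemma fixed_unit_vector (u : 'cV[C]_2) : u != 0 ->
  exists a b : C, nr a ^+ 2 + nr b ^+ 2 = 1 /\
  forall G : 'M[C]_2, G *m map_mx Num.conj u = u ->
    G 0 0 * a^* + G 0 1 * b^* = a /\ G 1 0 * a^* + G 1 1 * b^* = b.
Proof.
move=> u0; have v0 : 0 < vn u by rewrite vn_gt0.
pose t : R := (Num.sqrt (vn u))^-1.
have t0 : 0 < t by rewrite invr_gt0 sqrtr_gt0.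
have tc : (t%:C%C : C)^* = t%:C%C by exact: conjc_real.
exists (t%:C%C * u 0 0), (t%:C%C * u 1 0); split.
  rewrite !nrM !exprMn -mulrDr nr_real gtr0_norm //.
  have -> : nr (u 0 0) ^+ 2 + nr (u 1 0) ^+ 2 = vn u by rewrite /vn sum2R.
  by rewrite /t exprVn sqr_sqrtr ?ltW // mulVf // gt_eqF.
move=> G /matrixP Gu; have := Gu 0 0; have := Gu 1 0; rewrite !mul2E !mxE.
move=> e2 e1; rewrite !rmorphM /= tc.
by split; [rewrite -[in RHS]e1 | rewrite -[in RHS]e2]; ring.
Qed.

(** The antilinear map u |-> F (conj u) exchanges conj p and q, hence fixes
q + conj p, or i q when this sum vanishes. *)
Theorem boundary_form (F : C -> 'M[C]_2) z0 : schur_disc F -> nr z0 < 1 ->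
  ~ scontr (F z0) -> exists (u v : C) (W : C -> C),
  [/\ nr u ^+ 2 + nr v ^+ 2 = 1, forall z, nr z < 1 -> differentiable W z,
      forall z, nr z < 1 -> nr (W z) <= 1 &
      forall z, nr z < 1 -> F z = rot u v *m diag2 1 (W z) *m (rot u v)^T].
Proof.
move=> sF z01 ns; have [p [q [p0 h]]] := boundary_const sF z01 ns.
have [x [x0 hx]] : exists x : 'cV[C]_2, x != 0 /\
    forall z, nr z < 1 -> F z *m map_mx Num.conj x = x.
  have [s0|s0] := eqVneq (q + map_mx Num.conj p) 0; last first.
    exists (q + map_mx Num.conj p); split=> // z z1; have [h1 h2] := h z z1.
    by rewrite map_mxD map_conjK mulmxDr h1 h2 addrC.
  have qE : map_mx Num.conj p = - q by apply/eqP; rewrite -addr_eq0 addrC s0.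
  exists ('i *: q); split.
    rewrite scaler_eq0 negb_or neq0Ci /=; apply: contraNneq p0 => q0.
    by rewrite -map_conj_eq0 qE q0 oppr0.
  move=> z z1; have [_ h2] := h z z1.
  by rewrite map_mxZ /= conjCi -scalemxAr h2 qE scaleNr scalerN opprK.
have [u [v [n1 huv]]] := fixed_unit_vector x0.
exists u, v, (fun z => F z 0 0 * v ^+ 2 - 2 * F z 0 1 * u * v + F z 1 1 * u ^+ 2).
split; [exact: n1 | | |]; move=> z z1; have [mF Fs cF] := sF z z1.
- have cst (k : C) := @diffable_cst R k z.
  apply: diffableD; last exact: diffableM (mF 1 1) (cst _).
  apply: diffableB; first exact: diffableM (mF 0 0) (cst _).
  exact: diffableM (diffableM (diffableM (cst _) (mF 0 1)) (cst _)) (cst _).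
- pose w : 'cV[C]_2 := \col_i (if i == 0 then - v else u).
  have wE : vn w = 1 by rewrite /vn sum2R !mxE /= nrN addrC.
  have := (proj1 (contr_bilinear _) cF) w w; rewrite wE.
  have -> : (w^T *m F z *m w) 0 0 =
      F z 0 0 * v ^+ 2 - 2 * F z 0 1 * u * v + F z 1 1 * u ^+ 2.
    have F10 : F z 1 0 = F z 0 1 by rewrite -[in LHS]Fs mxE.
    by rewrite !mul2E !mxE /= F10; ring.
  by lra.
- have F10 : F z 1 0 = F z 0 1 by rewrite -[in LHS]Fs mxE.
  have [e1 e2] := huv _ (hx z z1); rewrite F10 in e2.
  exact: rot_diag.
Qed.

End TwoByTwo.

(** * The Schur algorithm *)

Section SchurAlgorithm.
Variable R : realType.
Local Notation C := (Cplx R).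
Implicit Types (z w c : C) (F G : C -> 'M[C]_2).

Definition sschur_disc F := schur_disc F /\ forall z, nr z < 1 -> scontr (F z).

Lemma Phi_schur_disc (a : 'M[C]_2) F : a^T = a -> scontr a -> schur_disc F ->
  schur_disc (fun z => cartan_Phi a (F z)).
Proof.
move=> as_ ca sF z z1; have [mF Fs cF] := sF z z1.
have [S [T dr]] := defect_rootsP as_ ca; split.
- exact: Phi_mhol dr mF (defect_den_unit as_ ca cF).
- exact: (Phi_sym as_ ca dr).
- exact: (Phi_contr as_ ca dr).
Qed.

(** Phi_{F c} (F z) vanishes at c and can be divided by a Moebius factor. *)
Lemma schur_step F c : nr c < 1 -> sschur_disc F ->
  exists G, [/\ schur_disc G,
    forall z, nr z < 1 -> cartan_Phi (F c) (F z) = mob (- c) z *: G z &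
    forall z, nr z < 1 -> F z = cartan_Phi (- F c) (mob (- c) z *: G z)].
Proof.
move=> c1 [sF ssF]; have [_ as_ _] := sF c c1; have ca := ssF c c1.
have [S [T dr]] := defect_rootsP as_ ca.
have [G sG GE] := schur_divide c1 (Phi_schur_disc as_ ca sF) (Phi_self dr).
exists G; split=> // z z1; rewrite -GE //; have [_ _ cF] := sF z z1.
by rewrite (PhiNK as_ ca dr).
Qed.

Lemma scontrN (a : 'M[C]_2) : scontr a -> scontr (- a).
Proof. by move=> h v v0; rewrite mulNmx vnN h. Qed.

Lemma trmxN (a : 'M[C]_2) : a^T = a -> (- a)^T = - a.
Proof. by move=> h; rewrite linearN /= h. Qed.

Lemma mob_closed_disc c z : nr c < 1 -> nr z <= 1 -> nr (mob c z) <= 1.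
Proof.
move=> c1 z1; rewrite -(@ler_pXn2r _ 2) ?nnegrE ?nr_ge0 // expr1n -subr_ge0.
rewrite nr_mob //; apply: divr_ge0; last exact: sqr_ge0.
have h1 : nr c ^+ 2 <= 1 by rewrite -(expr1n _ 2) lerXn2r ?nnegrE ?nr_ge0 // ltW.
have h2 : nr z ^+ 2 <= 1 by rewrite -(expr1n _ 2) lerXn2r ?nnegrE ?nr_ge0.
by apply: mulr_ge0; rewrite subr_ge0.
Qed.

Lemma scontrZ (x : 'M[C]_2) k : nr k <= 1 -> scontr x -> scontr (k *: x).
Proof.
move=> k1 h v v0; apply: le_lt_trans (h v v0); rewrite -scalemxAl vnZ.
rewrite ler_piMl ?vn_ge0 // -(expr1n _ 2).
by rewrite lerXn2r ?nnegrE ?nr_ge0.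
Qed.

Definition near_closed_disc G := forall z, nr z <= 1 ->
  exists2 r : R, 0 < r & forall w, nr (w - z) < r -> mhol G w.

Lemma near_closed_disc_Phi (a : 'M[C]_2) G c : a^T = a -> scontr a -> nr c < 1 ->
  near_closed_disc G -> (forall z, nr z <= 1 -> scontr (G z)) ->
  near_closed_disc (fun z => cartan_Phi a (mob (- c) z *: G z)).
Proof.
move=> as_ ca c1 nG sG z z1; have cN : nr (- c) < 1 by rewrite nrN.
have [S [T dr]] := defect_rootsP as_ ca.
pose X w := mob (- c) w *: G w.
have [r1 r10 h1] := nG z z1.
have dden w : differentiable (fun w => 1 + (- c)^* * w) w.
  apply: diffableD (diffable_cst _ _) _.
  exact: diffableM (diffable_cst _ _) (diffable_id _).
have [r2 r20 h2] := cont_neq0 (differentiable_cont (dden z)) (mob_den_neq0 cN z1).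
have mX w : nr (w - z) < r1 -> nr (w - z) < r2 -> mhol X w.
  move=> w1 w2; apply: mholZ (h1 w w1).
  apply: diffable_div (dden w) (h2 w w2).
  exact: diffableD (diffable_id _) (diffable_cst _ _).
have zz : nr (z - z) = 0 by rewrite subrr nr0.
have mXz : mhol X z by apply: mX; rewrite zz.
have cX : contr (X z) by apply/scontrW/scontrZ; [exact: mob_closed_disc | exact: sG].
have mden w : mhol X w -> mhol (fun w => 1%:M - a^t* *m X w) w.
  move=> mXw; exact: mholB (mhol_cst _ _) (mholM (mhol_cst _ _) mXw).
have det0 : \det (1%:M - a^t* *m X z) != 0.
  by have := defect_den_unit as_ ca cX; rewrite unitmxE unitfE.
have [r3 r30 h3] := cont_neq0 (differentiable_cont (diffable_det (mden z mXz))) det0.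
exists (Num.min r1 (Num.min r2 r3)); first by rewrite !lt_min r10 r20.
move=> w; rewrite !lt_min => /and3P[w1 w2 w3].
apply: (Phi_mhol dr (mX w w1 w2)); rewrite unitmxE unitfE; exact: h3.
Qed.

(** If the Schur algorithm at the points of s runs to its end, then replacing the
last disc by a constant and going back gives an interpolant which is strictly
contractive up to the circle.  Otherwise it meets a disc touching the boundary,
which has degree 0, and each step back raises the degree by one. *)
Theorem interpolation_or_degree (s : seq C) F : (forall c, c \in s -> nr c < 1) ->
  sschur_disc F ->
  (exists G, [/\ near_closed_disc G,
     forall z, nr z <= 1 -> (G z)^T = G z /\ scontr (G z) &
     forall c, c \in s -> G c = F c]) \/
  exists2 d, (d < size s)%N & inner_degree d F.
Proof.
elim: s F => [|c s IH] F s1 ssF.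
  left; exists (fun=> 0); split=> // [z _|z _].
    by exists 1 => // w _; apply: mhol_cst.
  by split; [exact: trmx0 | move=> v v0; rewrite mul0mx vn0 vn_gt0].
have c1 : nr c < 1 by apply: s1; rewrite mem_head.
have [sF sc] := ssF; have [_ as_ _] := sF c c1; have ca := sc c c1.
case: s IH s1 => [|e s] IH s1.
  left; exists (fun=> F c); split=> // [z _|y]; last by rewrite inE => /eqP ->.
  by exists 1 => // w _; apply: mhol_cst.
have [G [sG GE FE]] := schur_step c1 ssF.
have as_N := trmxN as_; have caN := scontrN ca.
have cN : nr (- c) < 1 by rewrite nrN.
have up d : inner_degree d G -> inner_degree d.+1 F.
  move=> /(inner_degree_mob c1) dG.
  have := inner_degree_Phi as_N caN _ dG; move=> /(_ _) H.
  apply: inner_degree_ext (H _) => [z z1|z z1]; first by rewrite -FE.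
  rewrite -GE //; have [S [T dr]] := defect_rootsP as_ ca.
  by have [_ _ cF] := sF z z1; exact: (Phi_contr as_ ca dr).
have [scG|] := pselect (forall z, nr z < 1 -> scontr (G z)); last first.
  move=> /existsNP [z0 /not_implyP [z01 nz]]; right; exists 1%N => //.
  have [p [q [p0 h]]] := boundary_const sG z01 nz.
  exact: up (inner_degree_const p0 h).
have [|[H [nH HH HE]]|[d ds dG]] := IH G _ (conj sG scG).
- by move=> y ys; apply: s1; rewrite inE ys orbT.
- left; have [S [T dr]] := defect_rootsP as_N caN.
  exists (fun z => cartan_Phi (- F c) (mob (- c) z *: H z)); split.
  + apply: (near_closed_disc_Phi as_N caN c1 nH) => z z1.
    by have [_ h] := HH z z1.
  + move=> z z1; have [Hs Hc] := HH z z1.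
    have sX := scontrZ (mob_closed_disc cN z1) Hc; split.
      by apply: (Phi_sym as_N caN dr) (scontrW sX); rewrite linearZ /= Hs.
    exact: (Phi_scontr as_N caN dr).
  + move=> y; rewrite inE => /orP[/eqP ->|ys].
      by rewrite [RHS](FE c c1) /mob subrr mul0r !scale0r.
    by rewrite HE // -FE //; apply: s1; rewrite inE ys orbT.
- by right; exists d.+1; [exact: ds | exact: up].
Qed.

Lemma scale_diag2 z (W : C) : diag2 z (z * W) = z *: diag2 1 W.
Proof.
rewrite !diag2E [RHS]mx2_eta; congr mx2; rewrite [RHS]mxE mx2E;
by rewrite ?mulr1 ?mulr0.
Qed.

(** The Schur algorithm at 0 lowers the degree at each step; it stops at a disc
touching the boundary, at the latest when the degree is 0. *)
Theorem schur_algorithm d F : sschur_disc F -> inner_degree d F ->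
  exists (s : seq 'M[C]_2) (Z : C -> C) (U : 'M[C]_2),
  [/\ (0 < size s <= d)%N, forall a, a \in s -> cartan_II a,
      [/\ forall z, nr z < 1 -> differentiable Z z,
          forall z, nr z < 1 -> nr (Z z) < 1 & Z 0 = 0],
      U \is unitarymx &
      forall z, nr z < 1 ->
        F z = lift_disc s (fun z => U *m diag2 z (Z z) *m U^T) z].
Proof.
have n0 : nr (0 : C) < 1 by rewrite nr0 ltr01.
elim: d F => [|d IH] F ssF dF.
  by case: (inner_degree0 dF); apply: (proj2 ssF).
have [sF sc] := ssF; have [_ as_ _] := sF 0 n0; have ca := sc 0 n0.
have [G [sG GE FE]] := schur_step n0 ssF.
have m0 z : mob (- 0) z = z.
  by rewrite /mob oppr0 rmorph0 mul0r !addr0 divr1.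
have cN : cartan_II (- F 0).
  by apply/cartan_IIP; split; [exact: trmxN | exact: scontrN].
have dG : inner_degree d G.
  apply: (inner_degree_div (F := fun z => cartan_Phi (F 0) (F z))).
  - by move=> z z1; have [] := sG z z1.
  - by move=> z z1; rewrite GE // m0.
  - apply: inner_degree_Phi dF => // z z1; by have [] := sF z z1.
have [scG|] := pselect (forall z, nr z < 1 -> scontr (G z)); last first.
  move=> /existsNP [z0 /not_implyP [z01 nz]].
  have [u [v [W [n1 dW W1 GW]]]] := boundary_form sG z01 nz.
  exists [:: - F 0], (fun z => z * W z), (rot u v); split.
  - by [].
  - by move=> a; rewrite inE => /eqP ->.
  - split.
    + by move=> z z1; apply: diffableM (diffable_id _) (dW z z1).
    + move=> z z1; rewrite nrM; apply: le_lt_trans (z1).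
      exact: ler_piMr (nr_ge0 _) (W1 z z1).
    + by rewrite mul0r.
  - exact: rot_unitary.
  - move=> z z1; rewrite /= scale_diag2 -scalemxAr -scalemxAl -(GW z z1).
    by rewrite -{2}(m0 z); exact: FE.
have [s [Z [U [sd sC HZ HU GU]]]] := IH G (conj sG scG) dG.
case: s sd sC GU => [//|a s] sd sC GU.
exists [:: - F 0, a & s], Z, U; split.
- exact: sd.
- by move=> b; rewrite inE => /orP[/eqP ->|/sC].
- exact: HZ.
- exact: HU.
- by move=> z z1; rewrite [LHS](FE z z1) m0 (GU z z1).
Qed.

End SchurAlgorithm.

(** * The symmetrised bidisc *)

Section SymmetrisedBidisc.
Variable R : realType.
Local Notation C := (Cplx R).
Implicit Types (z w c : C).

Lemma diffable_fst (x : C * C) : differentiable (fun y : C * C => y.1) x.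
Proof. by apply: linear_differentiable => y; exact: cvg_fst. Qed.

Lemma diffable_snd (x : C * C) : differentiable (fun y : C * C => y.2) x.
Proof. by apply: linear_differentiable => y; exact: cvg_snd. Qed.

Lemma bidiscP (x : C * C) : symmetrised_bidisc x <->
  exists z w, [/\ nr z < 1, nr w < 1 & x = (z + w, z * w)].
Proof.
split=> [[[z w] [/= z1 w1] <-]|[z [w [z1 w1 ->]]]].
  by exists z, w; rewrite -!discE.
by exists (z, w) => //; split; rewrite /= discE.
Qed.

(** The map induced on the symmetrised bidisc by applying the Moebius map
z |-> (z - c) / (1 - conj c z) to both coordinates of the bidisc. *)
Definition sym_mob c (x : C * C) : C * C :=
  (((1 + c * c^*) * x.1 - 2 * c - 2 * c^* * x.2) /
     (1 - c^* * x.1 + c^* ^+ 2 * x.2),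
   (x.2 - c * x.1 + c ^+ 2) / (1 - c^* * x.1 + c^* ^+ 2 * x.2)).

Lemma sym_mob_den c z w :
  1 - c^* * (z + w) + c^* ^+ 2 * (z * w) = (1 + (- c)^* * z) * (1 + (- c)^* * w).
Proof. by rewrite rmorphN; ring. Qed.

Lemma sym_mobE c z w : nr c < 1 -> nr z < 1 -> nr w < 1 ->
  sym_mob c (z + w, z * w) =
  (mob (- c) z + mob (- c) w, mob (- c) z * mob (- c) w).
Proof.
move=> c1 z1 w1; have cN : nr (- c) < 1 by rewrite nrN.
have dz := mob_den_neq0 cN (ltW z1); have dw := mob_den_neq0 cN (ltW w1).
rewrite /sym_mob /= sym_mob_den /mob.
by rewrite rmorphN in dz dw *; congr pair; field; rewrite dz dw.
Qed.

Lemma sym_mob_holo c : nr c < 1 -> holomorphic_on (@symmetrised_bidisc R) (sym_mob c).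
Proof.
move=> c1 x /bidiscP [z [w [z1 w1 xE]]].
have cN : nr (- c) < 1 by rewrite nrN.
have d0 : 1 - c^* * x.1 + c^* ^+ 2 * x.2 != 0.
  by rewrite xE /= sym_mob_den mulf_neq0 // mob_den_neq0 // ltW.
have d1 := diffable_fst x; have d2 := diffable_snd x.
have cst (k : C) : differentiable (fun _ : C * C => k) x by apply: differentiable_cst.
have dd : differentiable (fun y : C * C => 1 - c^* * y.1 + c^* ^+ 2 * y.2) x.
  apply: (differentiableD (differentiableB (cst 1) _) _).
    exact: (differentiableM (cst _) d1).
  exact: (differentiableM (cst _) d2).
apply: differentiable_pair.
  apply: (differentiableM _ (differentiableV dd d0)).
  apply: (differentiableB (differentiableB _ (cst _)) _).
    exact: (differentiableM (cst _) d1).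
  exact: (differentiableM (cst _) d2).
apply: (differentiableM _ (differentiableV dd d0)).
apply: (differentiableD (differentiableB d2 _) (cst _)).
exact: (differentiableM (cst _) d1).
Qed.

Lemma sym_mob_bidisc c x : nr c < 1 -> symmetrised_bidisc x ->
  symmetrised_bidisc (sym_mob c x).
Proof.
move=> c1 /bidiscP [z [w [z1 w1 ->]]]; rewrite sym_mobE //.
apply/bidiscP; exists (mob (- c) z), (mob (- c) w).
by split=> //; apply: mob_disc; rewrite ?nrN.
Qed.

Lemma sym_mobK c x : nr c < 1 -> symmetrised_bidisc x ->
  sym_mob (- c) (sym_mob c x) = x.
Proof.
move=> c1 /bidiscP [z [w [z1 w1 ->]]]; have cN : nr (- c) < 1 by rewrite nrN.
by rewrite sym_mobE // sym_mobE ?mob_disc // !mobK // ltW.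
Qed.

Lemma sym_mob_automorphism c : nr c < 1 ->
  automorphism (@symmetrised_bidisc R) (sym_mob c).
Proof.
move=> c1; have cN : nr (- c) < 1 by rewrite nrN.
split; [exact: sym_mob_holo | by move=> x; apply: sym_mob_bidisc |].
exists (sym_mob (- c)); split.
- exact: sym_mob_holo.
- by move=> x; apply: sym_mob_bidisc.
- by move=> x; apply: sym_mobK.
- by move=> x xD; rewrite -{1}[c]opprK sym_mobK.
Qed.

(** For (s, p) = (z + w, z w), the equation s = 2 (u v + conj (u v) p) says that an
involution of the disc with the fixed point c = v / conj u exchanges z and w.
Moving c to 0 turns this involution into z |-> - z. *)
Lemma sym_mob_flat u v p : nr u ^+ 2 + nr v ^+ 2 = 1 -> u != 0 ->
  (sym_mob (v / u^*) (2 * (u * v + u^* * v^* * p), p)).1 = 0.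
Proof.
move=> /(congr1 (real_complex R)); rewrite rmorphD rmorph1 /= !sqr_nrC => n1 u0.
have a0 : u^* != 0 by rewrite conjC_eq0.
apply/eqP; rewrite mulf_eq0; apply/orP; left; apply/eqP.
rewrite rmorphM fmorphV /= conjCK; move: (u^*) (v^*) n1 a0 => a b n1 a0.
have -> : (1 + v / a * (b * u^-1)) * (2 * (u * v + a * b * p)) - 2 * (v / a) -
   2 * (b * u^-1) * p =
  2 * (u * v + a * b * p) * (u * a + v * b - 1) / (u * a).
  by field; rewrite u0 a0.
by rewrite n1 subrr mulr0 mul0r.
Qed.

Lemma sum_sqr_lt (u v : C) : nr u ^+ 2 + nr v ^+ 2 = 1 -> nr v < nr u ->
  u != 0 /\ nr (v / u^*) < 1.
Proof.
move=> n1 vu; have u0 : u != 0 by rewrite -nr_gt0 (le_lt_trans (nr_ge0 v)).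
by split=> //; rewrite nr_div nr_conj ltr_pdivrMr ?mul1r // nr_gt0.
Qed.

(** When b = 2 u v has modulus 1, the equation reads (z - b) (1 - conj b w) = 0. *)
Lemma flat_not_unimodular u v z w : nr u ^+ 2 + nr v ^+ 2 = 1 -> nr u = nr v ->
  nr z < 1 -> nr w < 1 -> z + w <> 2 * (u * v + u^* * v^* * (z * w)).
Proof.
move=> n1 uv z1 w1 h; pose b := 2 * (u * v).
have nb : nr b = 1 by rewrite /b !nrM nr_nat uv; rewrite uv in n1; lra.
have bb : b * b^* = 1 by rewrite -sqr_nrC nb expr1n rmorph1.
have bc : b^* = 2 * (u^* * v^*).
  by rewrite /b !rmorphM rmorph_nat.
have : (z - b) * (1 - b^* * w) = 0.
  have -> : (z - b) * (1 - b^* * w) = (z + w) - (b + b^* * (z * w)) + w * (b * b^* - 1).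
    by ring.
  by rewrite bb subrr mulr0 addr0 bc /b h; ring.
move/eqP; rewrite mulf_eq0 => /orP[|]; rewrite subr_eq0 => /eqP e.
  by move: z1; rewrite e nb ltxx.
have : nr (1 : C) < 1 by rewrite e nrM nr_conj nb mul1r.
by rewrite nr1 ltxx.
Qed.

(** The corresponding point of the bidisc consists of the eigenvalues of the matrix x
with its columns exchanged, which is again a strict contraction. *)
Lemma scontr_bidisc (x : 'M[C]_2) : x^T = x -> scontr x ->
  symmetrised_bidisc (2 * x 0 1, x 0 1 ^+ 2 - x 0 0 * x 1 1).
Proof.
move=> xs sx; have x10 : x 1 0 = x 0 1 by rewrite -[in LHS]xs mxE.
pose s : C := sqrtc (x 0 0 * x 1 1).
have sE : s ^+ 2 = x 0 0 * x 1 1 by apply: sqrtc_sqr.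
have eig (t : C) : (t - x 0 1) ^+ 2 = x 0 0 * x 1 1 -> nr t < 1.
  move=> tE; have [w0 [w1 [nz e0 e1]]] : exists w0 w1 : C,
      [/\ (w0 != 0) || (w1 != 0), x 0 0 * w0 = (t - x 0 1) * w1 &
          x 1 1 * w1 = (t - x 0 1) * w0].
    have [t0|t0] := eqVneq (t - x 0 1) 0; last first.
      by exists (t - x 0 1), (x 0 0); rewrite t0; split=> //; rewrite -?expr2 ?tE; ring.
    have [y0|y0] := eqVneq (x 0 0) 0.
      by exists 1, 0; rewrite oner_eq0 t0 y0; split=> //; rewrite ?mulr0 ?mul0r.
    exists 0, 1; rewrite oner_eq0 orbT t0; split=> //; rewrite ?mulr0 ?mul0r //.
    move: tE; rewrite t0 expr0n /= => /esym/eqP; rewrite mulf_eq0 (negbTE y0) /=.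
    by move=> /eqP ->; rewrite mul0r.
  pose w : 'cV[C]_2 := \col_i (if i == 0 then w0 else w1).
  have wn : w != 0.
    apply: contraTneq nz => /matrixP we.
    have := we 0 0; have := we 1 0; rewrite !mxE /= => -> ->.
    by rewrite eqxx.
  have := sx w wn; have -> : vn (x *m w) = nr t ^+ 2 * vn w.
    rewrite /vn !sum2R !mul2E !mxE /= x10.
    have -> : x 0 0 * w0 + x 0 1 * w1 = t * w1 by rewrite e0; ring.
    have -> : x 0 1 * w0 + x 1 1 * w1 = t * w0 by rewrite e1; ring.
    by rewrite !nrM; ring.
  rewrite -[ltRHS]mul1r ltr_pM2r ?vn_gt0 // -(sqr_lt1 (nr_ge0 t)) //.
apply/bidiscP; exists (x 0 1 + s), (x 0 1 - s); split.
- by apply: eig; rewrite addrAC subrr add0r.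
- by apply: eig; rewrite addrAC subrr add0r sqrrN.
- by congr pair; rewrite -?sE; ring.
Qed.

(** By [boundary_form], a lifted disc touching the boundary of the Cartan domain lies
over a flat geodesic s = b + conj b p with b = 2 u v.  Here |b| < 1, since phi has
values in the symmetrised bidisc, and an automorphism makes b vanish. *)
Lemma lift_boundary (phi : C -> C * C) (F : C -> 'M[C]_2) z0 :
  (forall z, nr z < 1 -> symmetrised_bidisc (phi z)) ->
  (forall z, nr z < 1 ->
     phi z = (2 * F z 0 1, F z 0 1 ^+ 2 - F z 0 0 * F z 1 1)) ->
  schur_disc F -> nr z0 < 1 -> ~ scontr (F z0) ->
  exists psi, automorphism (@symmetrised_bidisc R) psi /\
    forall z, nr z < 1 -> (psi (phi z)).1 = 0.
Proof.
move=> phiD phiF sF z01 ns.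
have [u [v [W [n1 _ _ FW]]]] := boundary_form sF z01 ns.
have phiE z : nr z < 1 ->
    phi z = (2 * (u * v + u^* * v^* * (phi z).2), (phi z).2).
  move=> z1; rewrite phiF //= FW // diag2E /rot mx2_tr !mx2_mul !mx2E.
  have := congr1 (real_complex R) n1; rewrite rmorphD rmorph1 /= !sqr_nrC => e1.
  congr pair; move: (u^*) (v^*) e1 => a b e1.
  have -> : (u * 1 + - b * 0) * v + (u * 0 + - b * W z) * a = u * v - W z * a * b.
    by ring.
  set X := (X in _ + a * b * X).
  have -> : X = - W z * (u * a + v * b) ^+ 2 by rewrite /X; ring.
  by rewrite e1; ring.
have n1' : nr v ^+ 2 + nr u ^+ 2 = 1 by rewrite addrC.
have [uv|uv|uv] := ltgtP (nr u) (nr v).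
- have [v0 c1] := sum_sqr_lt n1' uv; exists (sym_mob (u / v^*)).
  split; first exact: sym_mob_automorphism.
  move=> z z1; rewrite phiE // (mulrC u v) (mulrC u^*).
  exact: sym_mob_flat.
- have [u0 c1] := sum_sqr_lt n1 uv; exists (sym_mob (v / u^*)).
  split; first exact: sym_mob_automorphism.
  by move=> z z1; rewrite phiE //; apply: sym_mob_flat.
have [z [w [z1 w1 pE]]] := (bidiscP _).1 (phiD z0 z01).
case: (flat_not_unimodular n1 uv z1 w1).
by have := phiE z0 z01; rewrite pE /= => -[].
Qed.

End SymmetrisedBidisc.

(** * Weak extremals and their liftings *)

Section Main.
Variable R : realType.
Local Notation C := (Cplx R).

Lemma swap_columnsE (A : 'M[C]_2) :
  swap_columns A = mx2 (A 0 1) (A 0 0) (A 1 1) (A 1 0).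
Proof.
rewrite [LHS]mx2_eta /swap_columns /xcol.
by congr mx2; rewrite mxE ?perm.tpermL ?perm.tpermR.
Qed.

(** A strict interpolant of the lifting would project to a map which is forbidden by
weak extremality. *)
Lemma weak_extremal_degree (m : nat) (phi : C -> C * C) (F : C -> 'M[C]_2) :
  weak_extremal (@symmetrised_bidisc R) m phi ->
  (forall z, nr z < 1 ->
     phi z = (2 * F z 0 1, F z 0 1 ^+ 2 - F z 0 0 * F z 1 1)) ->
  sschur_disc F -> exists2 d, (d < m)%N & inner_degree d F.
Proof.
move=> [_ _ [lam [_ lamD nog]]] phiF ssF.
have [||[G [nG HG GE]]|[d dm dF]] := @interpolation_or_degree R (codom lam) F.
- by move=> c /codomP [j ->]; have := lamD j; rewrite discE.
- exact: ssF.
- case: nog; exists (fun z => (2 * G z 0 1, G z 0 1 ^+ 2 - G z 0 0 * G z 1 1)).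
  split.
  + exists [set z | exists2 r : R, 0 < r & forall w, nr (w - z) < r -> mhol G w].
    split.
    * rewrite openE => z [r r0 hr]; apply/nbhs_nrP; exists (r / 2).
        by rewrite divr_gt0.
      move=> w wz; exists (r / 2); first by rewrite divr_gt0.
      move=> y yw; apply: hr; have := nrD (y - w) (w - z); rewrite addrA subrK; lra.
    * by move=> z; rewrite closed_discE; apply: nG.
    * move=> z [r r0 hr]; have mG : mhol G z by apply: hr; rewrite subrr nr0.
      have d2 : differentiable (fun w => 2 * G w 0 1) z.
        exact: diffableM (diffable_cst _ _) (mG 0 1).
      have d3 : differentiable (fun w => G w 0 1 ^+ 2 - G w 0 0 * G w 1 1) z.
        exact: diffableB (diffableX _ (mG 0 1)) (diffableM (mG 0 0) (mG 1 1)).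
      exact: (differentiable_pair d2 d3).
  + by move=> z; rewrite closed_discE => z1; have [Gs sG] := HG z z1; apply: scontr_bidisc.
  + move=> j; rewrite GE ?codom_f // -phiF //.
    by have := lamD j; rewrite discE.
- by exists d => //; move: dm; rewrite size_codom card_ord.
Qed.

End Main.

Theorem theorem17 (R : realType) (m : nat) (phi : Cplx R -> Cplx R * Cplx R) :
  (2 <= m)%N ->
  weak_extremal (@symmetrised_bidisc R) m phi ->
  ~ (exists psi : Cplx R * Cplx R -> Cplx R * Cplx R,
       automorphism (@symmetrised_bidisc R) psi /\
       forall z, disc z -> (psi (phi z)).1 = 0) ->
  exists (n : nat) (a : n.-tuple 'M[Cplx R]_2) (Z : Cplx R -> Cplx R)
         (U : 'M[Cplx R]_2),
    let f := lift_disc a (fun z => U *m diag2 z (Z z) *m U^T) in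
    [/\ (1 <= n <= m.-1)%N,
        (forall i, cartan_II (tnth a i)),
        [/\ holomorphic_on (@disc R) Z, (forall z, disc z -> disc (Z z)) &
            Z 0 = 0],
        U \is unitarymx &
        (forall z, disc z ->
           ((phi z).1 / 2, (phi z).1 / 2, (phi z).2) =
             proj_tetra (swap_columns (f z))) /\
        (~ (forall z, disc z -> royal_variety (phi z)) ->
         forall z, disc z -> f z 0 0 != 0)].
Proof.
move=> m2 wphi notflat; have [dphi phiD _] := wphi.
pose h z := (phi z).1 / 2; pose p z := (phi z).2.
have dphi' z : nr z < 1 -> differentiable phi z.
  by move=> z1; apply: dphi; rewrite discE.
have phiD' z : nr z < 1 -> symmetrised_bidisc (phi z).
  by move=> z1; apply: phiD; rewrite discE.
have dh z : nr z < 1 -> differentiable h z.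
  move=> z1; apply: diffableM (diffable_cst _ _).
  exact: (differentiable_comp (dphi' z z1) (diffable_fst (phi z))).
have dp z : nr z < 1 -> differentiable p z.
  move=> z1; exact: (differentiable_comp (dphi' z z1) (diffable_snd (phi z))).
have hp z : nr z < 1 -> exists w1 w2,
    [/\ nr w1 < 1, nr w2 < 1, h z = (w1 + w2) / 2 & p z = w1 * w2].
  move=> /phiD' /bidiscP [w1 [w2 [l1 l2 E]]]; exists w1, w2.
  by rewrite /h /p E.
have [x [y [dxy xyE nxy xn0]]] := lifting dh dp hp.
pose F z : 'M[Cplx R]_2 := mx2 (x z) (h z) (h z) (y z).
have phiF z : nr z < 1 ->
    phi z = (2 * F z 0 1, F z 0 1 ^+ 2 - F z 0 0 * F z 1 1).
  move=> z1; rewrite /F !mx2E xyE // [LHS]surjective_pairing.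
  by congr pair; rewrite /h /p; [field | ring].
have sF : schur_disc F.
  move=> z z1; split; last 2 first.
  - by rewrite /F mx2_tr.
  - apply/contr_bilinear => v w; have := nxy z z1 (v 0 0) (v 1 0) (w 0 0) (w 1 0).
    have -> : (v^T *m F z *m w) 0 0 = v 0 0 * (x z * w 0 0 + h z * w 1 0) +
        v 1 0 * (h z * w 0 0 + y z * w 1 0).
      by rewrite !mul2E !mxE /=; ring.
    by rewrite /vn !sum2R; lra.
  have [dx dy] := dxy z z1; apply: ord2P; apply: ord2P.
  - by apply: differentiable_ext dx => w; rewrite mx2E.
  - by apply: differentiable_ext (dh z z1) => w; rewrite mx2E.
  - by apply: differentiable_ext (dh z z1) => w; rewrite mx2E.
  - by apply: differentiable_ext dy => w; rewrite mx2E.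
have ssF : sschur_disc F.
  split=> // z0 z01; apply: contrapT => ns; apply: notflat.
  have [psi [psiA psi0]] := lift_boundary phiD' phiF sF z01 ns.
  by exists psi; split=> // z; rewrite discE; apply: psi0.
have [d dm dF] := weak_extremal_degree wphi phiF ssF.
have [s [Z [U [sd sC [dZ ZD Z0] HU FE]]]] := schur_algorithm ssF dF.
exists (size s), (in_tuple s), Z, U => f.
have fE z : nr z < 1 -> f z = F z by move=> z1; rewrite FE.
split.
- by case/andP: sd => -> sd; rewrite (leq_trans sd) // -ltnS prednK // ltnW.
- by move=> i; apply: sC; rewrite mem_tnth.
- split; last exact: Z0.
    by move=> z; rewrite discE; apply: dZ.
  by move=> z; rewrite !discE; apply: ZD.
- exact: HU.
split=> [z|nroyal z]; rewrite discE => z1; rewrite fE //.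
  rewrite /proj_tetra det2 swap_columnsE /F !mx2E.
  have pE : (phi z).2 = h z ^+ 2 - x z * y z by rewrite xyE // /p; ring.
  by congr (_, _, _); rewrite pE; ring.
rewrite /F mx2E; apply: xn0 => //; apply: contrapT => nz; apply: nroyal => w.
rewrite discE => w1; have [w2 [w3 [l1 l2 hE pE]]] := hp w w1.
have hpw : h w ^+ 2 = p w.
  by apply/eqP; apply: contrapT => e; apply: nz; exists w => //; apply/negP.
exists (h w).
  by rewrite discE hE nr_div nr_nat; have := nrD w2 w3; lra.
rewrite hpw [RHS]surjective_pairing; congr pair.
by rewrite /h -mulr_natr; field.
Qed.
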